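(* Let $f_1,f_2,\dots,f_r\in\mathfrak{A}$. The finitely generated ideal $I=(f_1,f_2,\dots,f_r)=f_1\mathfrak{A}+\cdots+f_r\mathfrak{A}$ of $\mathfrak{A}$ is principal if and only if for each $n\in\mathbb{Z}$ there exists $j_n\in\{1,2,\dots,r\}$ such that $(f_j/f_{j_n})(n)\in\mathbb{Q}$ for all $j=1,2,\dots,r$.
   Context: $\mathfrak{A}$ denotes the ring (an integral domain) of integer-valued entire functions, i.e. the entire functions $f:\mathbb{C}\to\mathbb{C}$ with $f(\mathbb{Z})\subset\mathbb{Z}$, under pointwise operations. $(f_j/f_{j_n})(n)$ denotes the value at $n$ of the meromorphic function $f_j/f_{j_n}$ (removable singularities being removed). *)

(* Defs.v *)
From Stdlib Require Import Reals ZArith QArith Qreals Lia.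
From Stdlib Require Import FunctionalExtensionality ProofIrrelevance.
From Coquelicot Require Import Coquelicot.

Definition entire (f : C -> C) : Prop := forall z : C, ex_derive f z.

Definition integer_valued (f : C -> C) : Prop :=
  forall n : Z, exists m : Z, f (RtoC (IZR n)) = RtoC (IZR m).

Record IntEntire : Type := mkIntEntire {
  ie_fun :> C -> C;
  ie_entire : entire ie_fun;
  ie_int : integer_valued ie_fun }.

Lemma ie_ext (f g : IntEntire) : (forall z : C, f z = g z) -> f = g.
Proof.
destruct f as [f fe fi], g as [g ge gi]; simpl; intros H.
assert (E : f = g) by (apply functional_extensionality; exact H).
subst g; f_equal; apply proof_irrelevance.
Qed.

(* Coquelicot puts two normed module structures on C, with the same norm but
   different families of balls: [C_NormedModule], used in [entire], and the
   one derived from [C_AbsRing], to which [is_derive_mult] applies. *)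
Lemma is_derive_C_AbsRing (f : C -> C) (z l : C) :
  @is_derive C_AbsRing C_NormedModule f z l <->
  @is_derive C_AbsRing (AbsRing_NormedModule C_AbsRing) f z l.
Proof. split; intros [[A B D] H]; (split; [split|]); auto. Qed.

Lemma entire_mult (f g : C -> C) :
  entire f -> entire g -> entire (fun z => Cmult (f z) (g z)).
Proof.
intros Hf Hg z.
destruct (Hf z) as [df Df], (Hg z) as [dg Dg].
eexists; apply is_derive_C_AbsRing.
apply (is_derive_mult (K := C_AbsRing) f g).
- apply is_derive_C_AbsRing; exact Df.
- apply is_derive_C_AbsRing; exact Dg.
- exact Cmult_comm.
Qed.

Definition ie_const (k : Z) : IntEntire.
Proof.
refine (mkIntEntire (fun _ => RtoC (IZR k)) _ _).
- intros z; exact (ex_derive_const (K := C_AbsRing) (V := C_NormedModule) _ z).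
- intros n; exists k; reflexivity.
Defined.

Definition ie_plus (f g : IntEntire) : IntEntire.
Proof.
refine (mkIntEntire (fun z => Cplus (f z) (g z)) _ _).
- intros z; apply (ex_derive_plus (K := C_AbsRing) (V := C_NormedModule) f g);
    apply ie_entire.
- intros n; destruct (ie_int f n) as [a Ha], (ie_int g n) as [b Hb].
  exists (a + b)%Z; rewrite Ha, Hb, plus_IZR, RtoC_plus; reflexivity.
Defined.

Definition ie_opp (f : IntEntire) : IntEntire.
Proof.
refine (mkIntEntire (fun z => Copp (f z)) _ _).
- intros z; apply (ex_derive_opp (K := C_AbsRing) (V := C_NormedModule) f);
    apply ie_entire.
- intros n; destruct (ie_int f n) as [a Ha].
  exists (- a)%Z; rewrite Ha, opp_IZR, RtoC_opp; reflexivity.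
Defined.

Definition ie_mult (f g : IntEntire) : IntEntire.
Proof.
refine (mkIntEntire (fun z => Cmult (f z) (g z)) _ _).
- apply entire_mult; apply ie_entire.
- intros n; destruct (ie_int f n) as [a Ha], (ie_int g n) as [b Hb].
  exists (a * b)%Z; rewrite Ha, Hb, mult_IZR, RtoC_mult; reflexivity.
Defined.

Definition IntEntire_AbelianMonoid_mixin : AbelianMonoid.mixin_of IntEntire.
Proof.
apply (AbelianMonoid.Mixin IntEntire ie_plus (ie_const 0));
  intros; apply ie_ext; intros; simpl; ring.
Defined.

Canonical IntEntire_AbelianMonoid :=
  AbelianMonoid.Pack IntEntire IntEntire_AbelianMonoid_mixin IntEntire.

Definition IntEntire_AbelianGroup_mixin :
  AbelianGroup.mixin_of IntEntire_AbelianMonoid.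
Proof.
apply (AbelianGroup.Mixin IntEntire_AbelianMonoid ie_opp).
intros x; apply ie_ext; intros z; simpl; ring.
Defined.

Canonical IntEntire_AbelianGroup :=
  AbelianGroup.Pack IntEntire
    (AbelianGroup.Class _ _ IntEntire_AbelianGroup_mixin) IntEntire.

Definition IntEntire_Ring_mixin : Ring.mixin_of IntEntire_AbelianGroup.
Proof.
apply (Ring.Mixin IntEntire_AbelianGroup ie_mult (ie_const 1));
  intros; apply ie_ext; intros; simpl; ring.
Defined.

Canonical IntEntire_Ring :=
  Ring.Pack IntEntire (Ring.Class _ _ IntEntire_Ring_mixin) IntEntire.

(* [Ring] does not include commutativity. *)
Lemma ie_mult_comm (f g : IntEntire) : mult f g = mult g f.
Proof. apply ie_ext; intros z; apply Cmult_comm. Qed.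

Lemma ie_zeroE (z : C) : (zero : IntEntire) z = RtoC 0.
Proof. reflexivity. Qed.

Lemma ie_oneE (z : C) : (one : IntEntire) z = RtoC 1.
Proof. reflexivity. Qed.

Lemma ie_plusE (f g : IntEntire) (z : C) : plus f g z = Cplus (f z) (g z).
Proof. reflexivity. Qed.

Lemma ie_multE (f g : IntEntire) (z : C) : mult f g z = Cmult (f z) (g z).
Proof. reflexivity. Qed.

(* f_1 K + ... + f_r K; only f 1, ..., f r matter. *)
Definition fg_ideal {K : Ring} (r : nat) (f : nat -> K) (h : K) : Prop :=
  exists a : nat -> K, h = sum_n_m (fun j => mult (f j) (a j)) 1 r.

Definition is_principal {K : Ring} (I : K -> Prop) : Prop :=
  exists d : K, forall h : K, I h <-> exists a : K, h = mult d a.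

(* c is the value at z of the meromorphic function f / g, removable
   singularities being removed: f / g has limit c at z along points other than
   z, so z is not a pole.  The first clause excludes f / 0 with f <> 0, which
   Coquelicot's total division would make the zero function; for f = g = 0
   the quotient is read as the zero function, so that the definition makes
   sense for families all of whose members vanish identically. *)
Definition quotient_value (f g : IntEntire) (z c : C) : Prop :=
  (g = zero -> f = zero) /\
  filterlim (fun w : C => Cdiv (f w) (g w)) (locally' z) (locally c).

(* Main.v *)
Require Import Defs.
From Stdlib Require Import Reals ZArith QArith Qreals.
From Stdlib Require Import Lra Lia List Classical ClassicalEpsilon.
From Coquelicot Require Import Coquelicot.
Open Scope R_scope.

(* If d generates the ideal, write f_j = d a_j and d = sum f_j b_j; then
   sum a_j b_j = 1, so at each integer n some a_j(n) is a nonzero integer, and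
   the quotients f_i / f_j have the values a_i(n) / a_j(n) there.

   Conversely, entire functions form a Bezout domain: f_j = d u_j with
   sum u_j w_j = 1 for entire d, u_j, w_j. By hypothesis (u_j(n))_j is
   proportional to a primitive integer vector for every integer n, and
   multiplying d by the exponential of an entire function that interpolates
   suitable values at the integers makes all u_j integer-valued. The w_j can
   then be corrected, using "sin (pi z)", so as to be integer-valued too, and d,
   being sum f_j w_j, becomes an integer-valued generator.

   The complex analysis needed starts from Goursat's lemma on rectangles:
   Cauchy's formula yields the removal of roots, a bound on their number in a
   disc, and Weierstrass's convergence theorem. Infinite products and
   interpolation series are built from finite blocks of roots, the n-th block
   lying outside the disc of radius n - 1. *)

(** * Complex differentiability *)

(** The scalar that makes the vector of the u_j(n) primitive is nonzero because sum u_j w_j = 1, so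
    it has a logarithm and the scaling extends to an entire unit e. The obstacle is that d / e is
    not visibly integer-valued: this is read off from its expression as a combination of the f_j
    with integer-valued coefficients, so the coefficients must be integer-valued too.

    Infinitely many roots are handled without orders of vanishing or power series. A function is
    replaced by the sequence of its successive quotients, the n-th losing finitely many roots and
    the next one having no (common) root in the disc of radius n. Two sequences that lose the same
    roots are divided locally, at a late enough stage. Each block is finite by the bound on the
    number of roots, which also yields isolated roots and cancellation.

    Removing one root rests on a form of Goursat's lemma that tolerates a point where the function
    is only continuous: the slope of an entire function is a priori no better than that at its
    centre. *)

Definition cont_at (f : C -> C) (z : C) : Prop :=
  forall eps, 0 < eps -> exists del, 0 < del /\
    forall w, Cmod (w - z) < del -> Cmod (f w - f z) < eps.

(* Caratheodory's form of differentiability: products, quotients and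
   composites reduce to algebra and continuity of [phi]. *)
Definition has_deriv (f : C -> C) (z l : C) : Prop :=
  exists phi : C -> C, cont_at phi z /\ phi z = l /\
    forall w, f w = (f z + (w - z) * phi w)%C.

Definition holo (f : C -> C) : Prop := forall z, exists l, has_deriv f z l.

Lemma Cmod_minus_sym (a b : C) : Cmod (a - b) = Cmod (b - a).
Proof. rewrite <- Cmod_opp. f_equal. ring. Qed.

Lemma Cmod_triangle_minus (a b : C) : Cmod (a - b) <= Cmod a + Cmod b.
Proof. rewrite <- (Cmod_opp b). apply Cmod_triangle. Qed.

Lemma Cmod_triangle_inv (a b : C) : Cmod a - Cmod b <= Cmod (a - b).
Proof.
pose proof (Cmod_triangle (a - b) b) as H.
replace (a - b + b)%C with a in H by ring. lra.
Qed.

Lemma Cmod_pos_R (x : R) : 0 <= x -> Cmod x = x.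
Proof. intros H. rewrite Cmod_R. now apply Rabs_pos_eq. Qed.

Lemma Cminus_neq (a b : C) : a <> b -> (a - b)%C <> 0.
Proof. intros H E. apply H. apply Ceq_minus; exact E. Qed.

Lemma cont_at_ext (f g : C -> C) z : (forall w, f w = g w) -> cont_at f z -> cont_at g z.
Proof.
intros E H eps he. destruct (H eps he) as [d [hd K]].
exists d; split; [exact hd|]. intros w hw. rewrite <- !E. now apply K.
Qed.

Lemma cont_at_local (f g : C -> C) z r : 0 < r ->
  (forall w, Cmod (w - z) < r -> f w = g w) -> cont_at f z -> cont_at g z.
Proof.
intros hr E H eps he. destruct (H eps he) as [d [hd K]].
exists (Rmin d r); split; [now apply Rmin_glb_lt|]. intros w hw.
rewrite <- !E.
- apply K. eapply Rlt_le_trans; [exact hw|apply Rmin_l].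
- replace (z - z)%C with (RtoC 0) by ring. now rewrite Cmod_0.
- eapply Rlt_le_trans; [exact hw|apply Rmin_r].
Qed.

Lemma cont_at_const (c z : C) : cont_at (fun _ => c) z.
Proof.
intros eps he. exists 1; split; [lra|]. intros w _.
replace (c - c)%C with (RtoC 0) by ring. now rewrite Cmod_0.
Qed.

Lemma cont_at_id (z : C) : cont_at (fun w => w) z.
Proof. intros eps he. exists eps; split; auto. Qed.

Lemma cont_at_comp (f g : C -> C) z : cont_at g z -> cont_at f (g z) -> cont_at (fun w => f (g w)) z.
Proof.
intros Hg Hf eps he. destruct (Hf eps he) as [d [hd K]].
destruct (Hg d hd) as [e [h L]]. exists e; split; auto.
Qed.

Lemma cont_at_plus (f g : C -> C) z : cont_at f z -> cont_at g z -> cont_at (fun w => f w + g w)%C z.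
Proof.
intros Hf Hg eps he.
destruct (Hf (eps/2)) as [d [hd K]]; [lra|].
destruct (Hg (eps/2)) as [e [h L]]; [lra|].
exists (Rmin d e); split; [now apply Rmin_glb_lt|]. intros w hw.
replace (f w + g w - (f z + g z))%C with ((f w - f z) + (g w - g z))%C by ring.
eapply Rle_lt_trans; [apply Cmod_triangle|].
pose proof (K w (Rlt_le_trans _ _ _ hw (Rmin_l _ _))).
pose proof (L w (Rlt_le_trans _ _ _ hw (Rmin_r _ _))). lra.
Qed.

Lemma cont_at_bounded (f : C -> C) z : cont_at f z ->
  exists d B, 0 < d /\ 0 < B /\ forall w, Cmod (w - z) < d -> Cmod (f w) <= B.
Proof.
intros Hf. destruct (Hf 1) as [d [hd K]]; [lra|].
exists d, (Cmod (f z) + 1); split; [exact hd|split].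
- pose proof (Cmod_ge_0 (f z)); lra.
- intros w hw. pose proof (K w hw). pose proof (Cmod_triangle_inv (f w) (f z)). lra.
Qed.

Lemma cont_at_mult (f g : C -> C) z : cont_at f z -> cont_at g z -> cont_at (fun w => f w * g w)%C z.
Proof.
intros Hf Hg eps he.
destruct (cont_at_bounded f z Hf) as [r [B [hr [hB Bf]]]].
set (G := Cmod (g z) + 1).
assert (hG : 0 < G) by (unfold G; pose proof (Cmod_ge_0 (g z)); lra).
destruct (Hf (eps/2/G)) as [d [hd K]]; [apply Rdiv_lt_0_compat; lra|].
destruct (Hg (eps/2/B)) as [e [h L]]; [apply Rdiv_lt_0_compat; lra|].
exists (Rmin r (Rmin d e)); split; [repeat apply Rmin_glb_lt; auto|]. intros w hw.
pose proof (Bf w (Rlt_le_trans _ _ _ hw (Rmin_l _ _))) as H1.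
pose proof (Rlt_le_trans _ _ _ hw (Rmin_r _ _)) as hw'.
pose proof (K w (Rlt_le_trans _ _ _ hw' (Rmin_l _ _))) as H2.
pose proof (L w (Rlt_le_trans _ _ _ hw' (Rmin_r _ _))) as H3.
replace (f w * g w - f z * g z)%C with (f w * (g w - g z) + (f w - f z) * g z)%C by ring.
eapply Rle_lt_trans; [apply Cmod_triangle|]. rewrite !Cmod_mult.
assert (Cmod (f w) * Cmod (g w - g z) <= B * (eps/2/B)).
{ apply Rmult_le_compat; auto using Cmod_ge_0. lra. }
assert (Cmod (f w - f z) * Cmod (g z) <= eps/2/G * Cmod (g z)).
{ apply Rmult_le_compat_r; auto using Cmod_ge_0. lra. }
assert (eps/2/G * Cmod (g z) < eps/2/G * G).
{ apply Rmult_lt_compat_l; [apply Rdiv_lt_0_compat; lra|unfold G; lra]. }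
replace (B * (eps/2/B)) with (eps/2) in * by (field; lra).
replace (eps/2/G*G) with (eps/2) in * by (field; lra). lra.
Qed.

Lemma cont_at_opp (f : C -> C) z : cont_at f z -> cont_at (fun w => - f w)%C z.
Proof.
intros H. apply cont_at_ext with (fun w => (- (1)) * f w)%C; [intros; ring|].
apply cont_at_mult; [apply cont_at_const|exact H].
Qed.

Lemma cont_at_minus (f g : C -> C) z : cont_at f z -> cont_at g z -> cont_at (fun w => f w - g w)%C z.
Proof. intros; apply cont_at_plus; [assumption|now apply cont_at_opp]. Qed.

Lemma cont_at_neq0 (f : C -> C) z : cont_at f z -> f z <> 0 ->
  exists d, 0 < d /\ forall w, Cmod (w - z) < d -> Cmod (f z) / 2 < Cmod (f w).
Proof.
intros Hf H0. assert (h0 : 0 < Cmod (f z)) by now apply Cmod_gt_0.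
destruct (Hf (Cmod (f z) / 2)) as [d [hd K]]; [lra|].
exists d; split; [exact hd|]. intros w hw. pose proof (K w hw).
rewrite Cmod_minus_sym in H. pose proof (Cmod_triangle_inv (f z) (f w)). lra.
Qed.

Lemma cont_at_inv (f : C -> C) z : cont_at f z -> f z <> 0 -> cont_at (fun w => / f w)%C z.
Proof.
intros Hf H0 eps he. assert (h0 : 0 < Cmod (f z)) by now apply Cmod_gt_0.
destruct (cont_at_neq0 f z Hf H0) as [r [hr L]].
destruct (Hf (eps * (Cmod (f z) * Cmod (f z) / 2))) as [d [hd K]]; [apply Rmult_lt_0_compat; nra|].
exists (Rmin r d); split; [now apply Rmin_glb_lt|]. intros w hw.
pose proof (L w (Rlt_le_trans _ _ _ hw (Rmin_l _ _))) as H1.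
pose proof (K w (Rlt_le_trans _ _ _ hw (Rmin_r _ _))) as H2.
assert (Hw : f w <> 0) by (apply Cmod_gt_0; lra).
replace (/ f w - / f z)%C with ((f z - f w) / (f w * f z))%C by (field; auto).
rewrite Cmod_div by now apply Cmult_neq_0.
rewrite Cmod_mult, Cmod_minus_sym.
assert (hp : Cmod (f z) * Cmod (f z) / 2 < Cmod (f w) * Cmod (f z)) by nra.
apply Rmult_lt_reg_r with (Cmod (f w) * Cmod (f z)); [nra|].
unfold Rdiv at 1. rewrite Rmult_assoc, Rinv_l, Rmult_1_r by nra.
eapply Rlt_trans; [exact H2|]. apply Rmult_lt_compat_l; lra.
Qed.

Lemma cont_at_div (f g : C -> C) z : cont_at f z -> cont_at g z -> g z <> 0 ->
  cont_at (fun w => f w / g w)%C z.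
Proof. intros; apply cont_at_mult; [assumption|now apply cont_at_inv]. Qed.

Lemma cont_at_Cpow (f : C -> C) z n : cont_at f z -> cont_at (fun w => f w ^ n)%C z.
Proof.
intros Hf. induction n as [|n IH]; simpl; [apply cont_at_const|].
now apply cont_at_mult.
Qed.

Lemma has_deriv_cont (f : C -> C) z l : has_deriv f z l -> cont_at f z.
Proof.
intros [phi [Hp [_ E]]].
apply cont_at_ext with (fun w => f z + (w - z) * phi w)%C; [intros; now rewrite <- E|].
apply cont_at_plus; [apply cont_at_const|]. apply cont_at_mult; [|exact Hp].
apply cont_at_minus; [apply cont_at_id|apply cont_at_const].
Qed.

Lemma holo_cont (f : C -> C) : holo f -> forall z, cont_at f z.
Proof. intros H z. destruct (H z) as [l D]. exact (has_deriv_cont f z l D). Qed.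

Lemma has_deriv_ext (f g : C -> C) z l : (forall w, f w = g w) -> has_deriv f z l -> has_deriv g z l.
Proof.
intros E [phi [Hp [Hl H]]]. exists phi; split; [exact Hp|split; [exact Hl|]].
intros w. now rewrite <- !E.
Qed.

(** The slope identity of Caratheodory's form has to hold on the whole plane, although [g] is
    compared with [f] only near [z]; away from [z] it is forced by taking the difference quotient of
    [g] itself. *)
Lemma has_deriv_local (f g : C -> C) z l r : 0 < r ->
  (forall w, Cmod (w - z) < r -> f w = g w) -> has_deriv f z l -> has_deriv g z l.
Proof.
intros hr E [phi [Hp [Hl H]]].
assert (Hz : Cmod (z - z) < r) by (replace (z - z)%C with (RtoC 0) by ring; now rewrite Cmod_0).
exists (fun w => if Rlt_dec (Cmod (w - z)) r then phi w else (g w - g z) / (w - z))%C.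
split; [|split].
  apply cont_at_local with phi r; [exact hr| |exact Hp].
  intros w hw. now destruct (Rlt_dec (Cmod (w - z)) r).
- now destruct (Rlt_dec (Cmod (z - z)) r).
- intros w. destruct (Rlt_dec (Cmod (w - z)) r) as [h|h].
  + rewrite <- !E by assumption. apply H.
  + assert (w <> z) by (intros ->; contradiction).
    field. now apply Cminus_neq.
Qed.

Lemma has_deriv_const (c z : C) : has_deriv (fun _ => c) z 0.
Proof. exists (fun _ => RtoC 0); repeat split; [apply cont_at_const|intros; ring]. Qed.

Lemma has_deriv_id (z : C) : has_deriv (fun w => w) z 1.
Proof. exists (fun _ => RtoC 1); repeat split; [apply cont_at_const|intros; ring]. Qed.

Lemma has_deriv_plus (f g : C -> C) z l m : has_deriv f z l -> has_deriv g z m ->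
  has_deriv (fun w => f w + g w)%C z (l + m).
Proof.
intros [p [Hp [Lp Ep]]] [q [Hq [Lq Eq]]]. exists (fun w => p w + q w)%C.
split; [now apply cont_at_plus|split; [now rewrite Lp, Lq|]].
intros w. rewrite Ep, Eq. ring.
Qed.

Lemma has_deriv_mult (f g : C -> C) z l m : has_deriv f z l -> has_deriv g z m ->
  has_deriv (fun w => f w * g w)%C z (l * g z + f z * m).
Proof.
intros Df Dg. pose proof (has_deriv_cont g z m Dg) as Cg.
destruct Df as [p [Hp [Lp Ep]]], Dg as [q [Hq [Lq Eq]]].
exists (fun w => p w * g w + f z * q w)%C. split; [|split; [now rewrite Lp, Lq|]].
- apply cont_at_plus; apply cont_at_mult; auto using cont_at_const.
- intros w. rewrite Ep. replace (f z * g z)%C with (f z * (g w - (w - z) * q w))%C; [ring|].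
  rewrite (Eq w). ring.
Qed.

Lemma has_deriv_comp (f g : C -> C) z l m : has_deriv g z m -> has_deriv f (g z) l ->
  has_deriv (fun w => f (g w)) z (l * m).
Proof.
intros Dg [p [Hp [Lp Ep]]]. pose proof (has_deriv_cont g z m Dg) as Cg.
destruct Dg as [q [Hq [Lq Eq]]].
exists (fun w => p (g w) * q w)%C. split; [|split; [now rewrite Lp, Lq|]].
- apply cont_at_mult; [|exact Hq]. now apply cont_at_comp.
- intros w. rewrite (Ep (g w)). replace (g w - g z)%C with ((w - z) * q w)%C; [ring|].
  rewrite (Eq w). ring.
Qed.

Lemma has_deriv_inv (f : C -> C) z l : has_deriv f z l -> f z <> 0 ->
  has_deriv (fun w => / f w)%C z (- l / (f z * f z)).
Proof.
intros D H0. pose proof (has_deriv_cont f z l D) as Cf.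
destruct (cont_at_neq0 f z Cf H0) as [r [hr L]].
assert (HF : forall w, Cmod (w - z) < r -> f w <> 0).
{ intros w hw. apply Cmod_gt_0. pose proof (L w hw). pose proof (Cmod_ge_0 (f z)). lra. }
destruct D as [p [Hp [Lp Ep]]].
(* Off the disc, where [f] may vanish, the inverse is replaced by whatever makes the slope identity
   hold with one formula everywhere; [has_deriv_local] discards the change. *)
set (g := fun w => (if Rlt_dec (Cmod (w - z)) r then / f w else / f z + (w - z) * (- p w / (f w * f z)))%C).
apply has_deriv_local with g r; [exact hr| |].
{ intros w hw. unfold g. now destruct (Rlt_dec (Cmod (w - z)) r). }
assert (Hz : Cmod (z - z) < r) by (replace (z - z)%C with (RtoC 0) by ring; now rewrite Cmod_0).
exists (fun w => - p w / (f w * f z))%C. split; [|split].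
- apply cont_at_div; [now apply cont_at_opp| |now apply Cmult_neq_0].
  apply cont_at_mult; [exact Cf|apply cont_at_const].
- now rewrite Lp.
- intros w. unfold g.
  destruct (Rlt_dec (Cmod (z - z)) r); [|contradiction].
  destruct (Rlt_dec (Cmod (w - z)) r) as [h|h]; [|reflexivity].
  pose proof (HF w h). replace (p w * (w - z))%C with (f w - f z)%C; [|rewrite (Ep w); ring].
  transitivity (/ f z - (f w - f z) / (f w * f z))%C; [field; auto|].
  rewrite (Ep w) at 1. replace (f z + (w - z) * p w - f z)%C with ((w - z) * p w)%C by ring.
  field; auto.
Qed.

Lemma has_deriv_div (f g : C -> C) z l m : has_deriv f z l -> has_deriv g z m -> g z <> 0 ->
  exists k, has_deriv (fun w => f w / g w)%C z k.
Proof. intros. eexists. apply has_deriv_mult; [eassumption|]. now apply has_deriv_inv with (l := m). Qed.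

Lemma holo_ext (f g : C -> C) : (forall w, f w = g w) -> holo f -> holo g.
Proof. intros E H z. destruct (H z) as [l D]. exists l. exact (has_deriv_ext f g z l E D). Qed.

Lemma holo_const (c : C) : holo (fun _ => c).
Proof. intros z. exists 0. apply has_deriv_const. Qed.

Lemma holo_id : holo (fun w => w).
Proof. intros z. exists 1. apply has_deriv_id. Qed.

Lemma holo_plus (f g : C -> C) : holo f -> holo g -> holo (fun w => f w + g w)%C.
Proof.
intros Hf Hg z. destruct (Hf z) as [l Dl], (Hg z) as [m Dm].
eexists; apply has_deriv_plus; eassumption.
Qed.

Lemma holo_mult (f g : C -> C) : holo f -> holo g -> holo (fun w => f w * g w)%C.
Proof.
intros Hf Hg z. destruct (Hf z) as [l Dl], (Hg z) as [m Dm].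
eexists; apply has_deriv_mult; eassumption.
Qed.

Lemma holo_comp (f g : C -> C) : holo f -> holo g -> holo (fun w => f (g w)).
Proof.
intros Hf Hg z. destruct (Hg z) as [m Dm], (Hf (g z)) as [l Dl].
eexists; eapply has_deriv_comp; eassumption.
Qed.

Lemma holo_opp (f : C -> C) : holo f -> holo (fun w => - f w)%C.
Proof.
intros H. apply holo_ext with (fun w => (- (1)) * f w)%C; [intros; ring|].
apply holo_mult; [apply holo_const|exact H].
Qed.

Lemma holo_minus (f g : C -> C) : holo f -> holo g -> holo (fun w => f w - g w)%C.
Proof. intros; apply holo_plus; [assumption|now apply holo_opp]. Qed.

Lemma holo_Cpow (f : C -> C) n : holo f -> holo (fun w => f w ^ n)%C.
Proof.
intros Hf. induction n as [|n IH]; simpl; [apply holo_const|]. now apply holo_mult.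
Qed.

Lemma has_deriv_slope (F : C -> C) z l : has_deriv F z l -> forall eps, 0 < eps ->
  exists d, 0 < d /\ forall w, Cmod (w - z) < d -> Cmod (F w - F z - l * (w - z)) <= eps * Cmod (w - z).
Proof.
intros [phi [Hp [Lp E]]] eps he. destruct (Hp eps he) as [d [hd K]].
exists d; split; [exact hd|]. intros w hw.
replace (F w - F z - l * (w - z))%C with ((phi w - phi z) * (w - z))%C by (rewrite (E w), Lp; ring).
rewrite Cmod_mult. apply Rmult_le_compat_r; [apply Cmod_ge_0|]. now apply Rlt_le, K.
Qed.

Lemma slope_has_deriv (F : C -> C) z l :
  (forall eps, 0 < eps -> exists d, 0 < d /\ forall w, Cmod (w - z) < d ->
     Cmod (F w - F z - l * (w - z)) <= eps * Cmod (w - z)) -> has_deriv F z l.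
Proof.
intros H. exists (fun w => if Ceq_dec w z then l else (F w - F z) / (w - z))%C.
split; [|split].
- intros eps he. destruct (H (eps / 2)) as [d [hd K]]; [lra|].
  exists d; split; [exact hd|]. intros w hw.
  destruct (Ceq_dec z z); [|congruence].
  destruct (Ceq_dec w z) as [->|h].
  + replace (l - l)%C with (RtoC 0) by ring. rewrite Cmod_0. exact he.
  + assert (hn : (w - z)%C <> 0) by now apply Cminus_neq.
    assert (0 < Cmod (w - z)) by now apply Cmod_gt_0.
    specialize (K w hw).
    replace ((F w - F z) / (w - z) - l)%C with ((F w - F z - l * (w - z)) / (w - z))%C by (field; exact hn).
    rewrite Cmod_div by exact hn.
    apply Rmult_lt_reg_r with (Cmod (w - z)); [assumption|].
    unfold Rdiv at 1. rewrite Rmult_assoc, Rinv_l, Rmult_1_r by lra. nra.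
- now destruct (Ceq_dec z z).
- intros w. destruct (Ceq_dec w z) as [->|h]; [ring|].
  field. now apply Cminus_neq.
Qed.

(** Passing through [is_derive_C_AbsRing] makes the neighbourhoods discs for [Cmod], after which
    both notions are the same estimate of the remainder. *)
Lemma entire_holo (f : C -> C) : entire f <-> holo f.
Proof.
split; intros H z; destruct (H z) as [l D]; exists l.
- apply is_derive_C_AbsRing in D. destruct D as [_ D].
  specialize (D z (fun P HP => HP)).
  apply slope_has_deriv. intros eps he.
  destruct (D (mkposreal eps he)) as [[d hd] K]. simpl in K.
  exists d; split; [exact hd|]. intros w hw. rewrite (Cmult_comm l). exact (K w hw).
- apply is_derive_C_AbsRing. split; [apply is_linear_scal_l|].
  intros x Hx.
  apply (is_filter_lim_locally_unique (K := C_AbsRing) (V := AbsRing_NormedModule C_AbsRing)) in Hx.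
  subst x. intros [eps he]. destruct (has_deriv_slope f z l D eps he) as [d [hd K]].
  exists (mkposreal d hd). intros w hw. simpl.
  change (Cmod (f w - f z - (w - z) * l) <= eps * Cmod (w - z)).
  rewrite (Cmult_comm _ l). now apply K.
Qed.

(** * Integrals along real segments *)

(* The integrand is given on all of C, so that integrals along a path are those
   of a composite with the complexified path. *)
Definition CInt (H : C -> C) (a b : R) : C :=
  (RInt (fun t => fst (H (RtoC t))) a b, RInt (fun t => snd (H (RtoC t))) a b).

Lemma Cmod_le_sum (z : C) : Cmod z <= Rabs (fst z) + Rabs (snd z).
Proof.
destruct z as [x y]; simpl.
replace (x, y) with (RtoC x + Ci * RtoC y)%C by (apply injective_projections; simpl; ring).
eapply Rle_trans; [apply Cmod_triangle|]. rewrite Cmod_mult, Cmod_Ci, !Cmod_R. lra.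
Qed.

Lemma Rabs_fst_le (z : C) : Rabs (fst z) <= Cmod z.
Proof. eapply Rle_trans; [apply Rmax_l|apply Rmax_Cmod]. Qed.

Lemma Rabs_snd_le (z : C) : Rabs (snd z) <= Cmod z.
Proof. eapply Rle_trans; [apply Rmax_r|apply Rmax_Cmod]. Qed.

Lemma cont_at_fst (H : C -> C) (t : R) : cont_at H t -> continuous (fun s : R => fst (H (RtoC s))) t.
Proof.
intros K P [eps HP]. destruct (K eps (cond_pos eps)) as [d [hd L]].
exists (mkposreal d hd). intros s hs. apply HP.
change (Rabs (fst (H (RtoC s)) - fst (H (RtoC t))) < eps).
change (Rabs (s - t) < d) in hs.
eapply Rle_lt_trans; [apply (Rabs_fst_le (H (RtoC s) - H (RtoC t)))|].
apply L. now rewrite <- RtoC_minus, Cmod_R.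
Qed.

Lemma cont_at_snd (H : C -> C) (t : R) : cont_at H t -> continuous (fun s : R => snd (H (RtoC s))) t.
Proof.
intros K P [eps HP]. destruct (K eps (cond_pos eps)) as [d [hd L]].
exists (mkposreal d hd). intros s hs. apply HP.
change (Rabs (snd (H (RtoC s)) - snd (H (RtoC t))) < eps).
change (Rabs (s - t) < d) in hs.
eapply Rle_lt_trans; [apply (Rabs_snd_le (H (RtoC s) - H (RtoC t)))|].
apply L. now rewrite <- RtoC_minus, Cmod_R.
Qed.

Definition cont_R (H : C -> C) : Prop := forall t : R, cont_at H (RtoC t).

Lemma ex_RInt_fst (H : C -> C) a b : cont_R H -> ex_RInt (fun t : R => fst (H (RtoC t))) a b.
Proof. intros K. apply (ex_RInt_continuous (V := R_CompleteNormedModule)). intros; apply cont_at_fst, K. Qed.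

Lemma ex_RInt_snd (H : C -> C) a b : cont_R H -> ex_RInt (fun t : R => snd (H (RtoC t))) a b.
Proof. intros K. apply (ex_RInt_continuous (V := R_CompleteNormedModule)). intros; apply cont_at_snd, K. Qed.

Lemma CInt_ext (F G : C -> C) a b : (forall t : R, Rmin a b < t < Rmax a b -> F (RtoC t) = G (RtoC t)) ->
  CInt F a b = CInt G a b.
Proof.
intros E. unfold CInt. f_equal; apply RInt_ext; intros t ht; now rewrite E.
Qed.

Lemma CInt_plus (F G : C -> C) a b : cont_R F -> cont_R G ->
  CInt (fun t => F t + G t)%C a b = (CInt F a b + CInt G a b)%C.
Proof.
intros HF HG. unfold CInt. apply injective_projections; simpl.
- apply (RInt_plus (V := R_CompleteNormedModule)); now apply ex_RInt_fst.
- apply (RInt_plus (V := R_CompleteNormedModule)); now apply ex_RInt_snd.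
Qed.

Lemma CInt_scal (c : C) (F : C -> C) a b : cont_R F ->
  CInt (fun t => c * F t)%C a b = (c * CInt F a b)%C.
Proof.
intros HF. unfold CInt. destruct c as [x y]. apply injective_projections; simpl.
- rewrite (RInt_minus (V := R_CompleteNormedModule)
    (fun t => x * fst (F (RtoC t))) (fun t => y * snd (F (RtoC t)))).
  + rewrite !(RInt_scal (V := R_CompleteNormedModule)); try reflexivity;
      auto using ex_RInt_fst, ex_RInt_snd.
  + apply (ex_RInt_scal (V := R_NormedModule)). now apply ex_RInt_fst.
  + apply (ex_RInt_scal (V := R_NormedModule)). now apply ex_RInt_snd.
- rewrite (RInt_plus (V := R_CompleteNormedModule)
    (fun t => x * snd (F (RtoC t))) (fun t => y * fst (F (RtoC t)))).
  + rewrite !(RInt_scal (V := R_CompleteNormedModule)); try reflexivity;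
      auto using ex_RInt_fst, ex_RInt_snd.
  + apply (ex_RInt_scal (V := R_NormedModule)). now apply ex_RInt_snd.
  + apply (ex_RInt_scal (V := R_NormedModule)). now apply ex_RInt_fst.
Qed.

Lemma cont_R_scal (c : C) (F : C -> C) : cont_R F -> cont_R (fun t => c * F t)%C.
Proof. intros H t. apply cont_at_mult; [apply cont_at_const|apply H]. Qed.

Lemma CInt_minus (F G : C -> C) a b : cont_R F -> cont_R G ->
  CInt (fun t => F t - G t)%C a b = (CInt F a b - CInt G a b)%C.
Proof.
intros HF HG.
rewrite (CInt_ext _ (fun t => F t + (- (1)) * G t)%C); [|intros; ring].
rewrite CInt_plus; [|exact HF|now apply cont_R_scal].
rewrite CInt_scal by exact HG. ring.
Qed.

Lemma CInt_Chasles (F : C -> C) a b c : cont_R F ->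
  (CInt F a b + CInt F b c)%C = CInt F a c.
Proof.
intros HF. unfold CInt. apply injective_projections; simpl.
- apply (RInt_Chasles (V := R_CompleteNormedModule)); now apply ex_RInt_fst.
- apply (RInt_Chasles (V := R_CompleteNormedModule)); now apply ex_RInt_snd.
Qed.

Lemma CInt_point (F : C -> C) a : CInt F a a = 0.
Proof. unfold CInt. now rewrite !RInt_point. Qed.

Lemma CInt_const (c : C) a b : CInt (fun _ => c) a b = (c * RtoC (b - a))%C.
Proof.
unfold CInt. rewrite !RInt_const. destruct c as [x y].
apply injective_projections; simpl; unfold scal; simpl; unfold mult; simpl; ring.
Qed.

Lemma RInt_bound (f : R -> R) a b M : (forall t, continuous f t) ->
  (forall t, Rmin a b <= t <= Rmax a b -> Rabs (f t) <= M) -> Rabs (RInt f a b) <= M * Rabs (b - a).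
Proof.
intros Hc. revert a b.
assert (W : forall a b, a <= b -> (forall t, Rmin a b <= t <= Rmax a b -> Rabs (f t) <= M) ->
  Rabs (RInt f a b) <= M * Rabs (b - a)).
{ intros a b hab HM. rewrite (Rabs_pos_eq (b - a)) by lra. rewrite Rmult_comm.
  apply abs_RInt_le_const; [exact hab| |].
  - apply (ex_RInt_continuous (V := R_CompleteNormedModule)); auto.
  - intros t ht. apply HM. now rewrite Rmin_left, Rmax_right by exact hab. }
intros a b HM. destruct (Rle_dec a b) as [h|h]; [now apply W|].
rewrite <- opp_RInt_swap by (apply (ex_RInt_continuous (V := R_CompleteNormedModule)); auto).
rewrite Rabs_minus_sym. change (Rabs (- RInt f b a) <= M * Rabs (a - b)).
rewrite Rabs_Ropp. apply W; [lra|]. intros t ht. apply HM. now rewrite Rmin_comm, Rmax_comm.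
Qed.

(* The factor 2 comes from estimating the two components separately. *)
Lemma CInt_bound (F : C -> C) a b M : cont_R F ->
  (forall t : R, Rmin a b <= t <= Rmax a b -> Cmod (F (RtoC t)) <= M) -> Cmod (CInt F a b) <= 2 * M * Rabs (b - a).
Proof.
intros HF HM. eapply Rle_trans; [apply Cmod_le_sum|]. unfold CInt; simpl.
pose proof (RInt_bound (fun t => fst (F (RtoC t))) a b M) as H1.
pose proof (RInt_bound (fun t => snd (F (RtoC t))) a b M) as H2.
assert (Rabs (RInt (fun t : R => fst (F (RtoC t))) a b) <= M * Rabs (b - a)).
{ apply H1; [intros; apply cont_at_fst, HF|].
  intros t ht. eapply Rle_trans; [apply Rabs_fst_le|auto]. }
assert (Rabs (RInt (fun t : R => snd (F (RtoC t))) a b) <= M * Rabs (b - a)).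
{ apply H2; [intros; apply cont_at_snd, HF|].
  intros t ht. eapply Rle_trans; [apply Rabs_snd_le|auto]. }
lra.
Qed.

Lemma is_derive_slope (f : R -> R) (t l : R) :
  (forall eps, 0 < eps -> exists d, 0 < d /\ forall s, Rabs (s - t) < d ->
     Rabs (f s - f t - l * (s - t)) <= eps * Rabs (s - t)) -> is_derive f t l.
Proof.
intros H. split; [apply (is_linear_scal_l (K := R_AbsRing))|].
intros x Hx. apply (is_filter_lim_locally_unique (K := R_AbsRing) (V := R_NormedModule)) in Hx. subst x.
intros [eps he]. destruct (H eps he) as [d [hd K]].
exists (mkposreal d hd). intros s hs. simpl.
change (Rabs (f s - f t - (s - t) * l) <= eps * Rabs (s - t)).
rewrite (Rmult_comm _ l). now apply K.
Qed.

Lemma has_deriv_fst (F : C -> C) (t : R) l : has_deriv F t l -> is_derive (fun s : R => fst (F (RtoC s))) t (fst l).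
Proof.
intros D. apply is_derive_slope. intros eps he.
destruct (has_deriv_slope F t l D eps he) as [d [hd K]].
exists d; split; [exact hd|]. intros s hs.
specialize (K (RtoC s)). rewrite <- RtoC_minus, Cmod_R in K.
eapply Rle_trans; [|now apply K].
eapply Rle_trans; [|apply Rabs_fst_le]. simpl. right. f_equal. ring.
Qed.

Lemma has_deriv_snd (F : C -> C) (t : R) l : has_deriv F t l -> is_derive (fun s : R => snd (F (RtoC s))) t (snd l).
Proof.
intros D. apply is_derive_slope. intros eps he.
destruct (has_deriv_slope F t l D eps he) as [d [hd K]].
exists d; split; [exact hd|]. intros s hs.
specialize (K (RtoC s)). rewrite <- RtoC_minus, Cmod_R in K.
eapply Rle_trans; [|now apply K].
eapply Rle_trans; [|apply Rabs_snd_le]. simpl. right. f_equal. ring.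
Qed.

Lemma CInt_FTC (F f : C -> C) a b : (forall t : R, has_deriv F t (f t)) -> cont_R f ->
  CInt f a b = (F b - F a)%C.
Proof.
intros D Hf. unfold CInt. apply injective_projections; simpl.
- apply is_RInt_unique.
  apply (is_RInt_derive (V := R_CompleteNormedModule) (fun s : R => fst (F (RtoC s)))).
  + intros; now apply has_deriv_fst.
  + intros; now apply cont_at_fst.
- apply is_RInt_unique.
  apply (is_RInt_derive (V := R_CompleteNormedModule) (fun s : R => snd (F (RtoC s)))).
  + intros; now apply has_deriv_snd.
  + intros; now apply cont_at_snd.
Qed.

(** * The complex exponential *)

Definition cexp (z : C) : C := (exp (fst z) * cos (snd z), exp (fst z) * sin (snd z)).

Lemma cexp_plus (z w : C) : cexp (z + w) = (cexp z * cexp w)%C.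
Proof.
unfold cexp. apply injective_projections; simpl; rewrite exp_plus, ?cos_plus, ?sin_plus; ring.
Qed.

Lemma cexp_0 : cexp 0 = 1.
Proof. unfold cexp; simpl. rewrite exp_0, cos_0, sin_0. apply injective_projections; simpl; ring. Qed.

Lemma Cmod_cexp (z : C) : Cmod (cexp z) = exp (fst z).
Proof.
unfold Cmod, cexp; simpl.
replace (_ + _) with (exp (fst z) * exp (fst z) * ((sin (snd z))² + (cos (snd z))²)) by (unfold Rsqr; ring).
rewrite sin2_cos2, Rmult_1_r. apply sqrt_square, Rlt_le, exp_pos.
Qed.

Lemma cexp_neq0 (z : C) : cexp z <> 0.
Proof. apply Cmod_gt_0. rewrite Cmod_cexp. apply exp_pos. Qed.

Lemma cexp_opp (z : C) : (cexp z * cexp (- z))%C = 1.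
Proof. rewrite <- cexp_plus, <- cexp_0. f_equal. ring. Qed.

Lemma derivable_pt_lim_slope_0 (f : R -> R) l : derivable_pt_lim f 0 l ->
  forall eps, 0 < eps -> exists d, 0 < d /\ forall h, Rabs h < d -> Rabs (f h - f 0 - l * h) <= eps * Rabs h.
Proof.
intros D eps he. destruct (D eps he) as [[d hd] K]. exists d; split; [exact hd|].
intros h hh. destruct (Req_dec h 0) as [->|h0].
- rewrite Rabs_R0. replace (f 0 - f 0 - l * 0) with 0 by ring. rewrite Rabs_R0. lra.
- specialize (K h h0 hh). rewrite Rplus_0_l in K.
  replace (f h - f 0 - l * h) with (((f h - f 0) / h - l) * h) by (field; exact h0).
  rewrite Rabs_mult. apply Rmult_le_compat_r; [apply Rabs_pos|lra].
Qed.

Lemma cexp_slope_0 eps : 0 < eps -> exists d, 0 < d /\ forall h, Cmod h < d ->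
  Cmod (cexp h - 1 - h) <= eps * Cmod h.
Proof.
(* With m = [Cmod h], the two components contribute at most 4 e m and 5 e m. Here [Cmod h] < 1 gives
   exp x <= 3, and [Cmod h] < e gives |exp x - 1| <= 2 e. *)
intros he. set (e := Rmin 1 (eps / 10)).
assert (he0 : 0 < e) by (apply Rmin_glb_lt; lra).
assert (he1 : e <= 1) by apply Rmin_l.
assert (he2 : e <= eps / 10) by apply Rmin_r.
destruct (derivable_pt_lim_slope_0 exp 1) with (eps := e) as [d1 [h1 K1]]; [|exact he0|].
{ rewrite <- exp_0. apply derivable_pt_lim_exp. }
destruct (derivable_pt_lim_slope_0 sin 1) with (eps := e) as [d2 [h2 K2]]; [|exact he0|].
{ rewrite <- cos_0. apply derivable_pt_lim_sin. }
destruct (derivable_pt_lim_slope_0 cos 0) with (eps := e) as [d3 [h3 K3]]; [|exact he0|].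
{ replace 0 with (- sin 0) at 2 by (rewrite sin_0; ring). apply derivable_pt_lim_cos. }
exists (Rmin (Rmin 1 e) (Rmin d1 (Rmin d2 d3))). split; [repeat apply Rmin_glb_lt; lra|].
intros h hh.
pose proof (Rlt_le_trans _ _ _ hh (Rmin_l _ _)) as a1.
pose proof (Rlt_le_trans _ _ _ hh (Rmin_r _ _)) as a2.
pose proof (Rlt_le_trans _ _ _ a1 (Rmin_l _ _)) as b1.
pose proof (Rlt_le_trans _ _ _ a1 (Rmin_r _ _)) as b2.
pose proof (Rlt_le_trans _ _ _ a2 (Rmin_l _ _)) as b3.
pose proof (Rlt_le_trans _ _ _ a2 (Rmin_r _ _)) as a3.
pose proof (Rlt_le_trans _ _ _ a3 (Rmin_l _ _)) as b4.
pose proof (Rlt_le_trans _ _ _ a3 (Rmin_r _ _)) as b5.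
pose proof (Rabs_fst_le h) as Hx. pose proof (Rabs_snd_le h) as Hy.
eapply Rle_trans; [apply Cmod_le_sum|].
unfold cexp; destruct h as [x y]; simpl in *.
specialize (K1 x ltac:(lra)). specialize (K2 y ltac:(lra)). specialize (K3 y ltac:(lra)).
rewrite exp_0 in K1. rewrite sin_0 in K2. rewrite cos_0 in K3.
set (m := Cmod (x, y)) in *.
assert (hm : 0 <= m) by apply Cmod_ge_0.
assert (hE : Rabs (exp x) <= 3).
{ rewrite Rabs_pos_eq by apply Rlt_le, exp_pos. eapply Rle_trans; [|apply exp_le_3].
  destruct (Req_dec x 1) as [->|]; [lra|].
  apply Rlt_le, exp_increasing. apply Rabs_def2; lra. }
assert (X1 : Rabs (exp x - 1 - 1 * x) <= e * m).
{ eapply Rle_trans; [exact K1|]. apply Rmult_le_compat_l; lra. }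
assert (X2 : Rabs (sin y - 0 - 1 * y) <= e * m).
{ eapply Rle_trans; [exact K2|]. apply Rmult_le_compat_l; lra. }
assert (X3 : Rabs (cos y - 1 - 0 * y) <= e * m).
{ eapply Rle_trans; [exact K3|]. apply Rmult_le_compat_l; lra. }
assert (X4 : Rabs (exp x - 1) <= 2 * e).
{ replace (exp x - 1) with ((exp x - 1 - 1 * x) + x) by ring.
  eapply Rle_trans; [apply Rabs_triang|]. assert (e * m <= e * 1) by (apply Rmult_le_compat_l; lra). lra. }
replace (exp x * cos y + - (1) + - x) with (exp x * (cos y - 1 - 0 * y) + (exp x - 1 - 1 * x)) by ring.
replace (exp x * sin y + - 0 + - y) with (exp x * (sin y - 0 - 1 * y) + (exp x - 1) * y) by ring.
assert (Y1 : Rabs (exp x * (cos y - 1 - 0 * y) + (exp x - 1 - 1 * x)) <= 3 * (e * m) + e * m).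
{ eapply Rle_trans; [apply Rabs_triang|]. rewrite Rabs_mult. apply Rplus_le_compat; [|exact X1].
  apply Rmult_le_compat; auto using Rabs_pos. }
assert (Y2 : Rabs (exp x * (sin y - 0 - 1 * y) + (exp x - 1) * y) <= 3 * (e * m) + 2 * e * m).
{ eapply Rle_trans; [apply Rabs_triang|]. rewrite !Rabs_mult. apply Rplus_le_compat;
  apply Rmult_le_compat; auto using Rabs_pos. }
assert (e * m <= eps / 10 * m) by (apply Rmult_le_compat_r; lra). assert (0 <= eps * m) by (apply Rmult_le_pos; lra). lra.
Qed.

Lemma has_deriv_cexp (z : C) : has_deriv cexp z (cexp z).
Proof.
apply slope_has_deriv. intros eps he.
assert (hz : 0 < Cmod (cexp z)) by (rewrite Cmod_cexp; apply exp_pos).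
destruct (cexp_slope_0 (eps / Cmod (cexp z))) as [d [hd K]]; [now apply Rdiv_lt_0_compat|].
exists d; split; [exact hd|]. intros w hw. specialize (K _ hw).
replace (cexp w) with (cexp z * cexp (w - z))%C by (rewrite <- cexp_plus; f_equal; ring).
replace (cexp z * cexp (w - z) - cexp z - cexp z * (w - z))%C with (cexp z * (cexp (w - z) - 1 - (w - z)))%C by ring.
rewrite Cmod_mult.
replace (eps * Cmod (w - z)) with (Cmod (cexp z) * (eps / Cmod (cexp z) * Cmod (w - z))) by (field; lra).
apply Rmult_le_compat_l; lra.
Qed.

Lemma holo_cexp : holo cexp.
Proof. intros z. exists (cexp z). apply has_deriv_cexp. Qed.

(** Polar coordinates: the argument is the arc cosine of fst z / r, taken with the sign of snd z. *)
Lemma cexp_surj (z : C) : z <> 0 -> exists w, cexp w = z.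
Proof.
intros hz. assert (hr : 0 < Cmod z) by now apply Cmod_gt_0.
set (r := Cmod z) in *.
assert (E : fst z * fst z + snd z * snd z = r * r).
{ unfold r. replace (Cmod z * Cmod z) with (Cmod z ^ 2) by ring.
  rewrite Cmod2_alt. unfold Re, Im. ring. }
assert (B : -1 <= fst z / r <= 1).
{ pose proof (Rabs_fst_le z) as H. fold r in H. apply Rabs_le_between in H.
  split; apply Rmult_le_reg_r with r; try exact hr; unfold Rdiv; rewrite Rmult_assoc, Rinv_l; lra. }
assert (S : sqrt (1 - (fst z / r)²) = Rabs (snd z / r)).
{ rewrite <- sqrt_Rsqr_abs. f_equal. unfold Rsqr.
  replace (snd z / r * (snd z / r)) with (snd z * snd z / (r * r)) by (field; lra).
  replace (snd z * snd z) with (r * r - fst z * fst z) by lra. field; lra. }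
destruct (Rle_dec 0 (snd z)) as [h|h].
- exists (ln r, acos (fst z / r)). unfold cexp; simpl.
  rewrite exp_ln, cos_acos, sin_acos, S by assumption.
  rewrite Rabs_pos_eq by (apply Rmult_le_pos; [exact h|apply Rlt_le, Rinv_0_lt_compat, hr]).
  apply injective_projections; simpl; field; lra.
- exists (ln r, - acos (fst z / r)). unfold cexp; simpl.
  rewrite exp_ln, cos_neg, sin_neg, cos_acos, sin_acos, S by assumption.
  rewrite Rabs_left; [apply injective_projections; simpl; field; lra|].
  apply Rmult_lt_reg_r with r; [exact hr|]. unfold Rdiv. rewrite Rmult_assoc, Rinv_l; lra.
Qed.

Lemma cexp_2PI : cexp (Ci * RtoC (2 * PI)) = 1.
Proof.
unfold cexp; simpl. replace (0 * (2 * PI) - 1 * 0) with 0 by ring.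
replace (0 * 0 + 1 * (2 * PI)) with (2 * PI) by ring.
rewrite exp_0, cos_2PI, sin_2PI. apply injective_projections; simpl; ring.
Qed.

(** Serves every recursive construction below: bisection, removal of blocks of roots, Newton
    interpolation. The invariant [P] is separate from [Rel] because a successor exists only for
    admissible states. *)
Lemma dep_choice (T : Type) (P : nat -> T -> Prop) (Rel : nat -> T -> T -> Prop) (t0 : T) :
  P 0%nat t0 -> (forall n t, P n t -> exists t', P (S n) t' /\ Rel n t t') ->
  exists s : nat -> T, s 0%nat = t0 /\ forall n, P n (s n) /\ Rel n (s n) (s (S n)).
Proof.
intros H0 HS.
set (step := fun n t => epsilon (inhabits t0) (fun t' => P (S n) t' /\ Rel n t t')).
set (s := nat_rect (fun _ => T) t0 step).
assert (K : forall n, P n (s n)).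
{ induction n as [|n IH]; [exact H0|].
  exact (proj1 (epsilon_spec (inhabits t0) _ (HS n (s n) IH))). }
exists s; split; [reflexivity|]. intros n; split; [apply K|].
exact (proj2 (epsilon_spec (inhabits t0) _ (HS n (s n) (K n)))).
Qed.

(** * Goursat's lemma and Cauchy's formula *)

(** [vInt] integrates in the ordinate alone; the factor [Ci] of the path integral enters in
    [rectInt], which runs counterclockwise when a < b and c < d. No order is imposed, so a rectangle
    may extend from a corner in any direction. *)
Definition hInt (g : C -> C) (y a b : R) : C := CInt (fun t => g (t + Ci * RtoC y)%C) a b.
Definition vInt (g : C -> C) (x c d : R) : C := CInt (fun t => g (RtoC x + Ci * t)%C) c d.

Definition rectInt (g : C -> C) (a b c d : R) : C :=
  (hInt g c a b + Ci * vInt g b c d - hInt g d a b - Ci * vInt g a c d)%C.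

Lemma cont_R_h (g : C -> C) y : (forall z, cont_at g z) -> cont_R (fun t => g (t + Ci * RtoC y)%C).
Proof.
intros H t. apply cont_at_comp with (f := g); [|apply H].
apply cont_at_plus; [apply cont_at_id|apply cont_at_const].
Qed.

Lemma cont_R_v (g : C -> C) x : (forall z, cont_at g z) -> cont_R (fun t => g (RtoC x + Ci * t)%C).
Proof.
intros H t. apply cont_at_comp with (f := g); [|apply H].
apply cont_at_plus; [apply cont_at_const|].
apply cont_at_mult; [apply cont_at_const|apply cont_at_id].
Qed.

Lemma hInt_Chasles (g : C -> C) y a b c : (forall z, cont_at g z) ->
  hInt g y a c = (hInt g y a b + hInt g y b c)%C.
Proof. intros H. symmetry. apply CInt_Chasles. now apply cont_R_h. Qed.

Lemma vInt_Chasles (g : C -> C) x a b c : (forall z, cont_at g z) ->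
  vInt g x a c = (vInt g x a b + vInt g x b c)%C.
Proof. intros H. symmetry. apply CInt_Chasles. now apply cont_R_v. Qed.

Lemma rectInt_quarter (g : C -> C) a m b c n d : (forall z, cont_at g z) ->
  rectInt g a b c d =
  (rectInt g a m c n + rectInt g m b c n + rectInt g a m n d + rectInt g m b n d)%C.
Proof.
intros H. unfold rectInt.
rewrite (hInt_Chasles g c a m b), (hInt_Chasles g d a m b) by exact H.
rewrite (vInt_Chasles g a c n d), (vInt_Chasles g b c n d) by exact H. ring.
Qed.

Lemma rectInt_minus (g k : C -> C) a b c d : (forall z, cont_at g z) -> (forall z, cont_at k z) ->
  rectInt (fun z => g z - k z)%C a b c d = (rectInt g a b c d - rectInt k a b c d)%C.
Proof.
intros Hg Hk. unfold rectInt, hInt, vInt.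
rewrite !(CInt_minus (fun t => g (t + Ci * RtoC _)%C)) by now apply cont_R_h.
rewrite !(CInt_minus (fun t => g (RtoC _ + Ci * t)%C)) by now apply cont_R_v. ring.
Qed.

Lemma hInt_bound (g : C -> C) y a b M : (forall z, cont_at g z) ->
  (forall x : R, Rmin a b <= x <= Rmax a b -> Cmod (g (RtoC x + Ci * RtoC y)%C) <= M) ->
  Cmod (hInt g y a b) <= 2 * M * Rabs (b - a).
Proof. intros H HM. apply CInt_bound; [now apply cont_R_h|exact HM]. Qed.

Lemma vInt_bound (g : C -> C) x c d M : (forall z, cont_at g z) ->
  (forall y : R, Rmin c d <= y <= Rmax c d -> Cmod (g (RtoC x + Ci * RtoC y)%C) <= M) ->
  Cmod (vInt g x c d) <= 2 * M * Rabs (d - c).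
Proof. intros H HM. apply CInt_bound; [now apply cont_R_v|exact HM]. Qed.

Lemma rectInt_bound (g : C -> C) a b c d M : (forall z, cont_at g z) ->
  (forall x y : R, Rmin a b <= x <= Rmax a b -> Rmin c d <= y <= Rmax c d ->
     Cmod (g (RtoC x + Ci * RtoC y)%C) <= M) ->
  Cmod (rectInt g a b c d) <= 4 * M * (Rabs (b - a) + Rabs (d - c)).
Proof.
intros H HM. unfold rectInt.
assert (ha : Rmin a b <= a <= Rmax a b) by (split; [apply Rmin_l|apply Rmax_l]).
assert (hb : Rmin a b <= b <= Rmax a b) by (split; [apply Rmin_r|apply Rmax_r]).
assert (hc : Rmin c d <= c <= Rmax c d) by (split; [apply Rmin_l|apply Rmax_l]).
assert (hd : Rmin c d <= d <= Rmax c d) by (split; [apply Rmin_r|apply Rmax_r]).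
pose proof (hInt_bound g c a b M H ltac:(intros; now apply HM)).
pose proof (hInt_bound g d a b M H ltac:(intros; now apply HM)).
pose proof (vInt_bound g a c d M H ltac:(intros; now apply HM)).
pose proof (vInt_bound g b c d M H ltac:(intros; now apply HM)).
eapply Rle_trans; [apply Cmod_triangle_minus|].
eapply Rle_trans; [apply Rplus_le_compat_r, Cmod_triangle_minus|].
eapply Rle_trans; [apply Rplus_le_compat_r, Rplus_le_compat_r, Cmod_triangle|].
rewrite !Cmod_mult, Cmod_Ci. lra.
Qed.

Lemma rectInt_primitive (G g : C -> C) a b c d :
  (forall z, has_deriv G z (g z)) -> (forall z, cont_at g z) -> rectInt g a b c d = 0.
Proof.
intros D Hg.
assert (Dh : forall y x x', hInt g y x x' = (G (RtoC x' + Ci * RtoC y) - G (RtoC x + Ci * RtoC y))%C).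
{ intros y x x'. unfold hInt.
  apply (CInt_FTC (fun t => G (t + Ci * RtoC y)%C)); [|now apply cont_R_h].
  intros t. replace (g (RtoC t + Ci * RtoC y)%C) with (g (RtoC t + Ci * RtoC y) * (1 + 0))%C by ring.
  apply (has_deriv_comp G (fun t => t + Ci * RtoC y)%C); [|apply D].
  apply has_deriv_plus; [apply has_deriv_id|apply has_deriv_const]. }
assert (Dv : forall x y y', (Ci * vInt g x y y')%C = (G (RtoC x + Ci * RtoC y') - G (RtoC x + Ci * RtoC y))%C).
{ intros x y y'. unfold vInt. rewrite <- CInt_scal by now apply cont_R_v.
  apply (CInt_FTC (fun t => G (RtoC x + Ci * t)%C)); [|apply cont_R_scal; now apply cont_R_v].
  intros t. replace (Ci * g (RtoC x + Ci * RtoC t))%C with (g (RtoC x + Ci * RtoC t) * (0 + (0 * RtoC t + Ci * 1)))%C by ring.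
  apply (has_deriv_comp G (fun t => RtoC x + Ci * t)%C); [|apply D].
  apply has_deriv_plus; [apply has_deriv_const|].
  apply has_deriv_mult; [apply has_deriv_const|apply has_deriv_id]. }
unfold rectInt. rewrite !Dh, !Dv. ring.
Qed.

Lemma rectInt_affine (p l : C) a b c d : rectInt (fun z => p + l * z)%C a b c d = 0.
Proof.
apply rectInt_primitive with (G := fun z => (p * z + l / 2 * (z * z))%C).
- intros z. replace (p + l * z)%C with ((0 * z + p * 1) + (0 * (z * z) + l / 2 * (1 * z + z * 1)))%C.
  + apply has_deriv_plus.
    * exact (has_deriv_mult _ _ _ _ _ (has_deriv_const p z) (has_deriv_id z)).
    * exact (has_deriv_mult _ _ _ _ _ (has_deriv_const (l / 2) z)
        (has_deriv_mult _ _ _ _ _ (has_deriv_id z) (has_deriv_id z))).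
  + field.
- intros z. apply cont_at_plus; [apply cont_at_const|].
  apply cont_at_mult; [apply cont_at_const|apply cont_at_id].
Qed.

Lemma pow_small theta eps : 0 <= theta < 1 -> 0 < eps -> exists m, theta ^ m < eps.
Proof.
intros ht he. destruct (pow_lt_1_zero theta ltac:(rewrite Rabs_pos_eq; lra) eps he) as [N HN].
exists N. specialize (HN N (le_n N)). rewrite Rabs_pos_eq in HN; [exact HN|apply pow_le; lra].
Qed.

Lemma half_pow_pos n : 0 < (/ 2) ^ n.
Proof. apply pow_lt; lra. Qed.

Lemma half_pow_small eps : 0 < eps -> exists n, (/ 2) ^ n < eps.
Proof. apply pow_small. lra. Qed.

Lemma nested_intervals (u v : nat -> R) :
  (forall n, u n <= u (S n) /\ v (S n) <= v n /\ u n <= v n) ->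
  exists l, forall n, u n <= l <= v n.
Proof.
intros H.
assert (H1 : forall n k, u n <= u (n + k)%nat /\ v (n + k)%nat <= v n).
{ intros n k. induction k as [|k IH]; [rewrite Nat.add_0_r; lra|].
  rewrite Nat.add_succ_r. specialize (H (n + k)%nat). lra. }
assert (H2 : forall m n, u m <= v n).
{ intros m n. pose proof (H1 m n) as A. pose proof (H1 n m) as B.
  rewrite Nat.add_comm in B. specialize (H (m + n)%nat). lra. }
destruct (completeness (fun x => exists n, x = u n)) as [l [U L]].
- exists (v 0%nat). intros x [n ->]. apply H2.
- exists (u 0%nat). now exists 0%nat.
- exists l. intros n; split; [apply U; now exists n|].
  apply L. intros x [m ->]. apply H2.
Qed.

(** A negative [w] reverses the side of the rectangle, hence [Rmin] and [Rmax]; what is needed is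
    that two points of the image of [s, s + e] are at most e |w| apart. *)
Lemma Rmin_max_scale (p w s e t : R) : 0 <= e ->
  Rmin (p + w * s) (p + w * (s + e)) <= t <= Rmax (p + w * s) (p + w * (s + e)) ->
  forall s', s <= s' <= s + e -> Rabs (t - (p + w * s')) <= e * Rabs w.
Proof.
intros he ht s' hs. apply Rabs_le_between.
unfold Rmin, Rmax in ht.
destruct (Rle_dec (p + w * s) (p + w * (s + e))) as [h|h];
destruct (Rle_dec 0 w) as [h0|h0].
- rewrite (Rabs_pos_eq w) by exact h0. nra.
- rewrite (Rabs_left w) by lra. nra.
- rewrite (Rabs_pos_eq w) by exact h0. nra.
- rewrite (Rabs_left w) by lra. nra.
Qed.

Lemma Cmod_components (x y x' y' : R) :
  Cmod (RtoC x + Ci * RtoC y - (RtoC x' + Ci * RtoC y')) <= Rabs (x - x') + Rabs (y - y').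
Proof.
replace (RtoC x + Ci * RtoC y - (RtoC x' + Ci * RtoC y'))%C with (RtoC (x - x') + Ci * RtoC (y - y'))%C
  by (rewrite !RtoC_minus; ring).
eapply Rle_trans; [apply Cmod_triangle|]. rewrite Cmod_mult, Cmod_Ci, !Cmod_R. lra.
Qed.

(** Bisection: some quarter always carries at least a quarter of the integral. At the common point
    of the nested rectangles the affine part of [g] integrates to 0, and the remainder is at most
    eps times diameter times perimeter, which is of order eps / 4^n. Differentiability is asked on
    the rectangle only, so that the lemma applies beside an exceptional point. The state [st n] is
    the corner of the n-th square in the parameters s, t. *)
Lemma goursat (g : C -> C) (p w q h : R) : (forall z, cont_at g z) ->
  (forall s t, 0 <= s <= 1 -> 0 <= t <= 1 ->
     exists l, has_deriv g (RtoC (p + w * s) + Ci * RtoC (q + h * t))%C l) ->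
  rectInt g p (p + w) q (q + h) = 0.
Proof.
intros Hc Hd.
apply NNPP; intros H0. apply Cmod_gt_0 in H0.
set (eta := Cmod (rectInt g p (p + w) q (q + h))) in *.
set (B := fun (n : nat) (st : R * R) =>
  rectInt g (p + w * fst st) (p + w * (fst st + (/ 2) ^ n)) (q + h * snd st) (q + h * (snd st + (/ 2) ^ n))).
destruct (dep_choice (R * R) (fun n st => eta * (/ 4) ^ n <= Cmod (B n st))
  (fun n st st' => (fst st <= fst st' /\ fst st' + (/ 2) ^ (S n) <= fst st + (/ 2) ^ n) /\
                   (snd st <= snd st' /\ snd st' + (/ 2) ^ (S n) <= snd st + (/ 2) ^ n)) (0, 0))
  as [st [E0 K]].
- unfold B; simpl. right. unfold eta. rewrite Rmult_1_r. f_equal.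
  f_equal; ring.
- intros n [s t] Hn. unfold B in Hn; simpl fst in Hn; simpl snd in Hn.
  pose proof (half_pow_pos n) as he. set (e := (/ 2) ^ n) in *.
  rewrite (rectInt_quarter g _ (p + w * (s + e / 2)) _ _ (q + h * (t + e / 2)) _ Hc) in Hn.
  assert (Ee : (/ 2) ^ S n = e / 2) by (simpl; unfold e; lra).
  set (B' := fun s' t' => rectInt g (p + w * s') (p + w * (s' + e / 2)) (q + h * t') (q + h * (t' + e / 2))).
  assert (HB : eta * (/ 4) ^ n <= Cmod (B' s t) + Cmod (B' (s + e / 2) t) + Cmod (B' s (t + e / 2)) + Cmod (B' (s + e / 2) (t + e / 2))).
  { eapply Rle_trans; [exact Hn|]. unfold B'.
    replace (s + e / 2 + e / 2) with (s + e) by field. replace (t + e / 2 + e / 2) with (t + e) by field.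
    eapply Rle_trans; [apply Cmod_triangle|]. apply Rplus_le_compat_r.
    eapply Rle_trans; [apply Cmod_triangle|]. apply Rplus_le_compat_r. apply Cmod_triangle. }
  assert (W : exists s' t', (s' = s \/ s' = s + e / 2) /\ (t' = t \/ t' = t + e / 2) /\ eta * (/ 4) ^ n / 4 <= Cmod (B' s' t')).
  { destruct (Rle_dec (eta * (/ 4) ^ n / 4) (Cmod (B' s t))); [exists s, t; auto|].
    destruct (Rle_dec (eta * (/ 4) ^ n / 4) (Cmod (B' (s + e / 2) t))); [exists (s + e / 2), t; auto|].
    destruct (Rle_dec (eta * (/ 4) ^ n / 4) (Cmod (B' s (t + e / 2)))); [exists s, (t + e / 2); auto|].
    exists (s + e / 2), (t + e / 2); repeat split; auto; lra. }
  destruct W as [s' [t' [Hs [Ht Hb]]]]. exists (s', t'). unfold B; simpl fst; simpl snd.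
  rewrite Ee. fold (B' s' t').
  split; [cbn [pow]; lra|].
  destruct Hs as [-> | ->], Ht as [-> | ->]; lra.
- destruct (nested_intervals (fun n => fst (st n)) (fun n => fst (st n) + (/ 2) ^ n)) as [s Ls];
    [intros n; destruct (K n) as [_ Kn]; pose proof (half_pow_pos n); lra|].
  destruct (nested_intervals (fun n => snd (st n)) (fun n => snd (st n) + (/ 2) ^ n)) as [t Lt];
    [intros n; destruct (K n) as [_ Kn]; pose proof (half_pow_pos n); lra|].
  destruct (Hd s t) as [l D].
  { specialize (Ls 0%nat). rewrite E0 in Ls. simpl in Ls. lra. }
  { specialize (Lt 0%nat). rewrite E0 in Lt. simpl in Lt. lra. }
  set (z := (RtoC (p + w * s) + Ci * RtoC (q + h * t))%C) in *.
  set (S := Rabs w + Rabs h).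
  assert (hS : 0 <= S) by (unfold S; pose proof (Rabs_pos w); pose proof (Rabs_pos h); lra).
  (* The remainder is at most 4 eps S^2 / 4^n while the integral is at least eta / 4^n; the added 1
     makes 4 eps S^2 strictly less than eta. *)
  set (eps := eta / (4 * S * S + 1)).
  assert (heps : 0 < eps) by (apply Rdiv_lt_0_compat; nra).
  destruct (has_deriv_slope g z l D eps heps) as [d [hd Kd]].
  destruct (half_pow_small (d / (S + 1))) as [n Hn]; [apply Rdiv_lt_0_compat; lra|].
  pose proof (half_pow_pos n) as he.
  destruct (K n) as [Kn _]. unfold B in Kn.
  set (e := (/ 2) ^ n) in *. specialize (Ls n). specialize (Lt n). fold e in Ls, Lt.
  set (A := fun u => ((g z - l * z) + l * u)%C).
  assert (HA : forall u, cont_at A u).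
  { intros u. apply cont_at_plus; [apply cont_at_const|].
    apply cont_at_mult; [apply cont_at_const|apply cont_at_id]. }
  assert (heS : e * S < d).
  { apply Rle_lt_trans with (e * (S + 1)); [nra|].
    apply Rmult_lt_compat_r with (r := S + 1) in Hn; [|lra].
    unfold Rdiv in Hn. rewrite Rmult_assoc, Rinv_l, Rmult_1_r in Hn by lra. exact Hn. }
  assert (Bd : Cmod (rectInt (fun u => g u - A u)%C (p + w * fst (st n)) (p + w * (fst (st n) + e))
     (q + h * snd (st n)) (q + h * (snd (st n) + e))) <= 4 * (eps * (e * S)) *
     (Rabs ((p + w * (fst (st n) + e)) - (p + w * fst (st n))) + Rabs ((q + h * (snd (st n) + e)) - (q + h * snd (st n))))).
  { apply rectInt_bound; [intros u; now apply cont_at_minus|].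
    intros x y hx hy.
    pose proof (Rmin_max_scale _ _ _ _ _ (Rlt_le _ _ he) hx s Ls) as Dx.
    pose proof (Rmin_max_scale _ _ _ _ _ (Rlt_le _ _ he) hy t Lt) as Dy.
    pose proof (Cmod_components x y (p + w * s) (q + h * t)) as Dz. fold z in Dz.
    set (u := (RtoC x + Ci * RtoC y)%C) in *.
    assert (Du : Cmod (u - z) <= e * S) by (unfold S; lra).
    unfold A. replace (g u - (g z - l * z + l * u))%C with (g u - g z - l * (u - z))%C by ring.
    eapply Rle_trans; [apply Kd; lra|]. apply Rmult_le_compat_l; lra. }
  rewrite rectInt_minus in Bd by assumption.
  unfold A in Bd at 1. rewrite rectInt_affine in Bd.
  replace (p + w * (fst (st n) + e) - (p + w * fst (st n))) with (e * w) in Bd by ring.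
  replace (q + h * (snd (st n) + e) - (q + h * snd (st n))) with (e * h) in Bd by ring.
  rewrite !Rabs_mult, (Rabs_pos_eq e) in Bd by lra.
  replace (rectInt g _ _ _ _ - 0)%C with
    (rectInt g (p + w * fst (st n)) (p + w * (fst (st n) + e)) (q + h * snd (st n)) (q + h * (snd (st n) + e))) in Bd by ring.
  assert (E4 : (/ 4) ^ n = e * e).
  { unfold e. rewrite <- Rpow_mult_distr. f_equal. field. }
  rewrite E4 in Kn.
  assert (F : eta * (e * e) <= 4 * eps * (S * S) * (e * e)).
  { eapply Rle_trans; [exact Kn|]. eapply Rle_trans; [exact Bd|]. unfold S. right; ring. }
  assert (hee : 0 < e * e) by nra.
  apply Rmult_le_reg_r in F; [|exact hee].
  assert (Eq : eps * (4 * S * S + 1) = eta) by (unfold eps; field; nra).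
  nra.
Qed.

Lemma rectInt_degenerate_w (g : C -> C) a c d : rectInt g a a c d = 0.
Proof. unfold rectInt, hInt. rewrite !CInt_point. ring. Qed.

Lemma rectInt_degenerate_h (g : C -> C) a b c : rectInt g a b c c = 0.
Proof. unfold rectInt, vInt. rewrite !CInt_point. ring. Qed.

Lemma C_components_inj (x y x' y' : R) :
  (RtoC x + Ci * RtoC y)%C = (RtoC x' + Ci * RtoC y')%C -> x = x' /\ y = y'.
Proof. intros E. unfold Cplus, Cmult, RtoC, Ci in E; simpl in E. injection E. lra. Qed.

(** Halving towards the bad corner: the three other quarters avoid it and contribute 0 by [goursat],
    so the integral equals that over an arbitrarily small rectangle, which tends to 0 because [g] is
    bounded near the corner. Degenerate rectangles are set aside first, since their other quarters
    could contain the corner. *)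
Lemma goursat_corner (g : C -> C) (p w q h : R) : (forall z, cont_at g z) ->
  (forall z, z <> (RtoC p + Ci * RtoC q)%C -> exists l, has_deriv g z l) ->
  rectInt g p (p + w) q (q + h) = 0.
Proof.
intros Hc Hd.
destruct (Req_dec w 0) as [->|hw]; [rewrite Rplus_0_r; apply rectInt_degenerate_w|].
destruct (Req_dec h 0) as [->|hh]; [rewrite Rplus_0_r; apply rectInt_degenerate_h|].
assert (HB : forall n, rectInt g p (p + w * (/ 2) ^ n) q (q + h * (/ 2) ^ n) = rectInt g p (p + w) q (q + h)).
{ induction n as [|n IH]; [simpl; now rewrite !Rmult_1_r|]. rewrite <- IH.
  pose proof (half_pow_pos n) as he. simpl. set (e := (/ 2) ^ n) in *.
  rewrite (rectInt_quarter g p (p + w * (/ 2 * e)) (p + w * e) q (q + h * (/ 2 * e)) (q + h * e) Hc).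
  assert (Z : forall p' q' : R, (p' <> p /\ p' = p + w * (/ 2 * e)) /\ (q' = q \/ q' = q + h * (/ 2 * e)) \/
                  p' = p /\ q' <> q /\ q' = q + h * (/ 2 * e) ->
     rectInt g p' (p' + w * (/ 2 * e)) q' (q' + h * (/ 2 * e)) = 0).
  { intros p' q' Hpq. apply goursat; [exact Hc|]. intros s t hs ht. apply Hd.
    intros E. apply C_components_inj in E. destruct E as [E1 E2].
    destruct Hpq as [[[N Ep] _]|[Ep [N Eq]]].
    - rewrite Ep in E1. assert (w * (/ 2 * e * (1 + s)) = 0) by lra.
      apply Rmult_integral in H. destruct H; [contradiction|nra].
    - rewrite Eq in E2. assert (h * (/ 2 * e * (1 + t)) = 0) by lra.
      apply Rmult_integral in H. destruct H; [contradiction|nra]. }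
  assert (hwe : w * (/ 2 * e) <> 0) by (apply Rmult_integral_contrapositive; split; [exact hw|lra]).
  assert (hhe : h * (/ 2 * e) <> 0) by (apply Rmult_integral_contrapositive; split; [exact hh|lra]).
  replace (p + w * e) with (p + w * (/ 2 * e) + w * (/ 2 * e)) by field.
  replace (q + h * e) with (q + h * (/ 2 * e) + h * (/ 2 * e)) by field.
  rewrite (Z (p + w * (/ 2 * e)) q), (Z p (q + h * (/ 2 * e))), (Z (p + w * (/ 2 * e)) (q + h * (/ 2 * e))).
  - ring.
  - left; repeat split; auto; lra.
  - right; repeat split; auto; lra.
  - left; repeat split; auto; lra. }
destruct (cont_at_bounded g (RtoC p + Ci * RtoC q)%C (Hc _)) as [d [M [hd [hM HM]]]].
apply NNPP; intros H0. apply Cmod_gt_0 in H0.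
set (eta := Cmod (rectInt g p (p + w) q (q + h))) in *.
set (S := Rabs w + Rabs h).
assert (hS : 0 < S) by (unfold S; apply Rabs_pos_lt in hw; apply Rabs_pos_lt in hh; lra).
destruct (half_pow_small (Rmin (d / S) (eta / (4 * M * S)))) as [n Hn].
{ apply Rmin_glb_lt; apply Rdiv_lt_0_compat; auto. nra. }
pose proof (half_pow_pos n) as he. specialize (HB n). set (e := (/ 2) ^ n) in *.
pose proof (Rlt_le_trans _ _ _ Hn (Rmin_l _ _)) as H1.
pose proof (Rlt_le_trans _ _ _ Hn (Rmin_r _ _)) as H2.
assert (H1' : e * S < d).
{ apply Rlt_div_r; [exact hS|exact H1]. }
assert (H2' : e * (4 * M * S) < eta).
{ apply Rlt_div_r; [nra|exact H2]. }
assert (Bd : eta <= 4 * M * (Rabs (p + w * e - p) + Rabs (q + h * e - q))).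
{ unfold eta. rewrite <- HB. apply rectInt_bound; [exact Hc|].
  intros x y hx hy. apply HM. eapply Rle_lt_trans; [apply Cmod_components|].
  replace p with (p + w * 0) in hx at 1 3 by ring. replace (p + w * e) with (p + w * (0 + e)) in hx by ring.
  replace q with (q + h * 0) in hy at 1 3 by ring. replace (q + h * e) with (q + h * (0 + e)) in hy by ring.
  pose proof (Rmin_max_scale _ _ _ _ _ (Rlt_le _ _ he) hx 0 ltac:(lra)) as X.
  pose proof (Rmin_max_scale _ _ _ _ _ (Rlt_le _ _ he) hy 0 ltac:(lra)) as Y.
  rewrite Rmult_0_r, Rplus_0_r in X, Y. unfold S in H1'. lra. }
replace (p + w * e - p) with (e * w) in Bd by ring. replace (q + h * e - q) with (e * h) in Bd by ring.
rewrite !Rabs_mult, (Rabs_pos_eq e) in Bd by lra. unfold S in H2'. lra.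
Qed.

Lemma C_eta (z : C) : (RtoC (fst z) + Ci * RtoC (snd z))%C = z.
Proof. destruct z; apply injective_projections; simpl; ring. Qed.

(** The paths start at the exceptional point [p], so the only rectangles to consider have [p] as a
    corner. Going first horizontally or first vertically gives the same [G]; the two expressions
    yield its vertical and horizontal increments, which together form an L-shaped path from z to
    w. *)
Lemma primitive_exists (g : C -> C) (p : C) : (forall z, cont_at g z) ->
  (forall z, z <> p -> exists l, has_deriv g z l) ->
  exists G, forall z, has_deriv G z (g z).
Proof.
intros Hc Hd.
set (G := fun z : C => (hInt g (snd p) (fst p) (fst z) + Ci * vInt g (fst z) (snd p) (snd z))%C).
assert (HG : forall z, G z = (hInt g (snd z) (fst p) (fst z) + Ci * vInt g (fst p) (snd p) (snd z))%C).
{ intros z. assert (R0 : rectInt g (fst p) (fst z) (snd p) (snd z) = 0).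
  { replace (fst z) with (fst p + (fst z - fst p)) by ring.
    replace (snd z) with (snd p + (snd z - snd p)) by ring.
    apply goursat_corner; [exact Hc|]. intros u. rewrite C_eta. apply Hd. }
  unfold rectInt in R0. unfold G.
  match goal with |- ?a = ?b => replace a with (a - b + b)%C by ring; replace (a - b)%C with (RtoC 0); [ring|] end.
  rewrite <- R0. ring. }
exists G. intros z. apply slope_has_deriv. intros eps he.
(* Each leg of the path costs 2 (eps / 4) times its length, and both lengths are at most |w - z|.
   Halving [d] below keeps the sum of the two coordinate differences less than [d]. *)
destruct (Hc z (eps / 4)) as [d [hd K]]; [lra|].
exists (d / 2); split; [lra|]. intros w hw.
assert (E : (G w - G z)%C = (hInt g (snd z) (fst z) (fst w) + Ci * vInt g (fst w) (snd z) (snd w))%C).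
{ set (m := (fst w, snd z) : C).
  assert (E1 : (G w - G m)%C = (Ci * vInt g (fst w) (snd z) (snd w))%C).
  { unfold G, m; simpl fst; simpl snd.
    rewrite (vInt_Chasles g (fst w) (snd p) (snd z) (snd w) Hc). ring. }
  assert (E2 : (G m - G z)%C = hInt g (snd z) (fst z) (fst w)).
  { rewrite (HG m), (HG z). unfold m; simpl fst; simpl snd.
    rewrite (hInt_Chasles g (snd z) (fst p) (fst z) (fst w) Hc). ring. }
  rewrite <- E1, <- E2. ring. }
set (k := fun u => (g u - g z)%C).
assert (Hk : forall u, cont_at k u) by (intros u; apply cont_at_minus; [apply Hc|apply cont_at_const]).
assert (E2 : (G w - G z - g z * (w - z))%C = (hInt k (snd z) (fst z) (fst w) + Ci * vInt k (fst w) (snd z) (snd w))%C).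
{ rewrite E. unfold k, hInt, vInt.
  rewrite (CInt_minus (fun t => g (t + Ci * RtoC (snd z))%C)) by (try apply cont_R_h; auto; intro; apply cont_at_const).
  rewrite (CInt_minus (fun t => g (RtoC (fst w) + Ci * t)%C)) by (try apply cont_R_v; auto; intro; apply cont_at_const).
  rewrite !CInt_const.
  replace (w - z)%C with (RtoC (fst w - fst z) + Ci * RtoC (snd w - snd z))%C; [ring|].
  rewrite <- (C_eta (w - z)). reflexivity. }
rewrite E2. pose proof (Rabs_fst_le (w - z)) as Fx. pose proof (Rabs_snd_le (w - z)) as Fy.
change (Rabs (fst w - fst z) <= Cmod (w - z)) in Fx.
change (Rabs (snd w - snd z) <= Cmod (w - z)) in Fy.
assert (Hn : forall x y : R, Rmin (fst z) (fst w) <= x <= Rmax (fst z) (fst w) ->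
   Rmin (snd z) (snd w) <= y <= Rmax (snd z) (snd w) -> Cmod (k (RtoC x + Ci * RtoC y)%C) <= eps / 4).
{ intros x y hx hy. apply Rlt_le, K. rewrite <- (C_eta z).
  eapply Rle_lt_trans; [apply Cmod_components|].
  assert (forall a b c : R, Rmin a b <= c <= Rmax a b -> Rabs (c - a) <= Rabs (b - a)).
  { intros a b c. unfold Rmin, Rmax. destruct (Rle_dec a b) as [r|r]; intros hc.
    - rewrite !Rabs_pos_eq; lra.
    - rewrite (Rabs_left (b - a)) by lra. apply Rabs_le_between. lra. }
  pose proof (H _ _ _ hx). pose proof (H _ _ _ hy). lra. }
assert (hx : Rmin (fst z) (fst w) <= fst w <= Rmax (fst z) (fst w)) by (split; [apply Rmin_r|apply Rmax_r]).
assert (hy : Rmin (snd z) (snd w) <= snd z <= Rmax (snd z) (snd w)) by (split; [apply Rmin_l|apply Rmax_l]).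
pose proof (hInt_bound k (snd z) (fst z) (fst w) (eps / 4) Hk (fun x h => Hn x (snd z) h hy)) as B1.
pose proof (vInt_bound k (fst w) (snd z) (snd w) (eps / 4) Hk (fun y h => Hn (fst w) y hx h)) as B2.
eapply Rle_trans; [apply Cmod_triangle|]. rewrite Cmod_mult, Cmod_Ci.
assert (eps * Rabs (fst w - fst z) <= eps * Cmod (w - z)) by (apply Rmult_le_compat_l; lra).
assert (eps * Rabs (snd w - snd z) <= eps * Cmod (w - z)) by (apply Rmult_le_compat_l; lra).
lra.
Qed.

(** * Means over circles and Cauchy's formula *)

Definition circ (r : R) (t : C) : C := (RtoC r * cexp (Ci * t))%C.

(** Since dz = [Ci] z dt on a circle about 0, the mean of g(c + z) z along z = [circ r t] is the
    contour integral of g divided by 2 pi i. Working with means removes this constant. *)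
Definition cmean (H : C -> C) : C := (/ RtoC (2 * PI) * CInt H 0 (2 * PI))%C.

Lemma RtoC_neq0 (x : R) : x <> 0 -> RtoC x <> 0.
Proof. intros h E. apply h. now injection E. Qed.

Lemma two_PI_neq0 : RtoC (2 * PI) <> 0.
Proof. apply RtoC_neq0. pose proof PI_RGT_0. lra. Qed.

Lemma has_deriv_circ r t : has_deriv (circ r) t (Ci * circ r t).
Proof.
unfold circ.
replace (Ci * (RtoC r * cexp (Ci * t)))%C with
  (0 * cexp (Ci * t) + RtoC r * (cexp (Ci * t) * (0 * t + Ci * 1)))%C by ring.
apply (has_deriv_mult (fun _ => RtoC r) (fun t => cexp (Ci * t)%C)); [apply has_deriv_const|].
apply (has_deriv_comp cexp (fun t => Ci * t)%C); [|apply has_deriv_cexp].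
apply (has_deriv_mult (fun _ => Ci) (fun t => t)); [apply has_deriv_const|apply has_deriv_id].
Qed.

Lemma cont_circ r : forall t, cont_at (circ r) t.
Proof. intros t. eapply has_deriv_cont, has_deriv_circ. Qed.

Lemma Cmod_circ r (t : R) : 0 <= r -> Cmod (circ r (RtoC t)) = r.
Proof.
intros h. unfold circ. rewrite Cmod_mult, Cmod_cexp, Cmod_pos_R by exact h.
simpl. replace (0 * t - 1 * 0) with 0 by ring. rewrite exp_0. ring.
Qed.

Lemma circ_neq0 r t : r <> 0 -> circ r t <> 0.
Proof. intros h. apply Cmult_neq_0; [now apply RtoC_neq0|apply cexp_neq0]. Qed.

Lemma circ_2PI r : circ r (RtoC (2 * PI)) = circ r (RtoC 0).
Proof. unfold circ. rewrite cexp_2PI. replace (Ci * RtoC 0)%C with (RtoC 0) by ring. now rewrite cexp_0. Qed.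

Lemma circ_minus_bound r (t : R) h : 0 <= r -> r - Cmod h <= Cmod (circ r (RtoC t) - h).
Proof. intros hr. rewrite <- (Cmod_circ r t hr) at 1. apply Cmod_triangle_inv. Qed.

Lemma circ_minus_neq0 r (t : R) h : Cmod h < r -> (circ r (RtoC t) - h)%C <> 0.
Proof.
intros hr. apply Cmod_gt_0. pose proof (Cmod_ge_0 h).
pose proof (circ_minus_bound r t h ltac:(lra)). lra.
Qed.

Lemma cmean_ext (F G : C -> C) : (forall t : R, F (RtoC t) = G (RtoC t)) -> cmean F = cmean G.
Proof. intros E. unfold cmean. f_equal. apply CInt_ext; auto. Qed.

Lemma cmean_plus (F G : C -> C) : cont_R F -> cont_R G ->
  cmean (fun t => F t + G t)%C = (cmean F + cmean G)%C.
Proof. intros. unfold cmean. rewrite CInt_plus by assumption. ring. Qed.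

Lemma cmean_minus (F G : C -> C) : cont_R F -> cont_R G ->
  cmean (fun t => F t - G t)%C = (cmean F - cmean G)%C.
Proof. intros. unfold cmean. rewrite CInt_minus by assumption. ring. Qed.

Lemma cmean_scal (c : C) (F : C -> C) : cont_R F -> cmean (fun t => c * F t)%C = (c * cmean F)%C.
Proof. intros. unfold cmean. rewrite CInt_scal by assumption. ring. Qed.

Lemma cmean_const (c : C) : cmean (fun _ => c) = c.
Proof. unfold cmean. rewrite CInt_const, Rminus_0_r. field. apply two_PI_neq0. Qed.

Lemma cmean_bound (F : C -> C) M : cont_R F ->
  (forall t : R, 0 <= t <= 2 * PI -> Cmod (F (RtoC t)) <= M) -> Cmod (cmean F) <= 2 * M.
Proof.
intros HF HM. pose proof PI_RGT_0 as hpi. unfold cmean.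
rewrite Cmod_mult, Cmod_inv by apply two_PI_neq0. rewrite (Cmod_pos_R (2 * PI)) by lra.
apply Rmult_le_reg_l with (2 * PI); [lra|]. rewrite <- Rmult_assoc, Rinv_r, Rmult_1_l by lra.
eapply Rle_trans; [apply CInt_bound with (M := M); [exact HF|]|].
- intros t. rewrite Rmin_left, Rmax_right by lra. apply HM.
- rewrite Rminus_0_r, Rabs_pos_eq by lra. right; ring.
Qed.

Lemma cont_R_bounded (F : C -> C) : cont_R F ->
  exists B, 0 < B /\ forall t : R, 0 <= t <= 2 * PI -> Cmod (F (RtoC t)) <= B.
Proof.
intros HF.
destruct (bounded_continuity (V := R_NormedModule) (fun t : R => fst (F (RtoC t))) 0 (2 * PI)) as [M1 H1].
{ intros x _. apply (cont_at_fst F x), HF. }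
destruct (bounded_continuity (V := R_NormedModule) (fun t : R => snd (F (RtoC t))) 0 (2 * PI)) as [M2 H2].
{ intros x _. apply (cont_at_snd F x), HF. }
exists (Rabs M1 + Rabs M2 + 1). split; [pose proof (Rabs_pos M1); pose proof (Rabs_pos M2); lra|].
intros t ht. specialize (H1 t ht). specialize (H2 t ht).
change (Rabs (fst (F (RtoC t))) < M1) in H1. change (Rabs (snd (F (RtoC t))) < M2) in H2.
eapply Rle_trans; [apply Cmod_le_sum|]. pose proof (Rle_abs M1). pose proof (Rle_abs M2). lra.
Qed.

Lemma cmean_derivative (F f : C -> C) : (forall t : R, has_deriv F t (f t)) -> cont_R f ->
  F (RtoC (2 * PI)) = F (RtoC 0) -> cmean f = 0.
Proof. intros D Hf E. unfold cmean. rewrite (CInt_FTC F f) by assumption. rewrite E. ring. Qed.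

Lemma has_deriv_inv_circ_pow (h : C) r n t : r <> 0 ->
  has_deriv (fun t => (h / circ r t) ^ n)%C t (- (RtoC (INR n) * Ci) * (h / circ r t) ^ n)%C.
Proof.
intros hr. pose proof (circ_neq0 r t hr) as hc.
assert (D1 : has_deriv (fun t => h / circ r t)%C t (- Ci * (h / circ r t))%C).
{ replace (- Ci * (h / circ r t))%C with (0 * / circ r t + h * (- (Ci * circ r t) / (circ r t * circ r t)))%C by (field; exact hc).
  apply (has_deriv_mult (fun _ => h) (fun t => / circ r t)%C); [apply has_deriv_const|].
  apply has_deriv_inv; [apply has_deriv_circ|exact hc]. }
induction n as [|n IH].
- simpl. replace (- (0 * Ci) * 1)%C with (RtoC 0) by ring. apply has_deriv_const.
- rewrite Cpow_S, S_INR, RtoC_plus.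
  replace (- ((RtoC (INR n) + 1) * Ci) * (h / circ r t * (h / circ r t) ^ n))%C with
    ((- Ci * (h / circ r t)) * (h / circ r t) ^ n + (h / circ r t) * (- (RtoC (INR n) * Ci) * (h / circ r t) ^ n))%C by ring.
  apply (has_deriv_mult (fun t => h / circ r t)%C (fun t => (h / circ r t) ^ n)%C); assumption.
Qed.

Lemma cont_R_inv_circ_pow (h : C) r n : r <> 0 -> cont_R (fun t => (h / circ r t) ^ n)%C.
Proof. intros hr t. eapply has_deriv_cont, has_deriv_inv_circ_pow, hr. Qed.

(** The function (h / circ r t)^n is periodic and its derivative is - i n times itself, so its mean
    is 0 for n > 0. *)
Lemma cmean_inv_circ_pow (h : C) r n : r <> 0 -> (0 < n)%nat ->
  cmean (fun t => (h / circ r t) ^ n)%C = 0.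
Proof.
intros hr hn.
assert (E : (- (RtoC (INR n) * Ci) * cmean (fun t => (h / circ r t) ^ n))%C = 0).
{ rewrite <- cmean_scal by now apply cont_R_inv_circ_pow.
  apply cmean_derivative with (fun t => (h / circ r t) ^ n)%C.
  - intros t. now apply has_deriv_inv_circ_pow.
  - apply cont_R_scal. now apply cont_R_inv_circ_pow.
  - now rewrite circ_2PI. }
assert (N : (RtoC (INR n) * Ci)%C <> 0).
{ apply Cmult_neq_0; [apply RtoC_neq0; now apply not_0_INR, Nat.neq_0_lt_0|apply Ci_nz]. }
replace (cmean (fun t => (h / circ r t) ^ n)%C) with
  (- / (RtoC (INR n) * Ci) * (- (RtoC (INR n) * Ci) * cmean (fun t => (h / circ r t) ^ n)))%C by (field; split; [apply Ci_nz|apply RtoC_neq0; now apply not_0_INR, Nat.neq_0_lt_0]).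
rewrite E. ring.
Qed.

Lemma cont_R_cauchy_kernel (F : C -> C) r h : cont_R F -> Cmod h < r ->
  cont_R (fun t => F t / (circ r t - h))%C.
Proof.
intros HF hr t. apply cont_at_div; [apply HF| |now apply circ_minus_neq0].
apply cont_at_minus; [apply cont_circ|apply cont_at_const].
Qed.

Lemma cont_R_circ r : cont_R (circ r).
Proof. intros t. apply cont_circ. Qed.

Lemma cont_R_mult (F G : C -> C) : cont_R F -> cont_R G -> cont_R (fun t => F t * G t)%C.
Proof. intros HF HG t. apply cont_at_mult; auto. Qed.

Lemma eq_0_of_small (z : C) : (forall eps, 0 < eps -> Cmod z <= eps) -> z = 0.
Proof.
intros H. apply Cmod_eq_0. apply Rle_antisym; [|apply Cmod_ge_0].
apply Rnot_lt_le. intros h. specialize (H (Cmod z / 2)). lra.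
Qed.

(** The kernel is the geometric series of h / circ r t, whose terms after the first have mean 0. The
    series is never summed: [M n] is the mean of its remainder after n terms, equal to [M (S n)]
    plus the mean of one term, and it tends to 0. *)
Lemma cauchy_kernel_mean r h : Cmod h < r -> cmean (fun t => circ r t / (circ r t - h))%C = 1.
Proof.
intros hr. pose proof (Cmod_ge_0 h) as h0. assert (hr0 : r <> 0) by lra.
set (Y := fun t => (circ r t / (circ r t - h))%C).
assert (HY : cont_R Y) by (apply cont_R_cauchy_kernel; [apply cont_R_circ|exact hr]).
set (M := fun n => cmean (fun t => (h / circ r t) ^ n * Y t)%C).
assert (HM : forall n, M n = (M (S n) + cmean (fun t => (h / circ r t) ^ n))%C).
{ intros n. unfold M. rewrite <- cmean_plus.
  - apply cmean_ext. intros t. rewrite Cpow_S. unfold Y. field.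
    split; [now apply circ_minus_neq0|now apply circ_neq0].
  - apply cont_R_mult; [now apply cont_R_inv_circ_pow|exact HY].
  - now apply cont_R_inv_circ_pow. }
assert (HM1 : forall n, M 0%nat = (1 + M (S n))%C).
{ induction n as [|n IH].
  - rewrite HM. simpl. rewrite cmean_const. ring.
  - rewrite IH, (HM (S n)), cmean_inv_circ_pow by (auto; lia). ring. }
assert (E : cmean Y = M 0%nat) by (apply cmean_ext; intros; simpl; ring).
change (cmean Y = 1). apply Ceq_minus. apply eq_0_of_small. intros eps he.
assert (Bd : forall n, Cmod (cmean Y - 1) <= 2 * ((Cmod h / r) ^ S n * (r / (r - Cmod h)))).
{ intros n. rewrite E, (HM1 n). replace (1 + M (S n) - 1)%C with (M (S n)) by ring.
  apply cmean_bound; [apply cont_R_mult; [now apply cont_R_inv_circ_pow|exact HY]|].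
  intros t _. unfold Y. rewrite Cmod_mult, Cmod_pow.
  rewrite !Cmod_div by (try apply circ_neq0; try apply circ_minus_neq0; auto).
  rewrite Cmod_circ by lra. apply Rmult_le_compat_l.
  - apply pow_le. apply Rmult_le_pos; [exact h0|apply Rlt_le, Rinv_0_lt_compat; lra].
  - apply Rmult_le_compat_l; [lra|]. apply Rinv_le_contravar; [lra|].
    apply circ_minus_bound; lra. }
assert (Q : 0 <= Cmod h / r < 1).
{ split; [apply Rmult_le_pos; [exact h0|apply Rlt_le, Rinv_0_lt_compat; lra]|].
  apply Rlt_div_l; lra. }
assert (hC : 0 < r / (r - Cmod h)) by (apply Rdiv_lt_0_compat; lra).
destruct (pow_small (Cmod h / r) (eps / (2 * (r / (r - Cmod h)))) Q) as [N HN]; [apply Rdiv_lt_0_compat; lra|].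
apply Rlt_div_r in HN; [|lra]. specialize (Bd N).
assert ((Cmod h / r) ^ S N <= (Cmod h / r) ^ N).
{ simpl. rewrite <- (Rmult_1_l ((Cmod h / r) ^ N)) at 2.
  apply Rmult_le_compat_r; [apply pow_le|]; lra. }
assert ((Cmod h / r) ^ S N * (r / (r - Cmod h)) <= (Cmod h / r) ^ N * (r / (r - Cmod h)))
  by (apply Rmult_le_compat_r; lra).
lra.
Qed.

(** Up to the factor [Ci] the integrand is the derivative of a primitive of [g] along the closed
    circle. The point [p] is allowed for the sake of slope functions. *)
Lemma cauchy_theorem (g : C -> C) (p c : C) r : (forall z, cont_at g z) ->
  (forall z, z <> p -> exists l, has_deriv g z l) ->
  cmean (fun t => g (c + circ r t) * circ r t)%C = 0.
Proof.
intros Hc Hd. destruct (primitive_exists g p Hc Hd) as [G HG].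
assert (Hk : cont_R (fun t => g (c + circ r t) * circ r t)%C).
{ intros t. apply cont_at_mult; [|apply cont_circ].
  apply (cont_at_comp g (fun t => c + circ r t)%C); [|apply Hc].
  apply cont_at_plus; [apply cont_at_const|apply cont_circ]. }
assert (E : cmean (fun t => Ci * (g (c + circ r t) * circ r t))%C = 0).
{ apply cmean_derivative with (fun t => G (c + circ r t)%C).
  - intros t. replace (Ci * (g (c + circ r t) * circ r t))%C with (g (c + circ r t) * (0 + Ci * circ r t))%C by ring.
    apply (has_deriv_comp G (fun t => c + circ r t)%C); [|apply HG].
    apply has_deriv_plus; [apply has_deriv_const|apply has_deriv_circ].
  - now apply cont_R_scal.
  - now rewrite circ_2PI. }
rewrite cmean_scal in E by exact Hk.
match goal with |- ?x = _ => replace x with (/ Ci * (Ci * x))%C by (field; apply Ci_nz) end.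
rewrite E. ring.
Qed.

Lemma cont_R_circle (f : C -> C) c r : (forall z, cont_at f z) -> cont_R (fun t => f (c + circ r t)%C).
Proof.
intros H t. apply (cont_at_comp f (fun t => c + circ r t)%C); [|apply H].
apply cont_at_plus; [apply cont_at_const|apply cont_circ].
Qed.

Lemma has_deriv_slope_off (f phi : C -> C) w z : holo f -> z <> w ->
  (forall u, f u = (f w + (u - w) * phi u)%C) -> exists l, has_deriv phi z l.
Proof.
intros Hf hz E.
destruct (Hf z) as [l D].
destruct (has_deriv_div (fun u => f u - f w)%C (fun u => u - w)%C z (l + 0) (1 + 0)) as [k Dk].
- apply has_deriv_plus; [exact D|apply has_deriv_const].
- apply has_deriv_plus; [apply has_deriv_id|apply has_deriv_const].
- now apply Cminus_neq.
- exists k. apply has_deriv_local with (fun u => (f u - f w) / (u - w))%C (Cmod (z - w)); [| |exact Dk].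
  + apply Cmod_gt_0. now apply Cminus_neq.
  + intros u hu. assert (hu' : (u - w)%C <> 0).
    { apply Cminus_neq. intros ->. rewrite Cmod_minus_sym in hu. lra. }
    rewrite (E u). field. exact hu'.
Qed.

(** Cauchy's theorem is applied to the slope [phi] of [f] at c + h, continuous there by the
    definition of [has_deriv] and differentiable elsewhere. *)
Lemma cauchy_formula (f : C -> C) c h r : holo f -> Cmod h < r ->
  f (c + h)%C = cmean (fun t => f (c + circ r t) * circ r t / (circ r t - h))%C.
Proof.
intros Hf hr. pose proof (holo_cont f Hf) as Cf.
destruct (Hf (c + h)%C) as [l D]. pose proof D as [phi [Hp [Lp E]]].
assert (Dp : forall z, z <> (c + h)%C -> exists l, has_deriv phi z l).
{ intros z hz. now apply has_deriv_slope_off with f (c + h)%C. }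
assert (Cp : forall z, cont_at phi z).
{ intros z. destruct (Ceq_dec z (c + h)%C) as [->|hz]; [exact Hp|].
  destruct (Dp z hz) as [k Dk]. exact (has_deriv_cont phi z k Dk). }
pose proof (cauchy_theorem phi (c + h)%C c r Cp Dp) as T.
assert (E2 : forall t : R, (phi (c + circ r t) * circ r t)%C =
   (f (c + circ r t) * circ r t / (circ r t - h) - f (c + h) * (circ r t / (circ r t - h)))%C).
{ intros t. rewrite (E (c + circ r t)%C). field. now apply circ_minus_neq0. }
rewrite (cmean_ext (fun t => phi (c + circ r t) * circ r t)%C
  (fun t => f (c + circ r t) * circ r t / (circ r t - h) - f (c + h) * (circ r t / (circ r t - h)))%C E2) in T.
assert (HK : cont_R (fun t => circ r t / (circ r t - h))%C) by (apply cont_R_cauchy_kernel; [apply cont_R_circ|exact hr]).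
rewrite cmean_minus in T.
- rewrite cmean_scal, cauchy_kernel_mean in T by assumption.
  symmetry. apply Ceq_minus. rewrite <- T. ring.
- apply cont_R_cauchy_kernel; [|exact hr]. apply cont_R_mult; [now apply cont_R_circle|apply cont_R_circ].
- now apply cont_R_scal.
Qed.

(** Differentiability at the centre suffices, because the circle can be centred at any given point.
    The density [psi] is merely continuous, so that the lemma also applies to limits not yet known
    to be entire. *)
Lemma cauchy_transform_deriv (psi : C -> C) r : 0 < r -> cont_R psi ->
  exists l, has_deriv (fun h => cmean (fun t => psi t / (circ r t - h))%C) 0 l.
Proof.
intros hr Hpsi. destruct (cont_R_bounded psi Hpsi) as [M [hM HM]].
set (K := fun h => cmean (fun t => psi t / (circ r t - h))%C).
set (k1 := cmean (fun t => psi t / (circ r t * circ r t))%C).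
(* With z = [circ r t], 1/(z - h) - 1/z - h/z^2 = h^2 / (z^2 (z - h)). Here |z| = r and |z - h| >=
   r/2, and [cmean_bound] loses a factor 2. *)
set (Q := 4 * M / (r * r * r)).
assert (hQ : 0 < Q) by (apply Rdiv_lt_0_compat; [lra|repeat apply Rmult_lt_0_compat; exact hr]).
assert (C1 : cont_R (fun t => psi t / (circ r t * circ r t))%C).
{ intros t. apply cont_at_div; [apply Hpsi| |apply Cmult_neq_0; apply circ_neq0; lra].
  apply cont_at_mult; apply cont_circ. }
exists k1. apply slope_has_deriv. intros eps he.
exists (Rmin (r / 2) (eps / Q)). split; [apply Rmin_glb_lt; [lra|now apply Rdiv_lt_0_compat]|].
intros h hh. replace (h - 0)%C with h in * by ring.
pose proof (Rlt_le_trans _ _ _ hh (Rmin_l _ _)) as hh1.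
pose proof (Rlt_le_trans _ _ _ hh (Rmin_r _ _)) as hh2.
assert (C2 : cont_R (fun t => psi t / (circ r t * circ r t) / (circ r t - h))%C)
  by (apply cont_R_cauchy_kernel; [exact C1|lra]).
assert (E : (K h - K 0 - k1 * h)%C = (h * h * cmean (fun t => psi t / (circ r t * circ r t) / (circ r t - h)))%C).
{ unfold K, k1. rewrite <- cmean_scal by exact C2.
  rewrite (Cmult_comm (cmean _) h), <- cmean_scal by exact C1.
  rewrite <- cmean_minus by (apply cont_R_cauchy_kernel; [exact Hpsi|rewrite ?Cmod_0; lra]).
  rewrite <- cmean_minus.
  - apply cmean_ext. intros t. field.
    repeat split; first [apply circ_neq0; lra | apply circ_minus_neq0; rewrite ?Cmod_0; lra].
  - intros t. apply cont_at_minus; (apply cont_R_cauchy_kernel; [exact Hpsi|rewrite ?Cmod_0; lra]).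
  - now apply cont_R_scal. }
change (Cmod (K h - K 0 - k1 * h) <= eps * Cmod h). rewrite E, !Cmod_mult.
assert (Bd : Cmod (cmean (fun t => psi t / (circ r t * circ r t) / (circ r t - h))%C) <= Q).
{ unfold Q. replace (4 * M / (r * r * r)) with (2 * (M / (r * r) / (r / 2))) by (field; lra).
  apply cmean_bound; [exact C2|]. intros t ht.
  assert (circ r t <> 0) by (apply circ_neq0; lra).
  rewrite !Cmod_div, Cmod_mult, Cmod_circ; try lra; auto.
  2: now apply Cmult_neq_0. 2: apply circ_minus_neq0; lra.
  assert (0 < r * r) by nra.
  apply Rmult_le_compat.
  - apply Rmult_le_pos; [apply Cmod_ge_0|now apply Rlt_le, Rinv_0_lt_compat].
  - apply Rlt_le, Rinv_0_lt_compat. pose proof (circ_minus_bound r t h ltac:(lra)). lra.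
  - apply Rmult_le_compat_r; [now apply Rlt_le, Rinv_0_lt_compat|auto].
  - apply Rinv_le_contravar; [lra|]. pose proof (circ_minus_bound r t h ltac:(lra)). lra. }
apply Rlt_div_r in hh2; [|exact hQ].
pose proof (Cmod_ge_0 h) as h0.
apply Rle_trans with (Cmod h * Cmod h * Q); [apply Rmult_le_compat_l; nra|nra].
Qed.

(** Only the point [c] is in question. Subtracting Cauchy's formulas at c + h and c shows that the
    slope near [c] is the Cauchy transform of the values of [f] on the unit circle, which is
    differentiable at 0; at h = 0 the two agree by continuity. *)
Lemma holo_slope (f : C -> C) c : holo f -> exists g, holo g /\ forall z, f z = (f c + (z - c) * g z)%C.
Proof.
intros Hf. destruct (Hf c) as [l [phi [Hp [Lp E]]]]. exists phi; split; [|exact E].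
pose proof (holo_cont f Hf) as Cf.
intros z. destruct (Ceq_dec z c) as [->|hz]; [|now apply has_deriv_slope_off with f c].
set (K := fun h => cmean (fun t => f (c + circ 1 t) / (circ 1 t - h))%C).
assert (CR : cont_R (fun t => f (c + circ 1 t)%C)) by now apply cont_R_circle.
destruct (cauchy_transform_deriv (fun t => f (c + circ 1 t)%C) 1 Rlt_0_1 CR) as [k Dk].
assert (EK : forall h, Cmod h < 1 -> h <> 0 -> K h = phi (c + h)%C).
{ intros h hh h0.
  assert (F : f (c + h)%C = (f c + h * K h)%C).
  { unfold K. rewrite <- cmean_scal by (apply cont_R_cauchy_kernel; assumption).
    rewrite <- (Cplus_0_r c) at 2.
    rewrite (cauchy_formula f c h 1 Hf hh), (cauchy_formula f c 0 1 Hf) by (rewrite Cmod_0; lra).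
    rewrite <- cmean_plus.
    - apply cmean_ext. intros t. field.
      repeat split; first [apply circ_neq0; lra | apply circ_minus_neq0; rewrite ?Cmod_0; lra].
    - apply cont_R_cauchy_kernel; [|rewrite Cmod_0; lra]. apply cont_R_mult; [exact CR|apply cont_R_circ].
    - apply cont_R_scal. apply cont_R_cauchy_kernel; assumption. }
  rewrite (E (c + h)%C) in F. replace (c + h - c)%C with h in F by ring.
  transitivity (/ h * ((f c + h * K h) - f c))%C; [field; exact h0|]. rewrite <- F. field; exact h0. }
assert (EK0 : K 0 = phi c).
{ apply Ceq_minus, eq_0_of_small. intros eps he.
  destruct (Hp (eps / 2)) as [d [hd Hd]]; [lra|].
  destruct (has_deriv_cont _ _ _ Dk (eps / 2)) as [e [hee He]]; [lra|].
  set (m := Rmin (1 / 2) (Rmin (d / 2) (e / 2))).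
  assert (hm : 0 < m) by (repeat apply Rmin_glb_lt; lra).
  assert (m1 : m <= 1 / 2) by apply Rmin_l.
  assert (m2 : m <= d / 2) by (eapply Rle_trans; [apply Rmin_r|apply Rmin_l]).
  assert (m3 : m <= e / 2) by (eapply Rle_trans; [apply Rmin_r|apply Rmin_r]).
  specialize (Hd (c + RtoC m)%C). specialize (He (RtoC m)).
  replace (c + RtoC m - c)%C with (RtoC m) in Hd by ring.
  replace (RtoC m - 0)%C with (RtoC m) in He by ring.
  rewrite Cmod_pos_R in Hd, He by lra.
  specialize (Hd ltac:(lra)). specialize (He ltac:(lra)).
  change (Cmod (K (RtoC m) - K 0) < eps / 2) in He.
  rewrite <- (EK (RtoC m)) in Hd; [|rewrite Cmod_pos_R; lra|apply RtoC_neq0; lra].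
  replace (K 0 - phi c)%C with ((K (RtoC m) - phi c) - (K (RtoC m) - K 0))%C by ring.
  eapply Rle_trans; [apply Cmod_triangle_minus|]. lra. }
exists (k * 1)%C. apply has_deriv_local with (fun z => K (z - c)%C) 1; [lra| |].
- intros w hw. destruct (Ceq_dec w c) as [->|hwc].
  + replace (c - c)%C with (RtoC 0) by ring. exact EK0.
  + rewrite EK by (auto; now apply Cminus_neq). f_equal. ring.
- apply (has_deriv_comp K (fun z => z - c)%C).
  + replace (RtoC 1) with (1 + 0)%C by ring. apply has_deriv_plus; [apply has_deriv_id|apply has_deriv_const].
  + replace (c - c)%C with (RtoC 0) by ring. exact Dk.
Qed.

Lemma holo_div_root (f : C -> C) c : holo f -> f c = 0 -> exists g, holo g /\ forall z, f z = ((z - c) * g z)%C.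
Proof.
intros Hf h. destruct (holo_slope f c Hf) as [g [Hg E]]. exists g; split; [exact Hg|].
intros z. rewrite (E z), h. ring.
Qed.

(** Cauchy's formula on a circle twice as large reduces compactness of a disc to compactness of the
    interval [0, 2 pi]. *)
Lemma holo_bounded (f : C -> C) r : holo f -> exists B, 0 < B /\ forall z, Cmod z <= r -> Cmod (f z) <= B.
Proof.
intros Hf. set (s := Rmax r 1).
assert (hs1 : 1 <= s) by apply Rmax_r. assert (hsr : r <= s) by apply Rmax_l.
assert (CR : cont_R (fun t => f (0 + circ (2 * s) t)%C)) by (apply cont_R_circle; now apply holo_cont).
destruct (cont_R_bounded _ CR) as [M [hM HM]].
exists (2 * (M * (2 * s) / s)). split.
{ apply Rmult_lt_0_compat; [lra|]. apply Rdiv_lt_0_compat; nra. }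
intros z hz. replace z with (0 + z)%C by ring.
rewrite (cauchy_formula f 0 z (2 * s) Hf) by lra.
apply cmean_bound.
- apply cont_R_cauchy_kernel; [|lra]. apply cont_R_mult; [exact CR|apply cont_R_circ].
- intros t ht. rewrite Cmod_div by (apply circ_minus_neq0; lra).
  rewrite Cmod_mult, Cmod_circ by lra. apply Rmult_le_compat.
  + apply Rmult_le_pos; [apply Cmod_ge_0|lra].
  + apply Rlt_le, Rinv_0_lt_compat. pose proof (circ_minus_bound (2 * s) t z ltac:(lra)). lra.
  + apply Rmult_le_compat_r; [lra|]. now apply HM.
  + apply Rinv_le_contravar; [lra|]. pose proof (circ_minus_bound (2 * s) t z ltac:(lra)). lra.
Qed.

(** * Limits of entire functions *)

Definition clim (u : nat -> C) (l : C) : Prop :=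
  forall eps, 0 < eps -> exists N, forall n, (N <= n)%nat -> Cmod (u n - l) <= eps.

Lemma clim_unique u l m : clim u l -> clim u m -> l = m.
Proof.
intros Hl Hm. apply Ceq_minus, eq_0_of_small. intros eps he.
destruct (Hl (eps / 2)) as [N HN]; [lra|]. destruct (Hm (eps / 2)) as [M HM]; [lra|].
specialize (HN (max N M) (Nat.le_max_l _ _)). specialize (HM (max N M) (Nat.le_max_r _ _)).
replace (l - m)%C with ((u (max N M) - m) - (u (max N M) - l))%C by ring.
eapply Rle_trans; [apply Cmod_triangle_minus|]. lra.
Qed.

Lemma clim_eventually_const u l N : (forall n, (N <= n)%nat -> u n = l) -> clim u l.
Proof.
intros H eps he. exists N. intros n hn. rewrite H by exact hn.
replace (l - l)%C with (RtoC 0) by ring. rewrite Cmod_0. lra.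
Qed.

Lemma clim_ext_eventually u v l N : (forall n, (N <= n)%nat -> u n = v n) -> clim u l -> clim v l.
Proof.
intros E H eps he. destruct (H eps he) as [M HM]. exists (max N M). intros n hn.
rewrite <- E by lia. apply HM. lia.
Qed.

Lemma clim_scal c u l : clim u l -> clim (fun n => c * u n)%C (c * l)%C.
Proof.
intros H eps he. pose proof (Cmod_ge_0 c) as hc.
destruct (H (eps / (Cmod c + 1))) as [N HN]; [apply Rdiv_lt_0_compat; lra|].
exists N. intros n hn. specialize (HN n hn).
replace (c * u n - c * l)%C with (c * (u n - l))%C by ring. rewrite Cmod_mult.
apply Rle_trans with (Cmod c * (eps / (Cmod c + 1))); [now apply Rmult_le_compat_l|].
apply Rle_trans with ((Cmod c + 1) * (eps / (Cmod c + 1))); [|right; field; lra].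
apply Rmult_le_compat_r; [apply Rlt_le, Rdiv_lt_0_compat; lra|lra].
Qed.

Lemma clim_plus_const c u l : clim u l -> clim (fun n => c + u n)%C (c + l)%C.
Proof.
intros H eps he. destruct (H eps he) as [N HN]. exists N. intros n hn.
replace (c + u n - (c + l))%C with (u n - l)%C by ring. now apply HN.
Qed.

Lemma clim_shift u l k : clim u l -> clim (fun n => u (n + k)%nat) l.
Proof.
intros H eps he. destruct (H eps he) as [N HN]. exists N. intros n hn. apply HN. lia.
Qed.

Lemma clim_bound u l c B N : clim u l -> (forall n, (N <= n)%nat -> Cmod (u n - c) <= B) -> Cmod (l - c) <= B.
Proof.
intros H HB. apply le_epsilon. intros eps he. destruct (H eps he) as [M HM].
specialize (HM (max N M) (Nat.le_max_r _ _)). specialize (HB (max N M) (Nat.le_max_l _ _)).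
replace (l - c)%C with ((u (max N M) - c) - (u (max N M) - l))%C by ring.
eapply Rle_trans; [apply Cmod_triangle_minus|]. lra.
Qed.

Lemma geometric_limit_R (u : nat -> R) A : 0 <= A ->
  (forall n, Rabs (u (S n) - u n) <= A * (/ 2) ^ n) ->
  exists l, forall n, Rabs (u n - l) <= 2 * A * (/ 2) ^ n.
Proof.
intros hA H.
destruct (nested_intervals (fun n => u n - 2 * A * (/ 2) ^ n) (fun n => u n + 2 * A * (/ 2) ^ n)) as [l L].
- intros n. specialize (H n). apply Rabs_le_between in H. pose proof (half_pow_pos n) as hp.
  simpl. set (e := (/ 2) ^ n) in *. assert (0 <= A * e) by nra. lra.
- exists l. intros n. specialize (L n). simpl in L. apply Rabs_le_between. lra.
Qed.

Lemma half_pow_decr n m : (n <= m)%nat -> (/ 2) ^ m <= (/ 2) ^ n.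
Proof.
intros h. replace m with (n + (m - n))%nat by lia. rewrite pow_add.
pose proof (half_pow_pos n).
assert ((/ 2) ^ (m - n) <= 1) by (rewrite <- (pow1 (m - n)); apply pow_incr; lra). nra.
Qed.

Lemma geometric_limit (u : nat -> C) A N : 0 <= A ->
  (forall n, (N <= n)%nat -> Cmod (u (S n) - u n) <= A * (/ 2) ^ n) ->
  exists l, clim u l /\ forall n, (N <= n)%nat -> Cmod (u n - l) <= 4 * A * (/ 2) ^ n.
Proof.
intros hA H.
assert (hp : 0 < (/ 2) ^ N) by apply half_pow_pos.
destruct (geometric_limit_R (fun n => fst (u (N + n)%nat)) (A * (/ 2) ^ N)) as [x Hx].
{ nra. } { intros n. rewrite Rmult_assoc, <- pow_add, Nat.add_succ_r.
  eapply Rle_trans; [apply (Rabs_fst_le (u (S (N + n)) - u (N + n)%nat))|]. apply H. lia. }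
destruct (geometric_limit_R (fun n => snd (u (N + n)%nat)) (A * (/ 2) ^ N)) as [y Hy].
{ nra. } { intros n. rewrite Rmult_assoc, <- pow_add, Nat.add_succ_r.
  eapply Rle_trans; [apply (Rabs_snd_le (u (S (N + n)) - u (N + n)%nat))|]. apply H. lia. }
assert (B : forall n, (N <= n)%nat -> Cmod (u n - (x, y)) <= 4 * A * (/ 2) ^ n).
{ intros n hn. replace n with (N + (n - N))%nat by lia.
  specialize (Hx (n - N)%nat). specialize (Hy (n - N)%nat).
  eapply Rle_trans; [apply Cmod_le_sum|].
  rewrite Rmult_assoc, (Rmult_assoc A), <- pow_add, <- Rmult_assoc in Hx.
  rewrite Rmult_assoc, (Rmult_assoc A), <- pow_add, <- Rmult_assoc in Hy.
  change (Rabs (fst (u (N + (n - N))%nat) - x) + Rabs (snd (u (N + (n - N))%nat) - y) <= 4 * A * (/ 2) ^ (N + (n - N))).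
  lra. }
exists (x, y); split; [|exact B].
intros eps he. destruct (half_pow_small (eps / (4 * A + 1))) as [M HM]; [apply Rdiv_lt_0_compat; lra|].
apply Rlt_div_r in HM; [|lra].
exists (max N M). intros n hn. eapply Rle_trans; [apply B; lia|].
pose proof (half_pow_decr M n ltac:(lia)). pose proof (half_pow_pos n). nra.
Qed.

(* Weierstrass's convergence theorem: Cauchy's formula passes to the limit. *)
Lemma holo_limit (F : nat -> C -> C) : (forall n, holo (F n)) ->
  (forall rho, exists N A, 0 <= A /\ forall n z, (N <= n)%nat -> Cmod z <= rho ->
     Cmod (F (S n) z - F n z) <= A * (/ 2) ^ n) ->
  exists G, holo G /\ forall z, clim (fun n => F n z) (G z).
Proof.
intros HF HC.
assert (L0 : forall z, exists l, clim (fun n => F n z) l).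
{ intros z. destruct (HC (Cmod z)) as [N [A [hA HA]]].
  destruct (geometric_limit (fun n => F n z) A N hA) as [l [Hl _]].
  { intros n hn. apply HA; [exact hn|lra]. }
  now exists l. }
destruct (choice (fun z l => clim (fun n => F n z) l) L0) as [G HG].
assert (U : forall rho eps, 0 < eps -> exists n, forall z, Cmod z <= rho -> Cmod (F n z - G z) <= eps).
{ intros rho eps he. destruct (HC rho) as [N [A [hA HA]]].
  destruct (half_pow_small (eps / (4 * A + 1))) as [M HM]; [apply Rdiv_lt_0_compat; lra|].
  apply Rlt_div_r in HM; [|lra].
  exists (max N M). intros z hz.
  destruct (geometric_limit (fun n => F n z) A N hA) as [l [Hl Bl]].
  { intros n hn. now apply HA. }
  rewrite <- (clim_unique _ _ _ Hl (HG z)). eapply Rle_trans; [apply Bl; lia|].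
  pose proof (half_pow_decr M (max N M) ltac:(lia)). pose proof (half_pow_pos (max N M)). nra. }
exists G; split; [|exact HG].
assert (CG : forall z, cont_at G z).
{ intros z eps he. destruct (U (Cmod z + 1) (eps / 4)) as [n Hn]; [lra|].
  destruct (holo_cont (F n) (HF n) z (eps / 4)) as [d [hd Hd]]; [lra|].
  exists (Rmin d 1); split; [apply Rmin_glb_lt; lra|]. intros w hw.
  pose proof (Hd w (Rlt_le_trans _ _ _ hw (Rmin_l _ _))) as X.
  pose proof (Rlt_le_trans _ _ _ hw (Rmin_r _ _)) as hw1.
  assert (Cmod w <= Cmod z + 1) by (pose proof (Cmod_triangle_inv w z); lra).
  pose proof (Hn w H) as Y. pose proof (Hn z ltac:(lra)) as Z.
  replace (G w - G z)%C with ((F n w - F n z) - (F n w - G w) + (F n z - G z))%C by ring.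
  eapply Rle_lt_trans; [apply Cmod_triangle|].
  eapply Rle_lt_trans; [apply Rplus_le_compat_r, Cmod_triangle_minus|]. lra. }
intros c.
set (psi := fun t => (G (c + circ 1 t) * circ 1 t)%C).
assert (Cpsi : cont_R psi) by (apply cont_R_mult; [now apply cont_R_circle|apply cont_R_circ]).
destruct (cauchy_transform_deriv psi 1 Rlt_0_1 Cpsi) as [k Dk].
exists (k * (1 + 0))%C.
apply has_deriv_local with (fun z => cmean (fun t => psi t / (circ 1 t - (z - c)))%C) 1; [lra| |].
- intros w hw. set (h := (w - c)%C) in *. replace w with (c + h)%C by (unfold h; ring).
  apply Ceq_minus, eq_0_of_small. intros eps he.
  (* The error splits into that of [F n] at c + h and that of the mean, the latter at most 2 / (1 -
     |h|) times the error on the circle; [q] adds the two factors. *)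
  set (q := 1 + 2 / (1 - Cmod h)).
  assert (hq : 0 < q) by (unfold q; pose proof (Rdiv_lt_0_compat 2 (1 - Cmod h)); lra).
  destruct (U (Cmod c + 1) (eps / q)) as [n Hn]; [now apply Rdiv_lt_0_compat|].
  set (phi := fun t => (F n (c + circ 1 t) * circ 1 t)%C).
  assert (Cphi : cont_R phi) by (apply cont_R_mult; [apply cont_R_circle; now apply holo_cont|apply cont_R_circ]).
  assert (E : F n (c + h)%C = cmean (fun t => phi t / (circ 1 t - h))%C) by (apply cauchy_formula; auto).
  replace (_ - G (c + h))%C with ((F n (c + h) - G (c + h)) - cmean (fun t => (phi t / (circ 1 t - h) - psi t / (circ 1 t - h))))%C.
  2: { rewrite E, cmean_minus by (apply cont_R_cauchy_kernel; assumption). ring. }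
  replace eps with (eps / q + 2 * (eps / q / (1 - Cmod h))) by (unfold q; field; unfold q in hq; lra).
  eapply Rle_trans; [apply Cmod_triangle_minus|]. apply Rplus_le_compat.
  + apply Hn. eapply Rle_trans; [apply Cmod_triangle|]. lra.
  + apply cmean_bound.
    * intros t. apply cont_at_minus; (apply cont_R_cauchy_kernel; assumption).
    * intros t _. replace (phi t / (circ 1 t - h) - psi t / (circ 1 t - h))%C with
        ((F n (c + circ 1 t) - G (c + circ 1 t)) * circ 1 t / (circ 1 t - h))%C
        by (unfold phi, psi; field; now apply circ_minus_neq0).
      rewrite Cmod_div by now apply circ_minus_neq0. rewrite Cmod_mult, Cmod_circ, Rmult_1_r by lra.
      apply Rmult_le_compat; [apply Cmod_ge_0| | |].
      -- apply Rlt_le, Rinv_0_lt_compat. pose proof (circ_minus_bound 1 t h ltac:(lra)). lra.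
      -- apply Hn. eapply Rle_trans; [apply Cmod_triangle|]. rewrite Cmod_circ; lra.
      -- apply Rinv_le_contravar; [lra|]. pose proof (circ_minus_bound 1 t h ltac:(lra)). lra.
- apply (has_deriv_comp (fun h => cmean (fun t => psi t / (circ 1 t - h))%C) (fun z => z - c)%C).
  + apply has_deriv_plus; [apply has_deriv_id|]. apply has_deriv_const.
  + replace (c - c)%C with (RtoC 0) by ring. exact Dk.
Qed.

(** * Roots *)

Lemma exists_nat_ge x : exists N, x <= INR N.
Proof.
exists (Z.to_nat (up (Rmax x 0))). destruct (archimed (Rmax x 0)) as [h _].
pose proof (Rmax_l x 0). pose proof (Rmax_r x 0).
rewrite INR_IZR_INZ, Z2Nat.id; [lra|]. apply le_IZR. lra.
Qed.

Definition prodl (L : list C) (z : C) : C := fold_right (fun a x => ((z - a) * x)%C) (RtoC 1) L.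

Lemma prodl_cons a L z : prodl (a :: L) z = ((z - a) * prodl L z)%C.
Proof. reflexivity. Qed.

Lemma holo_prodl L : holo (prodl L).
Proof.
induction L as [|a L IH]; [apply holo_const|].
apply holo_mult; [|exact IH]. apply holo_minus; [apply holo_id|apply holo_const].
Qed.

Lemma Cmult_integral (a b : C) : (a * b)%C = 0 -> a = 0 \/ b = 0.
Proof.
intros E. destruct (Ceq_dec a 0) as [h|h]; [now left|right].
replace b with (/ a * (a * b))%C by (field; exact h). rewrite E. ring.
Qed.

Lemma prodl_root L z : prodl L z = 0 <-> In z L.
Proof.
induction L as [|a L IH]; simpl.
- split; [|tauto]. intros E. now apply C1_nz in E.
- split.
  + intros E. destruct (Cmult_integral _ _ E) as [h|h]; [left|right; now apply IH].
    symmetry. apply Ceq_minus. exact h.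
  + intros [->|h]; [ring|]. apply IH in h. rewrite h. ring.
Qed.

Lemma mean_value (f : C -> C) c r : holo f -> 0 < r -> f c = cmean (fun t => f (c + circ r t)%C).
Proof.
intros Hf hr. rewrite <- (Cplus_0_r c) at 1.
rewrite (cauchy_formula f c 0 r Hf) by (rewrite Cmod_0; exact hr).
apply cmean_ext. intros t. field. apply circ_neq0; lra.
Qed.

(* A weak form of Jensen's inequality: on the circle of radius 3R around c each
   factor z - a is at least 2R, at c it is at most R. *)
Lemma roots_bounded (f : C -> C) c rho : holo f -> f c <> 0 ->
  exists N, forall L h, holo h -> (forall z, f z = (prodl L z * h z)%C) ->
    (forall a, In a L -> Cmod a <= rho) -> (length L <= N)%nat.
Proof.
intros Hf hc. apply Cmod_gt_0 in hc.
set (r := Rabs rho + Cmod c + 1).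
assert (hr : 0 < r) by (unfold r; pose proof (Rabs_pos rho); pose proof (Cmod_ge_0 c); lra).
destruct (cont_R_bounded (fun t => f (c + circ (3 * r) t)%C)) as [B [hB HB]].
{ apply cont_R_circle. now apply holo_cont. }
(* A list of k roots forces |f c| <= r^k * 2 B / (2 r)^k = 2 B / 2^k, which fails for k > N. *)
destruct (half_pow_small (Cmod (f c) / (2 * B))) as [N HN]; [apply Rdiv_lt_0_compat; lra|].
apply Rlt_div_r in HN; [|lra].
exists N. intros L h Hh E HL.
assert (Hr : forall a, In a L -> Cmod (a - c) <= r).
{ intros a ha. eapply Rle_trans; [apply Cmod_triangle_minus|]. pose proof (HL a ha).
  pose proof (Rle_abs rho). unfold r. lra. }
clear HL.
assert (P1 : Cmod (prodl L c) <= r ^ length L).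
{ clear E. induction L as [|a L IH]; [simpl; rewrite Cmod_1; lra|].
  rewrite prodl_cons, Cmod_mult. simpl length. simpl pow.
  apply Rmult_le_compat; try apply Cmod_ge_0.
  - rewrite Cmod_minus_sym. apply Hr. now left.
  - apply IH. intros b hb. apply Hr. now right. }
assert (P2 : forall t : R, (2 * r) ^ length L <= Cmod (prodl L (c + circ (3 * r) (RtoC t))%C)).
{ intros t. clear E P1. induction L as [|a L IH]; [simpl; rewrite Cmod_1; lra|].
  rewrite prodl_cons, Cmod_mult. simpl length. simpl pow.
  apply Rmult_le_compat; [lra|apply pow_le; lra| |].
  - replace (c + circ (3 * r) (RtoC t) - a)%C with (circ (3 * r) (RtoC t) - (a - c))%C by ring.
    pose proof (circ_minus_bound (3 * r) t (a - c) ltac:(lra)). pose proof (Hr a (or_introl eq_refl)). lra.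
  - apply IH. intros b hb. apply Hr. now right. }
assert (p2 : 0 < (2 * r) ^ length L) by (apply pow_lt; lra).
assert (Hc : Cmod (h c) <= 2 * (B / (2 * r) ^ length L)).
{ rewrite (mean_value h c (3 * r) Hh) by lra. apply cmean_bound; [apply cont_R_circle; now apply holo_cont|].
  intros t ht. specialize (HB t ht). specialize (P2 t). simpl in HB. rewrite E, Cmod_mult in HB.
  apply Rle_div_r; [exact p2|]. pose proof (Cmod_ge_0 (h (c + circ (3 * r) (RtoC t))%C)). nra. }
destruct (Nat.le_gt_cases (length L) N) as [l|l]; [exact l|exfalso].
assert (K : Cmod (f c) <= (/ 2) ^ length L * (2 * B)).
{ rewrite E, Cmod_mult. rewrite Rpow_mult_distr in Hc.
  assert (q1 : 0 < r ^ length L) by (apply pow_lt; lra).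
  assert (q2 : 0 < 2 ^ length L) by (apply pow_lt; lra).
  replace ((/ 2) ^ length L * (2 * B)) with (r ^ length L * (2 * (B / (2 ^ length L * r ^ length L)))).
  - apply Rmult_le_compat; auto using Cmod_ge_0.
  - rewrite pow_inv. field. lra. }
pose proof (half_pow_decr N (length L) ltac:(lia)). nra.
Qed.

(** Common roots are divided out one at a time. The process stops because the removed roots are
    roots of [f] with multiplicity, whose number in the disc [roots_bounded] limits. *)
Lemma extract_common_roots (f g : C -> C) c rho : holo f -> holo g -> f c <> 0 ->
  exists L f1 g1, holo f1 /\ holo g1 /\
    (forall z, f z = (prodl L z * f1 z)%C) /\ (forall z, g z = (prodl L z * g1 z)%C) /\
    (forall a, In a L -> Cmod a <= rho) /\
    (forall z, Cmod z <= rho -> f1 z <> 0 \/ g1 z <> 0).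
Proof.
intros Hf Hg hc. destruct (roots_bounded f c rho Hf hc) as [N HN].
assert (K : forall k, exists L f1 g1, holo f1 /\ holo g1 /\
    (forall z, f z = (prodl L z * f1 z)%C) /\ (forall z, g z = (prodl L z * g1 z)%C) /\
    (forall a, In a L -> Cmod a <= rho) /\
    ((k <= length L)%nat \/ forall z, Cmod z <= rho -> f1 z <> 0 \/ g1 z <> 0)).
{ induction k as [|k IH].
  - exists nil, f, g. repeat split; auto.
    + intros z; simpl; ring.
    + intros z; simpl; ring.
    + intros a [].

  - destruct IH as [L [f1 [g1 [Hf1 [Hg1 [Ef [Eg [HL D]]]]]]]].
    destruct (classic (forall z, Cmod z <= rho -> f1 z <> 0 \/ g1 z <> 0)) as [h|h].
    { exists L, f1, g1. repeat split; auto. }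
    destruct D as [D|D]; [|contradiction].
    apply not_all_ex_not in h. destruct h as [a h]. apply imply_to_and in h. destruct h as [ha h].
    apply not_or_and in h. destruct h as [h1 h2]. apply NNPP in h1. apply NNPP in h2.
    destruct (holo_div_root f1 a Hf1 h1) as [f2 [Hf2 E1]].
    destruct (holo_div_root g1 a Hg1 h2) as [g2 [Hg2 E2]].
    exists (a :: L), f2, g2. repeat split; auto.
    + intros z. rewrite Ef, E1, prodl_cons. ring.
    + intros z. rewrite Eg, E2, prodl_cons. ring.
    + intros b [<-|hb]; auto.
    + left; simpl; lia. }
destruct (K (S N)) as [L [f1 [g1 [Hf1 [Hg1 [Ef [Eg [HL D]]]]]]]].
exists L, f1, g1. repeat split; auto.
destruct D as [D|D]; [|exact D].
pose proof (HN L f1 Hf1 Ef HL). lia.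
Qed.

(* [F n] is [F 0] divided by the roots in [q 0], ..., [q (n - 1)]. *)
Definition staged (q : nat -> list C) (F : nat -> C -> C) : Prop :=
  (forall n, holo (F n)) /\ forall n z, F n z = (prodl (q n) z * F (S n) z)%C.

(** For n = 0 the bound is negative, so the block [q 0] may contain the root 0. *)
Definition escaping (q : nat -> list C) : Prop :=
  forall n a, In a (q n) -> INR n - 1 < Cmod a.

(** The state is the block just removed with the two remaining functions. Before stage n these have
    no common root in the disc of radius n - 1, so the new block avoids that disc; f(c) stays
    nonzero, which allows the next extraction. *)
Lemma common_roots_staged (f g : C -> C) c : holo f -> holo g -> f c <> 0 ->
  exists q F G, F 0%nat = f /\ G 0%nat = g /\ staged q F /\ staged q G /\ escaping q /\
    forall n z, Cmod z <= INR n -> F (S n) z <> 0 \/ G (S n) z <> 0.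
Proof.
intros Hf Hg hc.
destruct (dep_choice (list C * (C -> C) * (C -> C))
  (fun n s => holo (snd (fst s)) /\ holo (snd s) /\ snd (fst s) c <> 0 /\
     forall z, Cmod z <= INR n - 1 -> snd (fst s) z <> 0 \/ snd s z <> 0)
  (fun n s s' => (forall a, In a (fst (fst s')) -> INR n - 1 < Cmod a) /\
     (forall z, snd (fst s) z = (prodl (fst (fst s')) z * snd (fst s') z)%C) /\
     (forall z, snd s z = (prodl (fst (fst s')) z * snd s' z)%C)) (nil, f, g)) as [s [E0 K]].
- simpl. repeat split; auto. intros z hz. pose proof (Cmod_ge_0 z). lra.
- intros n [[L f0] g0] [Hf0 [Hg0 [h0 N0]]]; simpl in *.
  destruct (extract_common_roots f0 g0 c (INR n) Hf0 Hg0 h0) as [L' [f1 [g1 [Hf1 [Hg1 [Ef [Eg [HL HN]]]]]]]].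
  exists (L', f1, g1). simpl snd; simpl fst. split; [split; [exact Hf1|split; [exact Hg1|split]]|split; [|auto]].
  + intros E. apply h0. rewrite Ef, E. ring.
  + intros z hz. apply HN. change (Cmod z <= INR (S n) - 1) in hz. rewrite S_INR in hz. lra.
  + intros a ha. apply Rnot_le_lt. intros hle.
    pose proof (proj2 (prodl_root L' a) ha) as Ra.
    destruct (N0 a hle) as [h|h]; apply h; rewrite ?Ef, ?Eg, Ra; ring.
- exists (fun n => fst (fst (s (S n)))), (fun n => snd (fst (s n))), (fun n => snd (s n)).
  rewrite E0. repeat split; try (intros n; apply K).
  intros n z hz. apply (K (S n)). rewrite S_INR. lra.
Qed.

(** Both sequences lose the same factors, so F n / D n is independent of n wherever the denominators
    do not vanish, and at each z this happens from some stage on. Multiplicities are thus never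
    compared. *)
Lemma staged_div (q : nat -> list C) (F D : nat -> C -> C) : staged q F -> staged q D ->
  (forall n z, Cmod z <= INR n -> D (S n) z <> 0) ->
  exists u, holo u /\ forall n z, F n z = (D n z * u z)%C.
Proof.
intros [HF EF] [HD ED] ND.
assert (ND' : forall n k z, Cmod z <= INR n -> D (S n + k)%nat z <> 0).
{ intros n k z hz. apply (ND (n + k)%nat). rewrite plus_INR. pose proof (pos_INR k). lra. }
assert (Q : forall n z k, Cmod z <= INR n -> (F (S n + k)%nat z / D (S n + k)%nat z = F (S n) z / D (S n) z)%C).
{ intros n z k hz. induction k as [|k IH]; [now rewrite Nat.add_0_r|]. rewrite <- IH.
  pose proof (ND' n k z hz) as N1. pose proof (ND' n (S k) z hz) as N2. rewrite Nat.add_succ_r in *.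
  rewrite (EF (S n + k)%nat), (ED (S n + k)%nat). rewrite (ED (S n + k)%nat) in N1.
  field. split; [exact N2|]. intros E. apply N1. rewrite E. ring. }
destruct (choice (fun z m => Cmod z <= INR m) (fun z => exists_nat_ge (Cmod z))) as [m Hm].
set (u := fun z => (F (S (m z)) z / D (S (m z)) z)%C).
assert (Hu : forall n z, Cmod z <= INR n -> u z = (F (S n) z / D (S n) z)%C).
{ intros n z hz. unfold u. destruct (Nat.le_ge_cases n (m z)) as [h|h].
  - replace (S (m z)) with (S n + (m z - n))%nat by lia. now apply Q.
  - replace (S n) with (S (m z) + (n - m z))%nat by lia. symmetry. apply Q, Hm. }
exists u. split.
(* One stage more than needed at [z], so that a single quotient represents [u] on the whole disc of
   radius 1 about [z]. *)
- intros z. destruct (HF (S (m z + 1)) z) as [l Dl]. destruct (HD (S (m z + 1)) z) as [k Dk].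
  destruct (has_deriv_div _ _ z l k Dl Dk) as [j Dj].
  { apply ND. rewrite plus_INR. pose proof (Hm z). simpl. lra. }
  exists j.
  apply has_deriv_local with (fun w => F (S (m z + 1)%nat) w / D (S (m z + 1)%nat) w)%C 1; [lra| |exact Dj].
  intros w hw. symmetry. apply Hu. rewrite plus_INR. simpl.
  pose proof (Cmod_triangle_inv w z). pose proof (Hm z). lra.
- intros n z.
  assert (Base : forall k, F (S (m z) + k)%nat z = (D (S (m z) + k)%nat z * u z)%C).
  { intros k. rewrite (Hu (m z + k)%nat) by (rewrite plus_INR; pose proof (pos_INR k); pose proof (Hm z); lra).
    change (S (m z) + k)%nat with (S (m z + k)). field. apply (ND' (m z) k), Hm. }
  (* At early stages [D k] may vanish at [z]; there the identity is not obtained by division but by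
     multiplying the later one by the blocks in between. *)
  assert (Down : forall j k, (j + k = S (m z))%nat -> F k z = (D k z * u z)%C).
  { induction j as [|j IH]; intros k hk; simpl in hk.
    - subst k. specialize (Base 0%nat). now rewrite Nat.add_0_r in Base.
    - rewrite EF, ED, (IH (S k)) by lia. ring. }
  destruct (Nat.le_ge_cases n (S (m z))) as [h|h].
  + apply (Down (S (m z) - n)%nat). lia.
  + replace n with (S (m z) + (n - S (m z)))%nat by lia. apply Base.
Qed.

(** * Weierstrass products *)

(** A high power of z / a. A negative radius does occur, as n - 1 at stage 0; the disc is then
    empty. *)
Lemma small_on_disc_one_at (a : C) rho eps : rho < Cmod a -> 0 < eps ->
  exists phi, holo phi /\ phi a = 1 /\ forall z, Cmod z <= rho -> Cmod (phi z) <= eps.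
Proof.
intros ha he. destruct (Rlt_dec rho 0) as [h|h].
- exists (fun _ => RtoC 1). split; [apply holo_const|split; [reflexivity|]].
  intros z hz. pose proof (Cmod_ge_0 z). lra.
- assert (a0 : a <> 0) by (apply Cmod_gt_0; lra).
  assert (Hq : 0 <= rho / Cmod a < 1).
  { split; [apply Rmult_le_pos; [lra|apply Rlt_le, Rinv_0_lt_compat; lra]|apply Rlt_div_l; lra]. }
  destruct (pow_small _ eps Hq he) as [m Hm].
  exists (fun z => (/ a * z) ^ m)%C. split; [|split].
  + apply (holo_Cpow (fun z => / a * z)%C). apply holo_mult; [apply holo_const|apply holo_id].
  + rewrite Cinv_l by exact a0. apply Cpow_1_l.
  + intros z hz. rewrite Cmod_pow, Cmod_mult, Cmod_inv by exact a0.
    apply Rle_trans with ((rho / Cmod a) ^ m); [|lra]. apply pow_incr. split.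
    * apply Rmult_le_pos; [apply Rlt_le, Rinv_0_lt_compat; lra|apply Cmod_ge_0].
    * unfold Rdiv. rewrite Rmult_comm. apply Rmult_le_compat_r; [apply Rlt_le, Rinv_0_lt_compat; lra|exact hz].
Qed.

(* The truncated series of - log (1 - w). *)
Fixpoint plog (m : nat) (w : C) : C :=
  match m with O => RtoC 0 | S k => (plog k w + / RtoC (INR (S k)) * w ^ S k)%C end.

Fixpoint geom (m : nat) (w : C) : C :=
  match m with O => RtoC 0 | S k => (geom k w + w ^ k)%C end.

Lemma geom_sum m w : ((1 - w) * geom m w)%C = (1 - w ^ m)%C.
Proof.
induction m as [|m IH]; [simpl; ring|]. rewrite Cpow_S. simpl geom.
replace ((1 - w) * (geom m w + w ^ m))%C with ((1 - w) * geom m w + (1 - w) * w ^ m)%C by ring.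
rewrite IH. ring.
Qed.

Lemma has_deriv_Cpow n w : has_deriv (fun z => z ^ S n)%C w (RtoC (INR (S n)) * w ^ n)%C.
Proof.
induction n as [|n IH].
- simpl. apply has_deriv_ext with (fun z => z); [intros; ring|].
  replace (1 * 1)%C with (RtoC 1) by ring. apply has_deriv_id.
- replace (RtoC (INR (S (S n))) * w ^ S n)%C with (1 * w ^ S n + w * (RtoC (INR (S n)) * w ^ n))%C.
  + apply (has_deriv_mult (fun z => z) (fun z => z ^ S n)%C); [apply has_deriv_id|exact IH].
  + rewrite (S_INR (S n)), RtoC_plus, (Cpow_S w n). ring.
Qed.

Lemma has_deriv_plog m w : has_deriv (plog m) w (geom m w).
Proof.
induction m as [|m IH]; [apply has_deriv_const|]. simpl geom.
apply (has_deriv_plus (plog m) (fun z => / RtoC (INR (S m)) * z ^ S m)%C); [exact IH|].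
assert (N : RtoC (INR (S m)) <> 0) by (apply RtoC_neq0, not_0_INR; lia).
replace (w ^ m)%C with (0 * w ^ S m + / RtoC (INR (S m)) * (RtoC (INR (S m)) * w ^ m))%C.
- apply (has_deriv_mult (fun _ => / RtoC (INR (S m)))%C (fun z => z ^ S m)%C); [apply has_deriv_const|apply has_deriv_Cpow].
- rewrite Cmult_assoc, Cinv_l by exact N. ring.
Qed.

Lemma plog_0 m : plog m 0 = 0.
Proof. induction m as [|m IH]; [reflexivity|]. simpl. rewrite IH. ring. Qed.

Lemma holo_plog m : holo (plog m).
Proof. intros w. eexists. apply has_deriv_plog. Qed.

Lemma plog_bound m w theta : Cmod w <= theta -> theta < 1 -> Cmod (plog m w) <= / (1 - theta).
Proof.
intros hw ht. pose proof (Cmod_ge_0 w) as h0.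
assert (K : (1 - theta) * Cmod (plog m w) <= theta * (1 - theta ^ m)).
{ induction m as [|m IH]; [simpl; rewrite Cmod_0; lra|].
  change (plog (S m) w) with (plog m w + / RtoC (INR (S m)) * w ^ S m)%C.
  assert (T : Cmod (/ RtoC (INR (S m)) * w ^ S m) <= theta ^ S m).
  { rewrite Cmod_mult, Cmod_pow, <- (Rmult_1_l (theta ^ S m)).
    apply Rmult_le_compat; [apply Cmod_ge_0|apply pow_le; lra| |apply pow_incr; lra].
    rewrite Cmod_inv by (apply RtoC_neq0, not_0_INR; lia).
    rewrite Cmod_pos_R by apply pos_INR. rewrite <- Rinv_1. apply Rinv_le_contravar; [lra|].
    rewrite S_INR. pose proof (pos_INR m). lra. }
  pose proof (Cmod_triangle (plog m w) (/ RtoC (INR (S m)) * w ^ S m)) as Tr.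
  assert ((1 - theta) * Cmod (plog m w + / RtoC (INR (S m)) * w ^ S m) <=
          (1 - theta) * (Cmod (plog m w) + theta ^ S m)) by (apply Rmult_le_compat_l; lra).
  simpl pow in *. nra. }
assert (0 <= theta ^ m) by (apply pow_le; lra).
apply Rmult_le_reg_l with (1 - theta); [lra|]. rewrite Rinv_r by lra. nra.
Qed.

(* Weierstrass's elementary factor. Its derivative is - w^m exp (plog m w). *)
Lemma elementary_factor_bound m w theta : Cmod w <= theta -> theta < 1 ->
  Cmod ((1 - w) * cexp (plog m w) - 1) <= 2 * (theta ^ m * exp (/ (1 - theta))).
Proof.
intros hw ht. pose proof (Cmod_ge_0 w) as h0.
set (F := fun t => ((1 - t * w) * cexp (plog m (t * w)))%C).
set (f := fun t => (- w * (t * w) ^ m * cexp (plog m (t * w)))%C).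
assert (Dw : forall t, has_deriv (fun t => t * w)%C t (1 * w + t * 0)%C).
{ intros t. apply (has_deriv_mult (fun t => t) (fun _ => w)); [apply has_deriv_id|apply has_deriv_const]. }
assert (De : forall t, has_deriv (fun t => cexp (plog m (t * w))) t (cexp (plog m (t * w)) * (geom m (t * w) * (1 * w + t * 0)))%C).
{ intros t. apply (has_deriv_comp cexp (fun t => plog m (t * w)%C)); [|apply has_deriv_cexp].
  apply (has_deriv_comp (plog m) (fun t => t * w)%C); [apply Dw|apply has_deriv_plog]. }
assert (E : CInt f 0 1 = ((1 - w) * cexp (plog m w) - 1)%C).
{ rewrite (CInt_FTC F f).
  - unfold F. replace (RtoC 1 * w)%C with w by ring. replace (RtoC 0 * w)%C with (RtoC 0) by ring.
    rewrite plog_0, cexp_0. ring.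
  - intros t.
    replace (f t) with ((0 + - (1) * (1 * w + t * 0)) * cexp (plog m (t * w)) +
       (1 - t * w) * (cexp (plog m (t * w)) * (geom m (t * w) * (1 * w + t * 0))))%C.
    + apply (has_deriv_mult (fun t => 1 - t * w)%C (fun t => cexp (plog m (t * w)))); [|apply De].
      apply (has_deriv_plus (fun _ => RtoC 1) (fun t => - (t * w))%C); [apply has_deriv_const|].
      apply has_deriv_ext with (fun t => (- (1)) * (t * w))%C; [intros; ring|].
      replace (- (1) * (1 * w + t * 0))%C with (0 * (t * w) + (- (1)) * (1 * w + t * 0))%C by ring.
      apply (has_deriv_mult (fun _ => (- (1))%C) (fun t => t * w)%C); [apply has_deriv_const|apply Dw].
    + unfold f. pose proof (geom_sum m (RtoC t * w)) as G.
      replace ((1 - t * w) * (cexp (plog m (t * w)) * (geom m (t * w) * (1 * w + t * 0))))%C with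
        (cexp (plog m (t * w)) * w * ((1 - t * w) * geom m (t * w)))%C by ring.
      rewrite G. ring.
  - intros t. unfold f. apply cont_at_mult; [|eapply has_deriv_cont, De].
    apply cont_at_mult; [apply cont_at_const|].
    apply (cont_at_Cpow (fun t => t * w)%C). eapply has_deriv_cont, Dw. }
rewrite <- E.
replace (2 * (theta ^ m * exp (/ (1 - theta)))) with (2 * (theta ^ m * exp (/ (1 - theta))) * Rabs (1 - 0))
  by (rewrite Rabs_pos_eq; lra).
apply CInt_bound.
- intros t. unfold f. apply cont_at_mult; [|eapply has_deriv_cont, De].
  apply cont_at_mult; [apply cont_at_const|].
  apply (cont_at_Cpow (fun t => t * w)%C). eapply has_deriv_cont, Dw.
- intros t. rewrite Rmin_left, Rmax_right by lra. intros h. unfold f.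
  assert (htw : Cmod (RtoC t * w) <= theta) by (rewrite Cmod_mult, Cmod_pos_R by lra; nra).
  rewrite !Cmod_mult, Cmod_opp, Cmod_pow, Cmod_cexp.
  assert (Cmod (RtoC t * w) ^ m <= theta ^ m) by (apply pow_incr; split; [apply Cmod_ge_0|exact htw]).
  assert (0 <= Cmod (RtoC t * w) ^ m) by (apply pow_le, Cmod_ge_0).
  assert (exp (fst (plog m (t * w))) <= exp (/ (1 - theta))).
  { assert (X : fst (plog m (t * w)) <= / (1 - theta)).
    { pose proof (plog_bound m _ _ htw ht). pose proof (Rabs_fst_le (plog m (t * w))).
      pose proof (Rle_abs (fst (plog m (t * w)))). lra. }
    destruct X as [X|X]; [left; now apply exp_increasing|right; now rewrite X]. }
  apply Rmult_le_compat; auto.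
  + apply Rmult_le_pos; auto.
  + apply Rlt_le, exp_pos.
  + nra.
Qed.

(** A constant exponential equal to - 1 / a turns z - a into 1 - z / a, and a long enough elementary
    factor does the rest, with ratio theta = rho / |a| < 1. *)
Lemma factor_near_one (a : C) rho eps : rho < Cmod a -> 0 < eps ->
  exists s, holo s /\ forall z, Cmod z <= rho -> Cmod ((z - a) * cexp (s z) - 1) <= eps.
Proof.
intros ha he. destruct (Rlt_dec rho 0) as [h|h].
- exists (fun _ => RtoC 0). split; [apply holo_const|]. intros z hz. pose proof (Cmod_ge_0 z). lra.
- assert (a0 : a <> 0) by (apply Cmod_gt_0; lra).
  destruct (cexp_surj (- / a)%C) as [b Hb].
  { intros E. apply C1_nz. replace (RtoC 1) with (- a * (- / a))%C by (field; exact a0). rewrite E. ring. }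
  set (theta := rho / Cmod a).
  assert (Hq : 0 <= theta < 1).
  { split; [apply Rmult_le_pos; [lra|apply Rlt_le, Rinv_0_lt_compat; lra]|apply Rlt_div_l; lra]. }
  pose proof (exp_pos (/ (1 - theta))) as hE.
  destruct (pow_small theta (eps / (2 * exp (/ (1 - theta)))) Hq) as [m Hm]; [apply Rdiv_lt_0_compat; lra|].
  apply Rlt_div_r in Hm; [|lra].
  exists (fun z => b + plog m (/ a * z))%C. split.
  + apply (holo_plus (fun _ => b) (fun z => plog m (/ a * z)%C)); [apply holo_const|].
    apply (holo_comp (plog m) (fun z => / a * z)%C); [apply holo_plog|].
    apply holo_mult; [apply holo_const|apply holo_id].
  + intros z hz. rewrite cexp_plus, Hb.
    replace ((z - a) * (- / a * cexp (plog m (/ a * z))))%C with ((1 - / a * z) * cexp (plog m (/ a * z)))%C by (field; exact a0).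
    eapply Rle_trans; [apply elementary_factor_bound with (theta := theta); [|lra]|lra].
    rewrite Cmod_mult, Cmod_inv by exact a0. unfold theta, Rdiv. rewrite Rmult_comm.
    apply Rmult_le_compat_r; [apply Rlt_le, Rinv_0_lt_compat; lra|exact hz].
Qed.

Lemma prodl_near_one (L : list C) rho eps : (forall a, In a L -> rho < Cmod a) -> 0 < eps ->
  exists s, holo s /\ forall z, Cmod z <= rho -> Cmod (prodl L z * cexp (s z) - 1) <= eps.
Proof.
revert eps. induction L as [|a L IH]; intros eps HL he.
- exists (fun _ => RtoC 0). split; [apply holo_const|]. intros z _. simpl.
  rewrite cexp_0. replace (1 * 1 - 1)%C with (RtoC 0) by ring. rewrite Cmod_0. lra.
(* From xy - 1 = (x - 1)(y - 1) + (x - 1) + (y - 1): each term is at most e, the first because e <=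
   1. *)
- set (e := Rmin 1 (eps / 3)).
  assert (he0 : 0 < e) by (apply Rmin_glb_lt; lra).
  assert (he1 : e <= 1) by apply Rmin_l. assert (he2 : e <= eps / 3) by apply Rmin_r.
  destruct (factor_near_one a rho e (HL a (or_introl eq_refl)) he0) as [s [Hs Bs]].
  destruct (IH e (fun b hb => HL b (or_intror hb)) he0) as [t [Ht Bt]].
  exists (fun z => s z + t z)%C. split; [now apply holo_plus|].
  intros z hz. specialize (Bs z hz). specialize (Bt z hz). rewrite prodl_cons, cexp_plus.
  set (x := ((z - a) * cexp (s z))%C) in *. set (y := (prodl L z * cexp (t z))%C) in *.
  replace ((z - a) * prodl L z * (cexp (s z) * cexp (t z)) - 1)%C with ((x - 1) * (y - 1) + (x - 1) + (y - 1))%C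
    by (unfold x, y; ring).
  eapply Rle_trans; [apply Cmod_triangle|]. eapply Rle_trans; [apply Rplus_le_compat_r, Cmod_triangle|].
  rewrite Cmod_mult. pose proof (Cmod_ge_0 (x - 1)). pose proof (Cmod_ge_0 (y - 1)).
  assert (Cmod (x - 1) * Cmod (y - 1) <= e * 1) by (apply Rmult_le_compat; lra). lra.
Qed.

Fixpoint pprod (w : nat -> C -> C) (n k : nat) (z : C) : C :=
  match k with O => RtoC 1 | S j => (pprod w n j z * w (n + j)%nat z)%C end.

Lemma holo_pprod w n k : (forall i, holo (w i)) -> holo (pprod w n k).
Proof. intros H. induction k as [|k IH]; [apply holo_const|]. now apply (holo_mult (pprod w n k)). Qed.

Lemma pprod_head w n k z : pprod w n (S k) z = (w n z * pprod w (S n) k z)%C.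
Proof.
induction k as [|k IH]; [simpl; rewrite Nat.add_0_r; ring|].
change (pprod w n (S (S k)) z) with (pprod w n (S k) z * w (n + S k)%nat z)%C.
rewrite IH. simpl. rewrite Nat.add_succ_r. ring.
Qed.

Lemma pprod_split w n j k z : pprod w n (j + k) z = (pprod w n j z * pprod w (n + j) k z)%C.
Proof.
induction k as [|k IH]; [rewrite Nat.add_0_r; simpl; ring|].
rewrite Nat.add_succ_r. simpl. rewrite IH, Nat.add_assoc. ring.
Qed.

Lemma quarter_pow n : (/ 4) ^ n <= (/ 2) ^ n.
Proof. apply pow_incr. lra. Qed.

(** [W n] is the tail product from index n. All tails are kept, since it is the tail from n + 1 that
    has no root in the disc of radius n. *)
Lemma infinite_product (w : nat -> C -> C) : (forall n, holo (w n)) ->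
  (forall n z, Cmod z <= INR n - 1 -> Cmod (w n z - 1) <= (/ 4) ^ S n) ->
  exists W : nat -> C -> C, (forall n, holo (W n)) /\
    (forall n z, W n z = (w n z * W (S n) z)%C) /\
    (forall n z, Cmod z <= INR n -> W (S n) z <> 0).
Proof.
intros Hw Bw.
(* With q = 4^-(N + k), the next factor adds at most (1/2)(q/4) + q/4 = 3q/8, exactly the decrease
   from q/2 to q/8 of the subtracted term. The bound 1/2 survives in the limit and keeps it away
   from 0. *)
assert (Q : forall N k z, Cmod z <= INR N - 1 -> Cmod (pprod w N k z - 1) <= / 2 - (/ 4) ^ (N + k) / 2).
{ intros N k z hz. induction k as [|k IH].
  - simpl. replace (1 - 1)%C with (RtoC 0) by ring. rewrite Cmod_0, Nat.add_0_r.
    assert ((/ 4) ^ N <= 1) by (rewrite <- (pow1 N); apply pow_incr; lra). lra.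
  - simpl. rewrite Nat.add_succ_r. simpl.
    assert (hz' : Cmod z <= INR (N + k) - 1) by (rewrite plus_INR; pose proof (pos_INR k); lra).
    specialize (Bw (N + k)%nat z hz'). simpl in Bw.
    set (q := (/ 4) ^ (N + k)) in *. set (p := pprod w N k z) in *. set (v := w (N + k)%nat z) in *.
    assert (0 < q) by (apply pow_lt; lra).
    replace (p * v - 1)%C with ((p - 1) * (v - 1) + (p - 1) + (v - 1))%C by ring.
    eapply Rle_trans; [apply Cmod_triangle|]. eapply Rle_trans; [apply Rplus_le_compat_r, Cmod_triangle|].
    rewrite Cmod_mult. pose proof (Cmod_ge_0 (p - 1)). pose proof (Cmod_ge_0 (v - 1)).
    assert (Cmod (p - 1) * Cmod (v - 1) <= / 2 * (/ 4 * q)) by (apply Rmult_le_compat; lra). lra. }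
assert (L : forall n, exists G, holo G /\ forall z, clim (fun k => pprod w n k z) (G z)).
{ intros n. apply (holo_limit (fun k => pprod w n k)); [intros k; now apply holo_pprod|].
  intros rho.
  destruct (exists_nat_ge (rho + 1)) as [N hN]. assert (hN' : rho <= INR N - 1) by lra.
  destruct (holo_bounded (pprod w n N) rho (holo_pprod w n N Hw)) as [B [hB HB]].
  exists N, (2 * B). split; [lra|]. intros k z hk hz. simpl.
  replace (pprod w n k z * w (n + k)%nat z - pprod w n k z)%C with (pprod w n k z * (w (n + k)%nat z - 1))%C by ring.
  rewrite Cmod_mult.
  assert (P : Cmod (pprod w n k z) <= B * 2).
  { replace k with (N + (k - N))%nat by lia. rewrite pprod_split, Cmod_mult.
    apply Rmult_le_compat; try apply Cmod_ge_0; [now apply HB|].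
    assert (hz' : Cmod z <= INR (n + N) - 1) by (rewrite plus_INR; pose proof (pos_INR n); lra).
    specialize (Q (n + N)%nat (k - N)%nat z hz').
    assert (0 < (/ 4) ^ (n + N + (k - N))) by (apply pow_lt; lra).
    pose proof (Cmod_triangle_inv (pprod w (n + N) (k - N) z) 1). rewrite Cmod_1 in H0. lra. }
  rewrite (Rmult_comm 2 B). apply Rmult_le_compat; try apply Cmod_ge_0; [exact P|].
  eapply Rle_trans; [apply Bw|].
  - rewrite plus_INR. pose proof (pos_INR n). apply le_INR in hk. lra.
  - eapply Rle_trans; [apply quarter_pow|]. apply half_pow_decr. lia. }
destruct (choice _ L) as [W HW].
exists W. split; [intros n; apply HW|split].
- intros n z. apply clim_unique with (fun k => pprod w n (k + 1) z).
  + apply clim_shift with (u := fun k => pprod w n k z). apply HW.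
  + apply clim_ext_eventually with (fun k => w n z * pprod w (S n) k z)%C 0%nat.
    * intros k _. rewrite Nat.add_1_r. symmetry. apply pprod_head.
    * apply clim_scal. apply HW.
- intros n z hz E.
  assert (K : Cmod (W (S n) z - 1) <= / 2).
  { apply clim_bound with (fun k => pprod w (S n) k z) 0%nat; [apply HW|].
    intros k _. eapply Rle_trans; [apply Q; rewrite S_INR; lra|].
    assert (0 < (/ 4) ^ (S n + k)) by (apply pow_lt; lra). lra. }
  rewrite E in K. replace (0 - 1)%C with (- (1))%C in K by ring. rewrite Cmod_opp, Cmod_1 in K. lra.
Qed.

(** Convergence requires exponential factors in [W], while [staged] asks for the bare [prodl (q n)].
    Multiplying [W n] by the exponentials of indices below n moves each of them into the next
    stage. *)
Lemma weierstrass_product (q : nat -> list C) : escaping q ->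
  exists D, staged q D /\ forall n z, Cmod z <= INR n -> D (S n) z <> 0.
Proof.
intros Hq.
assert (S0 : forall n, exists s, holo s /\ forall z, Cmod z <= INR n - 1 ->
   Cmod (prodl (q n) z * cexp (s z) - 1) <= (/ 4) ^ S n).
{ intros n. apply prodl_near_one; [apply Hq|apply pow_lt; lra]. }
destruct (choice _ S0) as [s Hs].
set (e := fun n z => cexp (s n z)).
assert (He : forall n, holo (e n)) by (intros n; apply (holo_comp cexp (s n)); [apply holo_cexp|apply Hs]).
destruct (infinite_product (fun n z => prodl (q n) z * e n z)%C) as [W [HW [EW NW]]].
{ intros n. apply holo_mult; [apply holo_prodl|apply He]. } { intros n. apply Hs. }
assert (Ne : forall n z, pprod e 0 n z <> 0).
{ intros n z. induction n as [|n IH]; [apply C1_nz|]. simpl. apply Cmult_neq_0; [exact IH|apply cexp_neq0]. }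
exists (fun n z => pprod e 0 n z * W n z)%C. split; [split|].
- intros n. apply holo_mult; [now apply holo_pprod|apply HW].
- intros n z. rewrite (EW n z). simpl. ring.
- intros n z hz. apply Cmult_neq_0; [apply Ne|now apply NW].
Qed.

(** * The Bezout property *)

(** The common roots of [f] with itself in a disc form a finite list, and the remaining factor has
    no root there. *)
Lemma isolated_roots (f : C -> C) c z : holo f -> f c <> 0 ->
  exists r, 0 < r /\ forall w, 0 < Cmod (w - z) < r -> f w <> 0.
Proof.
intros Hf hc.
destruct (extract_common_roots f f c (Cmod z + 1) Hf Hf hc) as [L [f1 [g1 [_ [_ [Ef [Eg [_ N]]]]]]]].
assert (HL : exists r, 0 < r /\ forall w, 0 < Cmod (w - z) < r -> prodl L w <> 0).
{ clear. induction L as [|a L [r [hr H]]].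
  - exists 1. split; [lra|]. intros w _. apply C1_nz.
  - destruct (Ceq_dec a z) as [->|haz].
    + exists r. split; [exact hr|]. intros w hw. rewrite prodl_cons.
      apply Cmult_neq_0; [apply Cmod_gt_0; lra|now apply H].
    + assert (h : 0 < Cmod (a - z)) by (apply Cmod_gt_0; now apply Cminus_neq).
      exists (Rmin r (Cmod (a - z))). split; [now apply Rmin_glb_lt|]. intros w [h0 hw]. rewrite prodl_cons.
      pose proof (Rlt_le_trans _ _ _ hw (Rmin_l _ _)). pose proof (Rlt_le_trans _ _ _ hw (Rmin_r _ _)).
      apply Cmult_neq_0; [|apply H; lra]. apply Cminus_neq. intros ->. lra. }
destruct HL as [r [hr HL]].
exists (Rmin r 1). split; [apply Rmin_glb_lt; lra|]. intros w [h0 hw].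
pose proof (Rlt_le_trans _ _ _ hw (Rmin_l _ _)). pose proof (Rlt_le_trans _ _ _ hw (Rmin_r _ _)).
pose proof (HL w ltac:(lra)) as P.
destruct (N w) as [n|n].
- pose proof (Cmod_triangle_inv w z). lra.
- rewrite Ef. now apply Cmult_neq_0.
- rewrite Eg. now apply Cmult_neq_0.
Qed.

(** The roots of [f] being isolated, [g] vanishes at points arbitrarily close to any z, hence at z
    by continuity. *)
Lemma holo_integral (f g : C -> C) c : holo f -> f c <> 0 -> (forall z, cont_at g z) ->
  (forall z, (f z * g z)%C = 0) -> forall z, g z = 0.
Proof.
intros Hf hc Hg E z. destruct (Ceq_dec (g z) 0) as [h|h]; [exact h|exfalso].
destruct (isolated_roots f c z Hf hc) as [r [hr Hr]].
destruct (cont_at_neq0 g z (Hg z) h) as [d [hd Hd]].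
set (m := Rmin (r / 2) (d / 2)).
assert (hm : 0 < m) by (apply Rmin_glb_lt; lra).
assert (m1 : m <= r / 2) by apply Rmin_l. assert (m2 : m <= d / 2) by apply Rmin_r.
assert (Em : Cmod (z + RtoC m - z) = m) by (replace (z + RtoC m - z)%C with (RtoC m) by ring; apply Cmod_pos_R; lra).
destruct (Cmult_integral _ _ (E (z + RtoC m)%C)) as [h1|h1].
- apply (Hr (z + RtoC m)%C); [rewrite Em; lra|exact h1].
- specialize (Hd (z + RtoC m)%C). rewrite Em, h1, Cmod_0 in Hd. specialize (Hd ltac:(lra)).
  pose proof (Cmod_ge_0 (g z)). lra.
Qed.

(** The roots of [f] are its common roots with the zero function, which remains zero after each
    division, so the absence of common roots concerns [F] alone. *)
Lemma roots_staged (f : C -> C) c : holo f -> f c <> 0 ->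
  exists q F, F 0%nat = f /\ staged q F /\ escaping q /\ forall n z, Cmod z <= INR n -> F (S n) z <> 0.
Proof.
intros Hf hc.
destruct (common_roots_staged f (fun _ => RtoC 0) c Hf (holo_const 0) hc) as [q [F [G [F0 [G0 [SF [SG [Hq N]]]]]]]].
exists q, F. repeat split; auto; try apply SF.
assert (K : forall n, F n c <> 0 /\ forall z, G n z = 0).
{ induction n as [|n [IF IG]]; [rewrite F0, G0; auto|].
  destruct SF as [_ EF], SG as [HG EG]. rewrite (EF n c) in IF. split.
  - intros E. apply IF. rewrite E. ring.
  - apply (holo_integral (prodl (q n)) (G (S n)) c).
    + apply holo_prodl.
    + intros E. apply IF. rewrite E. ring.
    + apply holo_cont, HG.
    + intros z. now rewrite <- EG. }
intros n z hz. destruct (N n z hz) as [h|h]; [exact h|]. exfalso. apply h. apply K.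
Qed.

Lemma staged_pprod q F n z : staged q F -> F 0%nat z = (pprod (fun i => prodl (q i)) 0 n z * F n z)%C.
Proof.
intros [_ E]. induction n as [|n IH]; [simpl; ring|]. rewrite IH, (E n). simpl. ring.
Qed.

(** Subtracting a multiple of [u] that agrees with [M] at [a] allows division by z - a, and the
    quotient is treated in the same way for the rest of the list. A repeated root is just met again
    after the division. *)
Lemma small_correction (L : list C) rho eps (u M : C -> C) : holo u -> holo M ->
  (forall a, In a L -> rho < Cmod a /\ u a <> 0) -> 0 < eps ->
  exists x M', holo x /\ holo M' /\ (forall z, (M z - x z * u z)%C = (prodl L z * M' z)%C) /\
    forall z, Cmod z <= rho -> Cmod (x z) <= eps.
Proof.
intros Hu. revert eps M. induction L as [|a L IH]; intros eps M HM HL he.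
- exists (fun _ => RtoC 0), M. split; [apply holo_const|split; [exact HM|split]].
  + intros z; simpl; ring.
  + intros z _. rewrite Cmod_0. lra.
- destruct (HL a (or_introl eq_refl)) as [ha ua].
  set (k := (M a / u a)%C). pose proof (Cmod_ge_0 k) as hk.
  destruct (small_on_disc_one_at a rho (eps / 2 / (Cmod k + 1)) ha) as [phi [Hphi [pa Bphi]]]; [repeat apply Rdiv_lt_0_compat; lra|].
  destruct (holo_div_root (fun z => M z - k * phi z * u z)%C a) as [M1 [HM1 E1]].
  { apply holo_minus; [exact HM|]. apply holo_mult; [|exact Hu]. apply holo_mult; [apply holo_const|exact Hphi]. }
  { rewrite pa. unfold k. field. exact ua. }
  (* Later corrections come back multiplied by z - a, at most [b] on the disc, and are therefore
     requested [b] times smaller. *)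
  set (b := 1 + Rabs rho + Cmod a).
  assert (hb : 0 < b) by (unfold b; pose proof (Rabs_pos rho); pose proof (Cmod_ge_0 a); lra).
  destruct (IH (eps / 2 / b) M1 HM1) as [x [M' [Hx [HM' [E Bx]]]]].
  { intros c hc. apply HL. now right. } { repeat apply Rdiv_lt_0_compat; lra. }
  exists (fun z => k * phi z + (z - a) * x z)%C, M'. split; [|split; [exact HM'|split]].
  + apply holo_plus; apply holo_mult; auto using holo_const.
    apply holo_minus; [apply holo_id|apply holo_const].
  + intros z. rewrite prodl_cons.
    replace ((z - a) * prodl L z * M' z)%C with ((z - a) * (prodl L z * M' z))%C by ring.
    rewrite <- E. replace ((z - a) * (M1 z - x z * u z))%C with ((z - a) * M1 z - (z - a) * x z * u z)%C by ring.
    rewrite <- E1. ring.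
  + intros z hz. specialize (Bphi z hz). specialize (Bx z hz).
    eapply Rle_trans; [apply Cmod_triangle|]. rewrite !Cmod_mult.
    assert (A1 : Cmod k * Cmod (phi z) <= (Cmod k + 1) * (eps / 2 / (Cmod k + 1))).
    { apply Rmult_le_compat; auto using Cmod_ge_0. lra. }
    assert (A2 : Cmod (z - a) * Cmod (x z) <= b * (eps / 2 / b)).
    { apply Rmult_le_compat; auto using Cmod_ge_0.
      eapply Rle_trans; [apply Cmod_triangle_minus|]. pose proof (Rle_abs rho). unfold b. lra. }
    replace ((Cmod k + 1) * (eps / 2 / (Cmod k + 1))) with (eps / 2) in A1 by (field; lra).
    replace (b * (eps / 2 / b)) with (eps / 2) in A2 by (field; lra). lra.
Qed.

Lemma holo_family_bounded (F : nat -> C -> C) rho n : (forall k, holo (F k)) ->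
  exists B, 0 < B /\ forall k z, (k < n)%nat -> Cmod z <= rho -> Cmod (F k z) <= B.
Proof.
intros HF. induction n as [|n [B [hB HB]]].
- exists 1. split; [lra|]. intros; lia.
- destruct (holo_bounded (F n) rho (HF n)) as [B' [hB' HB']].
  exists (B + B'). split; [lra|]. intros k z hk hz.
  destruct (Nat.eq_dec k n) as [->|h].
  + pose proof (HB' z hz). lra.
  + pose proof (HB k z ltac:(lia) hz). lra.
Qed.

Fixpoint csum (x : nat -> C) (n : nat) : C :=
  match n with O => RtoC 0 | S k => (csum x k + x k)%C end.

Lemma csum_head x n : csum x (S n) = (x 0%nat + csum (fun i => x (S i)) n)%C.
Proof. induction n as [|n IH]; [simpl; ring|]. simpl in *. rewrite IH. ring. Qed.

Lemma csum_ext x y n : (forall i, (i < n)%nat -> x i = y i) -> csum x n = csum y n.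
Proof.
induction n as [|n IH]; intros E; [reflexivity|]. simpl. rewrite E, IH; auto.
Qed.

Lemma csum_scal c x n : csum (fun i => c * x i)%C n = (c * csum x n)%C.
Proof. induction n as [|n IH]; simpl; [ring|]. rewrite IH. ring. Qed.

Lemma holo_csum (x : nat -> C -> C) n : (forall i, holo (x i)) -> holo (fun z => csum (fun i => x i z) n).
Proof.
intros H. induction n as [|n IH]; [exact (holo_const 0)|]. now apply (holo_plus (fun z => csum (fun i => x i z) n)).
Qed.

(* The solution is y_n = x_n + p_n x_(n+1) + p_n p_(n+1) x_(n+2) + ...; the
   smallness required for convergence depends on p alone, so that x can be
   chosen recursively afterwards. *)
Lemma series_recursion (p : nat -> C -> C) : (forall n, holo (p n)) ->
  exists beta : nat -> R, (forall n, 0 < beta n) /\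
    forall x : nat -> C -> C, (forall n, holo (x n)) ->
      (forall n z, Cmod z <= INR n - 1 -> Cmod (x n z) <= beta n) ->
      exists y : nat -> C -> C, (forall n, holo (y n)) /\
        forall n z, y n z = (x n z + p n z * y (S n) z)%C.
Proof.
intros Hp.
(* One bound for all products p_k ... p_(n-1) with k <= n, because x_n enters every series y_k with
   that coefficient; on the disc of radius n - 1 it then contributes at most 2^-n to each. *)
assert (HB : forall n, exists B, 0 < B /\ forall k z, (k < S n)%nat -> Cmod z <= INR n - 1 -> Cmod (pprod p k (n - k) z) <= B).
{ intros n. apply (holo_family_bounded (fun k => pprod p k (n - k))). intros k. now apply holo_pprod. }
destruct (choice _ HB) as [B HB'].
exists (fun n => (/ 2) ^ n / B n). split.
{ intros n. apply Rdiv_lt_0_compat; [apply half_pow_pos|apply HB']. }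
intros x Hx Bx.
set (Y := fun n k z => csum (fun i => pprod p n i z * x (n + i)%nat z)%C k).
assert (L : forall n, exists G, holo G /\ forall z, clim (fun k => Y n k z) (G z)).
{ intros n. apply (holo_limit (Y n)).
  - intros k. apply (holo_csum (fun i z => pprod p n i z * x (n + i)%nat z)%C).
    intros i. apply holo_mult; [now apply holo_pprod|apply Hx].
  - intros rho. destruct (exists_nat_ge (rho + 1)) as [N hN].
    exists N, 1. split; [lra|]. intros k z hk hz. unfold Y. simpl.
    replace (csum _ k + pprod p n k z * x (n + k)%nat z - csum _ k)%C with (pprod p n k z * x (n + k)%nat z)%C by ring.
    assert (hz' : Cmod z <= INR (n + k) - 1).
    { rewrite plus_INR. pose proof (pos_INR n). apply le_INR in hk. lra. }
    rewrite Cmod_mult. destruct (HB' (n + k)%nat) as [b0 Hb].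
    specialize (Hb n z ltac:(lia) hz'). replace (n + k - n)%nat with k in Hb by lia.
    specialize (Bx (n + k)%nat z hz').
    apply Rle_trans with (B (n + k)%nat * ((/ 2) ^ (n + k) / B (n + k)%nat)).
    + apply Rmult_le_compat; auto using Cmod_ge_0.
    + replace (B (n + k)%nat * ((/ 2) ^ (n + k) / B (n + k)%nat)) with ((/ 2) ^ (n + k)) by (field; lra).
      rewrite Rmult_1_l. apply half_pow_decr. lia. }
destruct (choice _ L) as [y Hy].
exists y. split; [intros n; apply Hy|]. intros n z.
apply clim_unique with (fun k => Y n (k + 1)%nat z).
- apply clim_shift with (u := fun k => Y n k z). apply Hy.
- apply clim_ext_eventually with (fun k => x n z + p n z * Y (S n) k z)%C 0%nat.
  + intros k _. rewrite Nat.add_1_r. unfold Y. rewrite csum_head, <- csum_scal. simpl (pprod p n 0 z).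
    rewrite Nat.add_0_r. f_equal; [ring|]. apply csum_ext. intros i _.
    rewrite pprod_head, Nat.add_succ_r. simpl. ring.
  + apply (clim_plus_const (x n z) (fun k => p n z * Y (S n) k z)%C). apply clim_scal, Hy.
Qed.

(* Newton interpolation at the roots of v: s is corrected at each of them in
   turn so that v divides 1 - u s, by terms made small on discs that do not
   contain the current root. *)
Lemma bezout_coprime (u v : C -> C) c : holo u -> holo v -> v c <> 0 ->
  (forall z, u z <> 0 \/ v z <> 0) ->
  exists s t, holo s /\ holo t /\ forall z, (u z * s z + v z * t z)%C = 1.
Proof.
intros Hu Hv hc N.
destruct (roots_staged v c Hv hc) as [q [V [V0 [SV [Hq NV]]]]].
destruct (series_recursion (fun n => prodl (q n)) (fun n => holo_prodl (q n))) as [beta [hb Hbeta]].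
(* The second component is the current remainder, initially 1; the first component of state n + 1 is
   the correction x_n that makes the n-th remainder minus x_n u divisible by block n. The first
   component of the initial state is a dummy. *)
destruct (dep_choice ((C -> C) * (C -> C)) (fun _ s => holo (fst s) /\ holo (snd s))
  (fun n s s' => (forall z, (snd s z - fst s' z * u z)%C = (prodl (q n) z * snd s' z)%C) /\
     forall z, Cmod z <= INR n - 1 -> Cmod (fst s' z) <= beta n) (fun _ => RtoC 0, fun _ => RtoC 1)) as [s [E0 K]].
- split; apply holo_const.
- intros n [x M] [_ HM]. simpl in *.
  destruct (small_correction (q n) (INR n - 1) (beta n) u M Hu HM) as [x' [M' [Hx' [HM' [E Bx]]]]]; [|apply hb|].
  + intros a ha. split; [now apply Hq|]. destruct (N a) as [h|h]; [exact h|exfalso; apply h].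
    rewrite <- V0, (staged_pprod q V n a SV). destruct SV as [_ EV]. rewrite EV, (proj2 (prodl_root _ _) ha). ring.
  + exists (x', M'). simpl. auto.
- destruct (Hbeta (fun n => fst (s (S n)))) as [y [Hy Ey]].
  { intros n. apply K. } { intros n. apply K. }
  (* By the recursion for [y], the remainders minus y_n u lose the same blocks as [V]; at stage 0
     the quotient gives 1 - y_0 u = v e. *)
  destruct (staged_div q (fun n z => snd (s n) z - y n z * u z)%C V) as [e [He Ee]].
  + split.
    * intros n. apply holo_minus; [apply K|]. apply holo_mult; [apply Hy|exact Hu].
    * intros n z. destruct (K n) as [_ [Kn _]]. rewrite (Ey n z).
      replace (snd (s n) z - (fst (s (S n)) z + prodl (q n) z * y (S n) z) * u z)%C with
        ((snd (s n) z - fst (s (S n)) z * u z) - prodl (q n) z * y (S n) z * u z)%C by ring.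
      rewrite Kn. ring.
  + exact SV.
  + exact NV.
  + exists (y 0%nat), e. split; [apply Hy|split; [exact He|]]. intros z.
    specialize (Ee 0%nat z). rewrite E0, V0 in Ee. simpl in Ee. rewrite <- Ee. ring.
Qed.

Lemma bezout_holo (f g : C -> C) : holo f -> holo g ->
  exists d u v s t, holo d /\ holo u /\ holo v /\ holo s /\ holo t /\
    (forall z, f z = (d z * u z)%C) /\ (forall z, g z = (d z * v z)%C) /\
    forall z, (u z * s z + v z * t z)%C = 1.
Proof.
intros Hf Hg. destruct (classic (exists c, f c <> 0)) as [[c hc]|h].
- destruct (common_roots_staged f g c Hf Hg hc) as [q [F [G [F0 [G0 [SF [SG [Hq N]]]]]]]].
  destruct (weierstrass_product q Hq) as [D [SD ND]].
  destruct (staged_div q F D SF SD ND) as [u [Hu Eu]].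
  destruct (staged_div q G D SG SD ND) as [v [Hv Ev]].
  (* The roles are exchanged because the factor known not to vanish identically is [u], coming from
     f(c) <> 0. *)
  destruct (bezout_coprime v u c Hv Hu) as [t [s [Ht [Hs E]]]].
  + intros E. apply hc. rewrite <- F0, Eu, E. ring.
  + intros z. destruct (exists_nat_ge (Cmod z)) as [n hn].
    destruct (N n z hn) as [h|h]; [right|left]; intros E; apply h; rewrite ?Eu, ?Ev, E; ring.
  + exists (D 0%nat), u, v, s, t. rewrite <- F0, <- G0.
    repeat (split; [assumption || apply SD || (intros z; apply Eu) || (intros z; apply Ev)|]).
    intros z. rewrite <- (E z). ring.
- assert (f0 : forall z, f z = 0) by (intros z; apply NNPP; intros n; apply h; now exists z).
  exists g, (fun _ => RtoC 0), (fun _ => RtoC 1), (fun _ => RtoC 0), (fun _ => RtoC 1).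
  repeat (split; [assumption || apply holo_const|]).
  split; [|split]; intros z; rewrite ?f0; ring.
Qed.

(** * Interpolation at the integers *)

Definition ZtoC (k : Z) : C := RtoC (IZR k).

Lemma ZtoC_inj k m : ZtoC k = ZtoC m -> k = m.
Proof. intros E. apply eq_IZR. now apply RtoC_inj. Qed.

Lemma Cmod_ZtoC k : Cmod (ZtoC k) = INR (Z.abs_nat k).
Proof. unfold ZtoC. rewrite Cmod_R, <- abs_IZR, INR_IZR_INZ, Nat2Z.inj_abs_nat. reflexivity. Qed.

Definition zroots (n : nat) : list C :=
  match n with O => ZtoC 0 :: nil | _ => ZtoC (Z.of_nat n) :: ZtoC (- Z.of_nat n) :: nil end.

Lemma in_zroots n a : In a (zroots n) -> exists k, a = ZtoC k /\ Z.abs_nat k = n.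
Proof.
destruct n as [|n].
- intros [<-|[]]. now exists 0%Z.
- intros [<-|[<-|[]]].
  + exists (Z.of_nat (S n)). split; [reflexivity|lia].
  + exists (- Z.of_nat (S n))%Z. split; [reflexivity|lia].
Qed.

Lemma zroots_split k : exists g, holo g /\ g (ZtoC k) <> 0 /\
  forall z, prodl (zroots (Z.abs_nat k)) z = ((z - ZtoC k) * g z)%C.
Proof.
destruct (Z.eq_dec k 0) as [->|h0].
- exists (fun _ => RtoC 1). split; [apply holo_const|split; [apply C1_nz|]]. intros z. simpl. ring.
- exists (fun z => z - ZtoC (- k))%C. split; [apply holo_minus; [apply holo_id|apply holo_const]|split].
  + apply Cminus_neq. intros E. apply ZtoC_inj in E. lia.
  + intros z. destruct (Z.abs_nat k) as [|n] eqn:E; [lia|]. unfold zroots.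
    destruct (Z.abs_spec k) as [[_ H]|[_ H]].
    * replace (Z.of_nat (S n)) with k by lia. simpl. ring.
    * replace (Z.of_nat (S n)) with (- k)%Z by lia. replace (- - k)%Z with k by lia. simpl. ring.
Qed.

Lemma escaping_zroots : escaping zroots.
Proof.
intros n a ha. apply in_zroots in ha. destruct ha as [k [-> <-]]. rewrite Cmod_ZtoC. lra.
Qed.

(* An entire function playing the role of sin (pi z). *)
Lemma integer_zeros : exists S, holo S /\
  (forall k, exists g, holo g /\ g (ZtoC k) <> 0 /\ forall z, S z = ((z - ZtoC k) * g z)%C) /\
  (forall K, holo K -> (forall k, K (ZtoC k) = 0) -> exists e, holo e /\ forall z, K z = (S z * e z)%C).
Proof.
destruct (weierstrass_product zroots escaping_zroots) as [D [SD ND]].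
exists (D 0%nat). split; [apply SD|split].
- intros k. set (n := Z.abs_nat k). destruct (zroots_split k) as [g [Hg [g0 Eg]]].
  exists (fun z => pprod (fun i => prodl (zroots i)) 0 n z * (g z * D (S n) z))%C. split; [|split].
  + apply holo_mult; [apply holo_pprod; intros i; apply holo_prodl|]. apply holo_mult; [exact Hg|apply SD].
  + apply Cmult_neq_0; [|apply Cmult_neq_0; [exact g0|]].
    * assert (P : forall m, (m <= n)%nat -> pprod (fun i => prodl (zroots i)) 0 m (ZtoC k) <> 0).
      { induction m as [|m IH]; intros hm; [apply C1_nz|]. simpl. apply Cmult_neq_0; [apply IH; lia|].
        intros E. apply prodl_root, in_zroots in E. destruct E as [j [E1 E2]].
        apply ZtoC_inj in E1. subst j. unfold n in hm. lia. }
      now apply P.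
    * apply ND. rewrite Cmod_ZtoC. apply Rle_refl.
  + intros z. rewrite (staged_pprod _ _ n z SD). destruct SD as [_ ED]. rewrite (ED n z).
    unfold n at 2. rewrite Eg. ring.
- intros K HK K0.
  (* After the blocks below n have been divided out, the quotient still vanishes at the integers of
     absolute value at least n, as those blocks do not vanish there. *)
  destruct (dep_choice (C -> C) (fun n M => holo M /\ forall k, (n <= Z.abs_nat k)%nat -> M (ZtoC k) = 0)
    (fun n M M' => forall z, M z = (prodl (zroots n) z * M' z)%C) K) as [M [E0 HM]].
  + split; [exact HK|]. intros k _. apply K0.
  + intros n M [HM M0].
    assert (X : exists M', holo M' /\ forall z, M z = (prodl (zroots n) z * M' z)%C).
    { destruct n as [|n].
      - destruct (holo_div_root M (ZtoC 0) HM) as [M' [HM' E]]; [apply M0; lia|].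
        exists M'. split; [exact HM'|]. intros z. rewrite E. simpl. ring.
      - destruct (holo_div_root M (ZtoC (Z.of_nat (S n))) HM) as [M1 [HM1 E1]]; [apply M0; lia|].
        destruct (holo_div_root M1 (ZtoC (- Z.of_nat (S n))) HM1) as [M2 [HM2 E2]].
        + assert (Z2 : M (ZtoC (- Z.of_nat (S n))) = 0) by (apply M0; lia).
          rewrite E1 in Z2. destruct (Cmult_integral _ _ Z2) as [h|h]; [|exact h].
          apply Ceq_minus, ZtoC_inj in h. lia.
        + exists M2. split; [exact HM2|]. intros z. rewrite E1, E2. unfold zroots. simpl. ring. }
    destruct X as [M' [HM' E]]. exists M'. split; [split; [exact HM'|]|exact E].
    intros k hk. assert (Zk : M (ZtoC k) = 0) by (apply M0; lia).
    rewrite E in Zk. destruct (Cmult_integral _ _ Zk) as [h|h]; [|exact h].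
    apply prodl_root, in_zroots in h. destruct h as [j [E1 E2]]. apply ZtoC_inj in E1. subst j. lia.
  + destruct (staged_div zroots M D) as [e [He Ee]]; [|exact SD|exact ND|].
    * split; [intros n; apply HM|]. intros n. apply HM.
    * exists e. split; [exact He|]. intros z. rewrite <- Ee, E0. reflexivity.
Qed.

(** The cardinal function S(z) / ((z - k) S'(k)), with [g] at k in the role of S'(k), times a
    function equal to 1 at k that brings the product below eps on a disc excluding k. *)
Lemma integer_bump k eps : 0 < eps -> exists b, holo b /\ b (ZtoC k) = 1 /\
  (forall m, m <> k -> b (ZtoC m) = 0) /\
  forall z, Cmod z <= INR (Z.abs_nat k) - 1 -> Cmod (b z) <= eps.
Proof.
intros he. destruct integer_zeros as [S [HS [HR _]]].
destruct (HR k) as [g [Hg [g0 Eg]]].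
assert (ha : INR (Z.abs_nat k) - 1 < Cmod (ZtoC k)) by (rewrite Cmod_ZtoC; lra).
destruct (holo_bounded (fun z => / g (ZtoC k) * g z)%C (INR (Z.abs_nat k) - 1)) as [B [hB HB]].
{ apply holo_mult; [apply holo_const|exact Hg]. }
destruct (small_on_disc_one_at _ _ (eps / B) ha) as [phi [Hphi [p1 Bphi]]]; [now apply Rdiv_lt_0_compat|].
exists (fun z => / g (ZtoC k) * g z * phi z)%C. split; [|split; [|split]].
- apply holo_mult; [|exact Hphi]. apply holo_mult; [apply holo_const|exact Hg].
- rewrite p1. field. exact g0.
- intros m hm.
  assert (gm : g (ZtoC m) = 0); [|rewrite gm; ring].
  assert (Sm : S (ZtoC m) = 0).
  { destruct (HR m) as [g' [_ [_ E']]]. rewrite E'. ring. }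
  rewrite Eg in Sm. destruct (Cmult_integral _ _ Sm) as [h|h]; [|exact h].
  apply Ceq_minus, ZtoC_inj in h. contradiction.
- intros z hz. rewrite Cmod_mult. replace eps with (B * (eps / B)) by (field; lra).
  apply Rmult_le_compat; auto using Cmod_ge_0.
Qed.

Lemma integer_interpolation (c : Z -> C) : exists F, holo F /\ forall k, F (ZtoC k) = c k.
Proof.
assert (T : forall n, exists t, holo t /\
   (forall m, t (ZtoC m) = if Nat.eq_dec (Z.abs_nat m) n then c m else RtoC 0) /\
   forall z, Cmod z <= INR n - 1 -> Cmod (t z) <= (/ 2) ^ n).
{ intros n. pose proof (half_pow_pos n) as hp.
  set (k := Z.of_nat n). assert (Ek : Z.abs_nat k = n) by (unfold k; lia).
  assert (Ek' : Z.abs_nat (- k) = n) by (unfold k; lia).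
  (* Bumps bounded by 2^-n / A make the n-th term, with its two coefficients, at most 2^-n. *)
  set (A := 1 + Cmod (c k) + Cmod (c (- k)%Z)).
  assert (hA : 0 < A) by (unfold A; pose proof (Cmod_ge_0 (c k)); pose proof (Cmod_ge_0 (c (- k)%Z)); lra).
  assert (heA : 0 < (/ 2) ^ n / A) by now apply Rdiv_lt_0_compat.
  destruct (integer_bump k _ heA) as [b [Hb [b1 [b0 Bb]]]].
  destruct (integer_bump (- k) _ heA) as [b' [Hb' [b1' [b0' Bb']]]].
  rewrite Ek in Bb. rewrite Ek' in Bb'.
  (* For n = 0 the integers k and - k coincide and the value must be counted once. *)
  set (c' := if Z.eq_dec k 0 then RtoC 0 else c (- k)%Z).
  exists (fun z => c k * b z + c' * b' z)%C. split; [|split].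
  - apply holo_plus; apply holo_mult; auto using holo_const.
  - intros m. unfold c'. destruct (Nat.eq_dec (Z.abs_nat m) n) as [h|h].
    + destruct (Z.eq_dec m k) as [->|h1].
      * rewrite b1. destruct (Z.eq_dec k 0) as [->|h2]; [ring|]. rewrite b0' by lia. ring.
      * assert (m = (- k)%Z) by lia. subst m. rewrite b1', b0 by lia.
        destruct (Z.eq_dec k 0) as [h2|h2]; [lia|]. ring.
    + rewrite b0, b0' by lia. ring.
  - intros z hz. specialize (Bb z hz). specialize (Bb' z hz).
    assert (hc' : Cmod c' <= Cmod (c (- k)%Z)).
    { unfold c'. destruct (Z.eq_dec k 0); [rewrite Cmod_0; apply Cmod_ge_0|apply Rle_refl]. }
    eapply Rle_trans; [apply Cmod_triangle|]. rewrite !Cmod_mult.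
    assert (X1 : Cmod (c k) * Cmod (b z) <= Cmod (c k) * ((/ 2) ^ n / A)).
    { apply Rmult_le_compat_l; [apply Cmod_ge_0|exact Bb]. }
    assert (X2 : Cmod c' * Cmod (b' z) <= Cmod (c (- k)%Z) * ((/ 2) ^ n / A)).
    { apply Rmult_le_compat; auto using Cmod_ge_0. }
    replace ((/ 2) ^ n) with (A * ((/ 2) ^ n / A)) at 1 by (field; lra). unfold A at 1. nra. }
destruct (choice _ T) as [t Ht].
destruct (holo_limit (fun n z => csum (fun i => t i z) n)) as [F [HF LF]].
- intros n. apply holo_csum. intros i. apply Ht.
- intros rho. destruct (exists_nat_ge (rho + 1)) as [N hN]. exists N, 1. split; [lra|].
  intros n z hn hz. simpl. replace (csum (fun i => t i z) n + t n z - csum (fun i => t i z) n)%C with (t n z) by ring.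
  rewrite Rmult_1_l. apply Ht. apply le_INR in hn. lra.
- exists F. split; [exact HF|]. intros k. apply clim_unique with (1 := LF (ZtoC k)).
  apply clim_eventually_const with (S (Z.abs_nat k)). intros n hn.
  assert (E : forall m, csum (fun i => t i (ZtoC k)) m = if Nat.ltb (Z.abs_nat k) m then c k else RtoC 0).
  { induction m as [|m IH]; [reflexivity|]. simpl csum. rewrite IH, (proj1 (proj2 (Ht m))).
    destruct (Nat.ltb_spec (Z.abs_nat k) m), (Nat.ltb_spec (Z.abs_nat k) (S m)), (Nat.eq_dec (Z.abs_nat k) m);
      try lia; ring. }
  rewrite E. destruct (Nat.ltb_spec (Z.abs_nat k) n); [reflexivity|lia].
Qed.

(** * Integer-valued entire functions *)

Definition extend {T : Type} (x : nat -> T) (n : nat) (t : T) (i : nat) : T :=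
  if Nat.eqb i n then t else x i.

Lemma extend_eq {T} (x : nat -> T) n t : extend x n t n = t.
Proof. unfold extend. now rewrite Nat.eqb_refl. Qed.

Lemma extend_lt {T} (x : nat -> T) n t i : (i < n)%nat -> extend x n t i = x i.
Proof. intros h. unfold extend. destruct (Nat.eqb_spec i n); [lia|reflexivity]. Qed.

(** If d = e a, f_(n+1) = e b and a s + b t = 1, the new cofactors are the a u_i together with b,
    and the new coefficients the s w_i together with t. *)
Lemma bezout_family (f : nat -> C -> C) n : (forall i, holo (f i)) ->
  exists d u w, holo d /\ (forall i, holo (u i)) /\ (forall i, holo (w i)) /\
    (forall i z, (i < S n)%nat -> f i z = (d z * u i z)%C) /\
    forall z, csum (fun i => u i z * w i z)%C (S n) = 1.
Proof.
intros Hf. induction n as [|n [d [u [w [Hd [Hu [Hw [E S1]]]]]]]].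
- exists (f 0%nat), (fun _ _ => RtoC 1), (fun _ _ => RtoC 1).
  split; [apply Hf|split; [intros; apply holo_const|split; [intros; apply holo_const|split]]].
  + intros i z hi. replace i with 0%nat by lia. ring.
  + intros z. simpl. ring.
- destruct (bezout_holo d (f (S n)) Hd (Hf (S n))) as [e [a [b [s [t [He [Ha [Hb [Hs [Ht [E1 [E2 E3]]]]]]]]]]]].
  exists e, (extend (fun i z => a z * u i z)%C (S n) b), (extend (fun i z => s z * w i z)%C (S n) t).
  split; [exact He|split; [|split; [|split]]].
  + intros i. unfold extend. destruct (Nat.eqb i (S n)); [exact Hb|now apply holo_mult].
  + intros i. unfold extend. destruct (Nat.eqb i (S n)); [exact Ht|now apply holo_mult].
  + intros i z hi. destruct (Nat.eq_dec i (S n)) as [->|h].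
    * rewrite extend_eq. apply E2.
    * rewrite extend_lt by lia. cbv beta. rewrite E by lia. rewrite E1. ring.
  + intros z. change (csum _ (S (S n))) with
      (csum (fun i => extend (fun i z => a z * u i z)%C (S n) b i z * extend (fun i z => s z * w i z)%C (S n) t i z)%C (S n)
       + extend (fun i z => a z * u i z)%C (S n) b (S n) z * extend (fun i z => s z * w i z)%C (S n) t (S n) z)%C.
    rewrite !extend_eq.
    rewrite (csum_ext _ (fun i => (a z * s z) * (u i z * w i z))%C).
    * rewrite csum_scal, S1, Cmult_1_r. apply E3.
    * intros i hi. cbv beta. rewrite !extend_lt by lia. cbv beta. ring.
Qed.

Lemma bezout_Z (x y : Z) : exists d u v s t, (x = d * u /\ y = d * v /\ u * s + v * t = 1)%Z.
Proof.
(* When x = 0 the gcd may be 0 and cannot be cancelled; the cofactors 0 and 1 serve even if y =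
   0. *)
destruct (Z.eq_dec x 0) as [->|hx].
- exists y, 0%Z, 1%Z, 0%Z, 1%Z. lia.
- destruct (Z.gcd_bezout x y (Z.gcd x y) eq_refl) as [s [t E]].
  destruct (Z.gcd_divide_l x y) as [u Hu]. destruct (Z.gcd_divide_r x y) as [v Hv].
  assert (g0 : Z.gcd x y <> 0%Z) by (intros h; apply Z.gcd_eq_0_l in h; contradiction).
  set (g := Z.gcd x y) in *.
  exists g, u, v, s, t. split; [lia|split; [lia|]].
  apply Z.mul_reg_r with g; [exact g0|]. clearbody g. rewrite Hu, Hv in E.
  transitivity (s * (u * g) + t * (v * g))%Z; [ring|]. rewrite E. ring.
Qed.

Lemma bezout_family_Z (x : nat -> Z) n :
  exists (d : Z) (u w : nat -> Z), (forall i, (i < S n)%nat -> x i = (d * u i)%Z) /\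
    csum (fun i => ZtoC (u i) * ZtoC (w i))%C (S n) = 1.
Proof.
induction n as [|n [d [u [w [E S1]]]]].
- exists (x 0%nat), (fun _ => 1%Z), (fun _ => 1%Z). split.
  + intros i hi. replace i with 0%nat by lia. lia.
  + unfold ZtoC. simpl. ring.
- destruct (bezout_Z d (x (S n))) as [e [a [b [s [t [E1 [E2 E3]]]]]]].
  exists e, (extend (fun i => a * u i)%Z (S n) b), (extend (fun i => s * w i)%Z (S n) t).
  split.
  + intros i hi. destruct (Nat.eq_dec i (S n)) as [->|h].
    * rewrite extend_eq. apply E2.
    * rewrite extend_lt by lia. cbv beta. rewrite E by lia. rewrite E1. ring.
  + change (csum _ (S (S n))) with
      (csum (fun i => ZtoC (extend (fun i => a * u i)%Z (S n) b i) * ZtoC (extend (fun i => s * w i)%Z (S n) t i))%C (S n)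
       + ZtoC (extend (fun i => a * u i)%Z (S n) b (S n)) * ZtoC (extend (fun i => s * w i)%Z (S n) t (S n)))%C.
    rewrite !extend_eq.
    rewrite (csum_ext _ (fun i => (ZtoC a * ZtoC s) * (ZtoC (u i) * ZtoC (w i)))%C).
    * rewrite csum_scal, S1, Cmult_1_r. unfold ZtoC.
      replace (RtoC 1) with (RtoC (IZR (a * s + b * t))) by (now rewrite E3).
      rewrite plus_IZR, !mult_IZR, RtoC_plus, !RtoC_mult. ring.
    * intros i hi. rewrite !extend_lt by lia. unfold ZtoC. rewrite !mult_IZR, !RtoC_mult. ring.
Qed.

Lemma common_denominator (q : nat -> Q) n :
  exists (D : Z) (x : nat -> Z), D <> 0%Z /\ forall i, (i < n)%nat -> Q2R (q i) * IZR D = IZR (x i).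
Proof.
induction n as [|n [D [x [hD E]]]].
- exists 1%Z, (fun _ => 0%Z). split; [lia|]. intros; lia.
- exists (D * Z.pos (Qden (q n)))%Z, (extend (fun i => x i * Z.pos (Qden (q n)))%Z n (Qnum (q n) * D)%Z).
  split; [lia|]. intros i hi. destruct (Nat.eq_dec i n) as [->|h].
  + rewrite extend_eq, !mult_IZR. unfold Q2R. field. apply not_0_IZR. lia.
  + rewrite extend_lt by lia. rewrite !mult_IZR, <- E by lia. ring.
Qed.

Lemma rational_family_primitive (q : nat -> Q) n :
  exists (g : R) (u w : nat -> Z), (forall i, (i < S n)%nat -> Q2R (q i) = g * IZR (u i)) /\
    csum (fun i => ZtoC (u i) * ZtoC (w i))%C (S n) = 1.
Proof.
destruct (common_denominator q (S n)) as [D [x [hD E]]].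
destruct (bezout_family_Z x n) as [d [u [w [E2 S1]]]].
exists (IZR d / IZR D), u, w. split; [|exact S1].
intros i hi. apply not_0_IZR in hD. apply Rmult_eq_reg_r with (IZR D); [|exact hD].
rewrite E, E2, mult_IZR by exact hi. field. exact hD.
Qed.

Lemma csum_eq0 (x : nat -> C) n : (forall i, (i < n)%nat -> x i = 0) -> csum x n = 0.
Proof. induction n as [|n IH]; intros H; [reflexivity|]. simpl. rewrite IH, H by auto. ring. Qed.

Lemma csum_plus x y n : csum (fun i => x i + y i)%C n = (csum x n + csum y n)%C.
Proof. induction n as [|n IH]; simpl; [ring|]. rewrite IH. ring. Qed.

(* At n the vector u is c_n times a primitive integer vector a_n; an entire e
   with e(n) = 1/c_n and no zeros makes e u integer-valued. Any entire v with
   v(n) dual to a_n has 1 - sum (e u) v vanishing on Z, and the defect is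
   absorbed by a multiple of S = "sin (pi z)". *)
Lemma integer_valued_bezout (u w : nat -> C -> C) r :
  (forall i, holo (u i)) -> (forall i, holo (w i)) ->
  (forall z, csum (fun i => u i z * w i z)%C (S r) = 1) ->
  (forall k, exists j, (j < S r)%nat /\ forall i, (i < S r)%nat ->
     exists q, u i (ZtoC k) = (RtoC (Q2R q) * u j (ZtoC k))%C) ->
  exists (e e' : C -> C) (v : nat -> C -> C), holo e /\ holo e' /\ (forall i, holo (v i)) /\
    (forall z, (e z * e' z)%C = 1) /\
    (forall i k, (i < S r)%nat -> exists m, (e (ZtoC k) * u i (ZtoC k))%C = ZtoC m) /\
    (forall i k, exists m, v i (ZtoC k) = ZtoC m) /\
    forall z, csum (fun i => e z * u i z * v i z)%C (S r) = 1.
Proof.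
intros Hu Hw E1 HQ.
assert (P : forall k, exists d : C * (nat -> Z) * (nat -> Z),
   (forall i, (i < S r)%nat -> u i (ZtoC k) = (cexp (fst (fst d)) * ZtoC (snd (fst d) i))%C) /\
   csum (fun i => ZtoC (snd (fst d) i) * ZtoC (snd d i))%C (S r) = 1).
{ intros k. destruct (HQ k) as [j [hj Hj]].
  destruct (choice (fun i q => (i < S r)%nat -> u i (ZtoC k) = (RtoC (Q2R q) * u j (ZtoC k))%C)) as [q Hq].
  { intros i. destruct (Nat.lt_ge_cases i (S r)) as [h|h].
    - destruct (Hj i h) as [q Hq]. now exists q.
    - exists 0%Q. intros. lia. }
  destruct (rational_family_primitive q r) as [g [a [b [Ea Sb]]]].
  assert (Eu : forall i, (i < S r)%nat -> u i (ZtoC k) = (RtoC g * u j (ZtoC k) * ZtoC (a i))%C).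
  { intros i hi. rewrite (Hq i hi), (Ea i hi), RtoC_mult. unfold ZtoC. ring. }
  (* A zero scalar would make all u_i vanish at k, against sum u_i w_i = 1; a nonzero one is an
     exponential. *)
  destruct (Ceq_dec (RtoC g * u j (ZtoC k))%C 0) as [h|h].
  - exfalso. apply C1_nz. rewrite <- (E1 (ZtoC k)).
    apply (csum_eq0 (fun i => u i (ZtoC k) * w i (ZtoC k))%C).
    intros i hi. rewrite (Eu i hi), h. ring.
  - destruct (cexp_surj _ h) as [l Hl]. exists (l, a, b). simpl fst; simpl snd. split; [|exact Sb].
    intros i hi. rewrite Hl. now apply Eu. }
destruct (choice _ P) as [d Hd].
destruct (integer_interpolation (fun k => - fst (fst (d k)))%C) as [h [Hh Eh]].
set (e := fun z => cexp (h z)). set (e' := fun z => cexp (- h z)%C).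
assert (He : holo e) by (apply (holo_comp cexp h); [apply holo_cexp|exact Hh]).
assert (He' : holo e') by (apply (holo_comp cexp (fun z => - h z)%C); [apply holo_cexp|now apply holo_opp]).
assert (Eu : forall i k, (i < S r)%nat -> (e (ZtoC k) * u i (ZtoC k))%C = ZtoC (snd (fst (d k)) i)).
{ intros i k hi. unfold e. rewrite Eh, (proj1 (Hd k) i hi).
  transitivity (cexp (fst (fst (d k))) * cexp (- fst (fst (d k))) * ZtoC (snd (fst (d k)) i))%C; [ring|].
  rewrite cexp_opp. ring. }
destruct (choice (fun i B => holo B /\ forall k, B (ZtoC k) = ZtoC (snd (d k) i))) as [B HB].
{ intros i. apply (integer_interpolation (fun k => ZtoC (snd (d k) i))). }
destruct integer_zeros as [S0 [HS [S0z SD]]].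
destruct (SD (fun z => 1 - csum (fun i => e z * u i z * B i z)%C (S r))%C) as [m [Hm Em]].
{ apply holo_minus; [apply holo_const|]. apply (holo_csum (fun i z => e z * u i z * B i z)%C).
  intros i. repeat apply holo_mult; auto. apply HB. }
{ intros k. rewrite (csum_ext _ (fun i => ZtoC (snd (fst (d k)) i) * ZtoC (snd (d k) i))%C).
  - rewrite (proj2 (Hd k)). ring.
  - intros i hi. rewrite (Eu i k hi), (proj2 (HB i)). reflexivity. }
(* In sum e u_i v_i the second term contributes (e e') S0 m sum u_i w_i = S0 m, which is the defect
   1 - sum e u_i B_i; at the integers S0 = 0 leaves the values of B_i unchanged. *)
exists e, e', (fun i z => B i z + S0 z * m z * e' z * w i z)%C.
split; [exact He|split; [exact He'|split; [|split; [|split; [|split]]]]].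
- intros i. apply holo_plus; [apply HB|]. repeat apply holo_mult; auto.
- intros z. apply cexp_opp.
- intros i k hi. exists (snd (fst (d k)) i). now apply Eu.
- intros i k. exists (snd (d k) i). rewrite (proj2 (HB i)).
  destruct (S0z k) as [g [_ [_ Eg]]]. rewrite (Eg (ZtoC k)). ring.
- intros z.
  rewrite (csum_ext _ (fun i => e z * u i z * B i z + (S0 z * m z) * (u i z * w i z))%C).
  + rewrite csum_plus, csum_scal, E1. rewrite Cmult_1_r, <- Em. ring.
  + intros i hi. replace (e z * u i z * (B i z + S0 z * m z * e' z * w i z))%C with
      (e z * u i z * B i z + (e z * e' z) * (S0 z * m z * (u i z * w i z)))%C by ring.
    unfold e, e'. rewrite cexp_opp. ring.
Qed.

Lemma filterlim_punctured (F : C -> C) (z c : C) :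
  filterlim F (@locally' C_UniformSpace z) (@locally C_UniformSpace c) <->
  forall eps, 0 < eps -> exists del, 0 < del /\
    forall w, 0 < Cmod (w - z) < del -> Cmod (F w - c) < eps.
Proof.
split.
(* The balls of [C_UniformSpace] are taken componentwise, hence the halvings in both directions. *)
- intros H eps he. assert (he2 : 0 < eps / 2) by lra.
  destruct (H (ball c (mkposreal _ he2))) as [[d hd] K].
  { now exists (mkposreal _ he2). }
  exists d. split; [exact hd|]. intros w [w0 w1].
  assert (Bw : @ball C_UniformSpace z d w).
  { split.
    - apply Rle_lt_trans with (2 := w1). apply (Rabs_fst_le (w - z)).
    - apply Rle_lt_trans with (2 := w1). apply (Rabs_snd_le (w - z)). }
  assert (Nw : w <> z).
  { intros ->. replace (z - z)%C with (RtoC 0) in w0 by ring. rewrite Cmod_0 in w0. lra. }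
  destruct (K w Bw Nw) as [B1 B2].
  change (Rabs (fst (F w - c)%C) < eps / 2) in B1.
  change (Rabs (snd (F w - c)%C) < eps / 2) in B2.
  eapply Rle_lt_trans; [apply Cmod_le_sum|]. lra.
- intros H P [[eps he] HP]. destruct (H eps he) as [d [hd K]].
  assert (hd2 : 0 < d / 2) by lra.
  exists (mkposreal _ hd2). intros w [B1 B2] Nw. apply HP.
  change (Rabs (fst (w - z)%C) < d / 2) in B1. change (Rabs (snd (w - z)%C) < d / 2) in B2.
  assert (X : Cmod (F w - c) < eps).
  { apply K. split; [apply Cmod_gt_0; now apply Cminus_neq|].
    eapply Rle_lt_trans; [apply Cmod_le_sum|]. lra. }
  split.
  + apply Rle_lt_trans with (2 := X). apply (Rabs_fst_le (F w - c)).
  + apply Rle_lt_trans with (2 := X). apply (Rabs_snd_le (F w - c)).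
Qed.

Lemma ie_holo (f : IntEntire) : holo f.
Proof. apply entire_holo, ie_entire. Qed.

Lemma ie_neq_zero (f : IntEntire) : f <> zero -> exists z, f z <> 0.
Proof.
intros h. apply NNPP. intros N. apply h. apply ie_ext. intros z. rewrite ie_zeroE.
apply NNPP. intros h'. apply N. now exists z.
Qed.

Lemma ie_sum_csum (f a : nat -> IntEntire) r z :
  (sum_n_m (fun j => mult (f j) (a j)) 1 r : IntEntire) z = csum (fun i => f (S i) z * a (S i) z)%C r.
Proof.
induction r as [|r IH].
- rewrite sum_n_m_zero by lia. reflexivity.
- rewrite sum_n_Sm by lia. rewrite ie_plusE, IH. reflexivity.
Qed.

(** The common factor [d] may vanish at [z], so f / g is compared with u / v at nearby points where
    [g] is nonzero. The conclusion, written as a product, then follows by continuity also when v(z)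
    = 0. *)
Lemma quotient_value_eq (f g : IntEntire) (d u v : C -> C) z c : g <> zero ->
  (forall w, cont_at u w) -> (forall w, cont_at v w) ->
  (forall w, f w = (d w * u w)%C) -> (forall w, g w = (d w * v w)%C) ->
  quotient_value f g z c -> u z = (c * v z)%C.
Proof.
intros hg Hu Hv Ef Eg [_ H]. apply Ceq_minus, eq_0_of_small. intros eps he.
assert (Ch : cont_at (fun w => u w - c * v w)%C z).
{ apply cont_at_minus; [apply Hu|]. apply cont_at_mult; [apply cont_at_const|apply Hv]. }
destruct (Ch (eps / 2)) as [d1 [h1 K1]]; [lra|].
destruct (cont_at_bounded v z (Hv z)) as [d2 [B [h2 [hB K2]]]].
apply filterlim_punctured with (eps := eps / 2 / B) in H; [|repeat apply Rdiv_lt_0_compat; lra].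
destruct H as [d3 [h3 K3]].
destruct (ie_neq_zero g hg) as [x hx].
destruct (isolated_roots g x z (ie_holo g) hx) as [d4 [h4 K4]].
set (m := Rmin (Rmin d1 d2) (Rmin d3 d4) / 2).
assert (hm : 0 < Rmin (Rmin d1 d2) (Rmin d3 d4)) by (repeat apply Rmin_glb_lt; assumption).
assert (m1 : Rmin (Rmin d1 d2) (Rmin d3 d4) <= d1) by (eapply Rle_trans; [apply Rmin_l|apply Rmin_l]).
assert (m2 : Rmin (Rmin d1 d2) (Rmin d3 d4) <= d2) by (eapply Rle_trans; [apply Rmin_l|apply Rmin_r]).
assert (m3 : Rmin (Rmin d1 d2) (Rmin d3 d4) <= d3) by (eapply Rle_trans; [apply Rmin_r|apply Rmin_l]).
assert (m4 : Rmin (Rmin d1 d2) (Rmin d3 d4) <= d4) by (eapply Rle_trans; [apply Rmin_r|apply Rmin_r]).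
set (w := (z + RtoC m)%C).
assert (Ew : Cmod (w - z) = m) by (unfold w; replace (z + RtoC m - z)%C with (RtoC m) by ring; apply Cmod_pos_R; unfold m; lra).
assert (gw : g w <> 0) by (apply K4; rewrite Ew; unfold m; lra).
specialize (K1 w ltac:(rewrite Ew; unfold m; lra)). specialize (K2 w ltac:(rewrite Ew; unfold m; lra)).
specialize (K3 w ltac:(rewrite Ew; unfold m; lra)).
assert (dw : d w <> 0) by (intros E; apply gw; rewrite Eg, E; ring).
assert (vw : v w <> 0) by (intros E; apply gw; rewrite Eg, E; ring).
assert (X : Cmod (u w - c * v w) <= eps / 2).
{ replace (u w - c * v w)%C with ((f w / g w - c) * v w)%C by (rewrite Ef, Eg; field; auto).
  rewrite Cmod_mult. replace (eps / 2) with (eps / 2 / B * B) by (field; lra).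
  apply Rmult_le_compat; auto using Cmod_ge_0. lra. }
replace (u z - c * v z)%C with ((u w - c * v w) - ((u w - c * v w) - (u z - c * v z)))%C by ring.
eapply Rle_trans; [apply Cmod_triangle_minus|]. lra.
Qed.

Lemma quotient_value_intro (f g : IntEntire) (d u v : C -> C) x z : holo d -> d x <> 0 ->
  (forall w, cont_at u w) -> (forall w, cont_at v w) -> v z <> 0 ->
  (forall w, f w = (d w * u w)%C) -> (forall w, g w = (d w * v w)%C) ->
  quotient_value f g z (u z / v z)%C.
Proof.
intros Hd hx Hu Hv vz Ef Eg.
destruct (isolated_roots d x z Hd hx) as [d1 [h1 K1]].
destruct (cont_at_neq0 v z (Hv z) vz) as [d2 [h2 K2]].
assert (NV : forall w, Cmod (w - z) < d2 -> v w <> 0).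
{ intros w hw. apply Cmod_gt_0. pose proof (K2 w hw). pose proof (Cmod_ge_0 (v z)). lra. }
split.
(* Close to [z] but off it neither [d] nor [v] vanishes, so [g] is not the zero function. *)
- intros g0. exfalso.
  set (m := Rmin d1 d2 / 2). assert (hm : 0 < Rmin d1 d2) by (apply Rmin_glb_lt; assumption).
  pose proof (Rmin_l d1 d2) as m1. pose proof (Rmin_r d1 d2) as m2.
  assert (Ew : Cmod (z + RtoC m - z) = m) by (replace (z + RtoC m - z)%C with (RtoC m) by ring; apply Cmod_pos_R; unfold m; lra).
  apply (Cmult_neq_0 (d (z + RtoC m)%C) (v (z + RtoC m)%C)).
  + apply K1. rewrite Ew. unfold m. lra.
  + apply NV. rewrite Ew. unfold m. lra.
  + rewrite <- Eg, g0. apply ie_zeroE.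
- apply filterlim_punctured. intros eps he.
  destruct (cont_at_div u v z (Hu z) (Hv z) vz eps he) as [d3 [h3 K3]].
  exists (Rmin (Rmin d1 d2) d3). split; [repeat apply Rmin_glb_lt; assumption|].
  intros w [w0 w1].
  pose proof (Rlt_le_trans _ _ _ w1 (Rmin_r _ _)) as l3. pose proof (Rlt_le_trans _ _ _ w1 (Rmin_l _ _)) as l12.
  pose proof (Rlt_le_trans _ _ _ l12 (Rmin_l _ _)) as l1. pose proof (Rlt_le_trans _ _ _ l12 (Rmin_r _ _)) as l2.
  pose proof (NV w l2) as vw. pose proof (K1 w (conj w0 l1)) as dw.
  replace (f w / g w)%C with (u w / v w)%C by (rewrite Ef, Eg; field; auto).
  now apply K3.
Qed.

Lemma csum_neq0 (x : nat -> C) n : csum x n <> 0 -> exists i, (i < n)%nat /\ x i <> 0.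
Proof.
intros h. apply NNPP. intros N. apply h, csum_eq0. intros i hi.
apply NNPP. intros h'. apply N. now exists i.
Qed.

Lemma generator_in_fg_ideal {K : Ring} (r : nat) (f : nat -> K) j : (1 <= j <= r)%nat -> fg_ideal r f (f j).
Proof.
intros hj. exists (fun i => if Nat.eqb i j then one else zero).
assert (E : forall m, (m < j)%nat -> sum_n_m (fun i => mult (f i) (if Nat.eqb i j then one else zero)) 1 m = zero).
{ intros m hm. transitivity (sum_n_m (fun _ : nat => zero : K) 1 m); [|apply sum_n_m_const_zero].
  apply sum_n_m_ext_loc. intros i hi. destruct (Nat.eqb_spec i j); [lia|]. apply mult_zero_r. }
assert (F : forall m, (j <= m)%nat -> sum_n_m (fun i => mult (f i) (if Nat.eqb i j then one else zero)) 1 m = f j).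
{ induction m as [|m IH]; intros hm; [lia|]. rewrite sum_n_Sm by lia.
  destruct (Nat.eqb_spec (S m) j) as [h|h].
  - rewrite E by lia. rewrite <- h, mult_one_r. apply plus_zero_l.
  - rewrite IH by lia. rewrite mult_zero_r. apply plus_zero_r. }
symmetry. apply F. lia.
Qed.

Lemma Q2R_div (a b : Z) : b <> 0%Z -> exists q, Q2R q = IZR a / IZR b.
Proof.
(* The lemma rewritten with is the one of [Qreals] on quotients of rationals; its namesake is still
   being proved. *)
intros hb. exists (inject_Z a / inject_Z b)%Q. rewrite Q2R_div.
- unfold Q2R, inject_Z; simpl. rewrite Rinv_1, !Rmult_1_r. reflexivity.
- intros E. apply hb. unfold Qeq, inject_Z in E. simpl in E. lia.
Qed.

Lemma principal_quotient_rational (r : nat) (hr : (1 <= r)%nat) (f : nat -> IntEntire) :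
  is_principal (fg_ideal r f) ->
  forall n : Z, exists jn : nat, (1 <= jn <= r)%nat /\
    forall j : nat, (1 <= j <= r)%nat ->
      exists q : Q, quotient_value (f j) (f jn) (RtoC (IZR n)) (RtoC (Q2R q)).
Proof.
intros [d Hd] n.
destruct (choice (fun j a => (1 <= j <= r)%nat -> f j = mult d a)) as [a Ha].
{ intros j. destruct (classic (1 <= j <= r)%nat) as [h|h].
  - destruct (proj1 (Hd (f j)) (generator_in_fg_ideal r f j h)) as [a Ha]. now exists a.
  - exists zero. intros; contradiction. }
destruct (classic (d = zero)) as [d0|d0].
(* All f_j vanish identically, and the quotient 0 / 0 is the zero function, of value 0. *)
- exists 1%nat. split; [lia|]. intros j hj. exists 0%Q.
  assert (Z : forall i, (1 <= i <= r)%nat -> f i = zero).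
  { intros i hi. rewrite (Ha i hi), d0. apply ie_ext. intros z. change (RtoC 0 * a i z = RtoC 0)%C. ring. }
  rewrite (Z j hj), (Z 1%nat) by lia. split; [auto|].
  apply filterlim_punctured. intros eps he. exists 1. split; [lra|]. intros w _.
  rewrite ie_zeroE. replace (Q2R 0) with 0 by (unfold Q2R; simpl; ring).
  replace (0 / 0 - 0)%C with (RtoC 0) by (unfold Cdiv; ring). now rewrite Cmod_0.
- destruct (ie_neq_zero d d0) as [x hx].
  destruct (proj2 (Hd d)) as [b Hb].
  { exists one. apply ie_ext. intros z. rewrite ie_multE, ie_oneE. ring. }
  (* Substituting f_j = d a_j in d = sum f_j b_j gives d (1 - sum a_j b_j) = 0, from which
     [holo_integral] cancels d. *)
  assert (E1 : forall z, csum (fun i => a (S i) z * b (S i) z)%C r = 1).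
  { intros z. symmetry. apply Ceq_minus.
    apply (holo_integral d (fun z => 1 - csum (fun i => a (S i) z * b (S i) z)%C r)%C x (ie_holo d) hx).
    - apply holo_cont. apply holo_minus; [apply holo_const|].
      apply (holo_csum (fun i z => a (S i) z * b (S i) z)%C). intros i. apply holo_mult; apply ie_holo.
    - intros w.
      assert (Sw : d w = csum (fun i => f (S i) w * b (S i) w)%C r) by (rewrite <- ie_sum_csum, <- Hb; reflexivity).
      rewrite (csum_ext _ (fun i => d w * (a (S i) w * b (S i) w))%C), csum_scal in Sw.
      + replace (d w * (1 - csum (fun i => a (S i) w * b (S i) w) r))%C with
          (d w - d w * csum (fun i => a (S i) w * b (S i) w) r)%C by ring.
        rewrite <- Sw. ring.
      + intros i hi. rewrite (Ha (S i)) by lia. rewrite ie_multE. ring. }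
  destruct (csum_neq0 (fun i => a (S i) (ZtoC n) * b (S i) (ZtoC n))%C r) as [i [hi ni]].
  { rewrite E1. apply C1_nz. }
  assert (ai : a (S i) (ZtoC n) <> 0) by (intros E; apply ni; rewrite E; ring).
  exists (S i). split; [lia|]. intros j hj.
  destruct (ie_int (a j) n) as [p Hp]. destruct (ie_int (a (S i)) n) as [p' Hp'].
  assert (p0 : p' <> 0%Z) by (intros ->; now apply ai).
  destruct (Q2R_div p p' p0) as [q Hq]. exists q. rewrite Hq.
  assert (p0R : IZR p' <> 0) by now apply not_0_IZR.
  rewrite RtoC_div by exact p0R. rewrite <- Hp, <- Hp'.
  apply (quotient_value_intro (f j) (f (S i)) d (a j) (a (S i)) x); auto using ie_holo, holo_cont.
  + intros w. now rewrite (Ha j hj).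
  + intros w. rewrite (Ha (S i)) by lia. reflexivity.
Qed.

Lemma csum_ie_int (x : nat -> C) n : (forall i, (i < n)%nat -> exists m, x i = ZtoC m) -> exists m, csum x n = ZtoC m.
Proof.
induction n as [|n IH]; intros H; [now exists 0%Z|].
destruct IH as [a Ea]; [intros; apply H; lia|]. destruct (H n) as [b Eb]; [lia|].
exists (a + b)%Z. simpl. rewrite Ea, Eb. unfold ZtoC. now rewrite plus_IZR, RtoC_plus.
Qed.

Lemma holo_ie (f : C -> C) : holo f -> (forall k, exists m, f (ZtoC k) = ZtoC m) ->
  exists F : IntEntire, forall z, F z = f z.
Proof.
intros Hf Hi. exists (mkIntEntire f (proj2 (entire_holo f) Hf) Hi). reflexivity.
Qed.

Lemma quotient_rational_principal (r : nat) (f : nat -> IntEntire) :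
  (forall n : Z, exists jn : nat, (1 <= jn <= S r)%nat /\
    forall j : nat, (1 <= j <= S r)%nat ->
      exists q : Q, quotient_value (f j) (f jn) (RtoC (IZR n)) (RtoC (Q2R q))) ->
  is_principal (fg_ideal (S r) f).
Proof.
intros HQ.
destruct (classic (exists j, (1 <= j <= S r)%nat /\ f j <> zero)) as [[j0 [hj0 nz]]|h].
2: { exists zero. intros h'. split.
  - intros [a Ha]. exists zero. rewrite Ha. apply ie_ext. intros z.
    rewrite ie_sum_csum, ie_multE, ie_zeroE. rewrite csum_eq0; [ring|].
    intros i hi. replace (f (S i)) with (zero : IntEntire); [rewrite ie_zeroE; ring|].
    symmetry. apply NNPP. intros n. apply h. exists (S i). split; [lia|exact n].
  - intros [a Ha]. exists (fun _ => zero). rewrite Ha. apply ie_ext. intros z.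
    rewrite ie_sum_csum, ie_multE, ie_zeroE. rewrite csum_eq0; [ring|].
    intros i hi. change (f (S i) z * RtoC 0 = RtoC 0)%C. ring. }
destruct (bezout_family (fun i => f (S i)) r) as [d [u [w [Hd [Hu [Hw [E S1]]]]]]].
{ intros i. apply ie_holo. }
destruct (integer_valued_bezout u w r Hu Hw S1) as [e [e' [v [He [He' [Hv [Ee [Iu [Iv S2]]]]]]]]].
{ intros k. destruct (HQ k) as [jn [hjn Hjn]].
  destruct jn as [|j]; [lia|]. exists j. split; [lia|]. intros i hi.
  destruct (Hjn (S i)) as [q Hq]; [lia|]. exists q.
  apply quotient_value_eq with (f (S i)) (f (S j)) d.
  (* If f_jn were zero, the first clause of [quotient_value] would annihilate the whole family,
     including f_j0. *)
  - intros Ej. apply nz. destruct (Hjn j0 hj0) as [q' [Z _]]. auto.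
  - apply holo_cont, Hu.
  - apply holo_cont, Hu.
  - intros z. apply E. lia.
  - intros z. apply E. lia.
  - exact Hq. }
destruct (choice (fun i (V : IntEntire) => forall z, V z = v i z)) as [V HV].
{ intros i. apply holo_ie; [apply Hv|]. intros k. apply Iv. }
destruct (choice (fun i (U : IntEntire) => (i < S r)%nat -> forall z, U z = (e z * u i z)%C)) as [U HU].
{ intros i. destruct (Nat.lt_ge_cases i (S r)) as [hi|hi].
  - destruct (holo_ie (fun z => e z * u i z)%C) as [F HF].
    + now apply holo_mult.
    + intros k. now apply Iu.
    + exists F. intros _. exact HF.
  - exists zero. intros; lia. }
(* Neither [d] nor [e'] need be integer-valued; their product is, by this expression, and the same
   expression puts it in the ideal. *)
assert (ED : forall z, (d z * e' z)%C = csum (fun i => f (S i) z * V i z)%C (S r)).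
{ intros z. rewrite (csum_ext _ (fun i => (d z * e' z) * (e z * u i z * v i z))%C).
  - rewrite csum_scal, S2. ring.
  - intros i hi. rewrite (E i z hi), HV.
    replace (d z * e' z * (e z * u i z * v i z))%C with ((e z * e' z) * (d z * u i z * v i z))%C by ring.
    rewrite Ee. ring. }
destruct (holo_ie (fun z => d z * e' z)%C) as [G HG].
{ now apply holo_mult. }
{ intros k. rewrite ED. apply csum_ie_int. intros i hi.
  destruct (ie_int (f (S i)) k) as [a Ha]. destruct (ie_int (V i) k) as [b Hb].
  exists (a * b)%Z. unfold ZtoC. rewrite Ha, Hb, mult_IZR, RtoC_mult. reflexivity. }
assert (Ef : forall i z, (i < S r)%nat -> f (S i) z = (G z * U i z)%C).
{ intros i z hi. rewrite HG, (HU i hi), (E i z hi).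
  replace (d z * e' z * (e z * u i z))%C with ((e z * e' z) * (d z * u i z))%C by ring.
  rewrite Ee. ring. }
exists G. intros h. split.
- intros [a Ha].
  exists (sum_n_m (fun j => mult (U (pred j)) (a j)) 1 (S r)). rewrite Ha. apply ie_ext. intros z.
  rewrite ie_multE, ie_sum_csum, (ie_sum_csum (fun j => U (pred j))), <- csum_scal.
  apply csum_ext. intros i hi. rewrite (Ef i z hi). simpl pred. ring.
- intros [a Ha]. exists (fun j => mult (V (pred j)) a). rewrite Ha. apply ie_ext. intros z.
  rewrite ie_sum_csum, ie_multE, HG, ED, Cmult_comm, <- csum_scal.
  apply csum_ext. intros i hi. rewrite ie_multE. simpl pred. ring.
Qed.

Theorem theorem2p9 (r : nat) (hr : (1 <= r)%nat) (f : nat -> IntEntire) :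
  is_principal (fg_ideal r f) <->
  forall n : Z, exists jn : nat, (1 <= jn <= r)%nat /\
    forall j : nat, (1 <= j <= r)%nat ->
      exists q : Q, quotient_value (f j) (f jn) (RtoC (IZR n)) (RtoC (Q2R q)).
Proof.
split.
- now apply principal_quotient_rational.
- destruct r as [|r]; [lia|]. apply quotient_rational_principal.
Qed.
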